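(* Let $p$ be an odd prime and $r\ge 2$. There is an algorithm which, given as input a simple undirected graph $X=(V,E)$ with $p^{2r+1}$ vertices, determines in time polynomial in the size of $X$ whether $X$ is (isomorphic to) the commuting graph of an extraspecial group of order $p^{2r+1}$ and, if so, labels the vertices of $X$ by unique group elements of such an extraspecial group $G$, i.e. computes a bijection $v\mapsto g_v$ from $V$ to $G$ such that two distinct vertices $u,v$ are adjacent in $X$ if and only if $g_u$ and $g_v$ commute in $G$.
   Context: The commuting graph $\Gamma(G)$ of a finite group $G$ is the simple undirected graph with vertex set $G$ (all elements, including central ones), in which two distinct elements are adjacent if and only if they commute. A $p$-group $G$ is extraspecial if its centre $Z(G)$ has order $p$ and coincides with the derived subgroup $G'$ and with the Frattini subgroup $\Phi(G)$; extraspecial $p$-groups have order $p^{2r+1}$ with $r\ge 1$, and for each prime $p$ and each $r\ge1$ there are exactly two of that order up to isomorphism. *)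

(* Defs.v *)
From mathcomp Require Import all_boot all_order all_fingroup all_solvable.

Set Implicit Arguments.
Unset Strict Implicit.
Unset Printing Implicit Defensive.

(* The model of computation is Jones' WHILE language over binary trees         *)
(* (N. D. Jones, Computability and Complexity from a Programming Perspective): *)
(* a program is a fixed finite command that can only build pairs, take them    *)
(* apart and test for emptiness.  Jones charges one unit per operation; here   *)
(* each operation is charged the full size of the tree it yields, so trees     *)
(* shared in memory are paid for at each use, the size of the store is at most *)
(* linear in input size plus time, and a Turing machine simulates a program    *)
(* with polynomial overhead (and conversely).                                  *)

Inductive tree : Type := Leaf | Pair of tree & tree.

Fixpoint tree_size (t : tree) : nat :=
  if t is Pair a b then (tree_size a + tree_size b).+1 else 1.

Definition is_pair (t : tree) : bool := if t is Pair _ _ then true else false.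

Inductive expr : Type :=
  | EVar of nat
  | ELeaf
  | EPair of expr & expr
  | EFst of expr
  | ESnd of expr.

Inductive cmd : Type :=
  | CSkip
  | CAssign of nat & expr
  | CSeq of cmd & cmd
  | CIf of expr & cmd & cmd
  | CWhile of expr & cmd.

Definition store : Type := nat -> tree.

Definition upd (s : store) (x : nat) (v : tree) : store :=
  fun y => if y == x then v else s y.

Fixpoint eval (s : store) (e : expr) : tree :=
  match e with
  | EVar x => s x
  | ELeaf => Leaf
  | EPair e1 e2 => Pair (eval s e1) (eval s e2)
  | EFst e1 => if eval s e1 is Pair a _ then a else Leaf
  | ESnd e1 => if eval s e1 is Pair _ b then b else Leaf
  end.

Fixpoint ecost (s : store) (e : expr) : nat :=
  tree_size (eval s e) +
  match e with
  | EVar _ | ELeaf => 0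
  | EPair e1 e2 => ecost s e1 + ecost s e2
  | EFst e1 | ESnd e1 => ecost s e1
  end.

(* [exec c s t s'] : started in store s, c halts after time t in store s'. *)
Inductive exec : cmd -> store -> nat -> store -> Prop :=
  | ExSkip s : exec CSkip s 1 s
  | ExAssign s x e : exec (CAssign x e) s (ecost s e).+1 (upd s x (eval s e))
  | ExSeq c1 c2 s1 s2 s3 t1 t2 :
      exec c1 s1 t1 s2 -> exec c2 s2 t2 s3 -> exec (CSeq c1 c2) s1 (t1 + t2) s3
  | ExIf e c1 c2 s s' t :
      exec (if is_pair (eval s e) then c1 else c2) s t s' ->
      exec (CIf e c1 c2) s (ecost s e + t).+1 s'
  | ExWhileStop e c s :
      ~~ is_pair (eval s e) -> exec (CWhile e c) s (ecost s e).+1 s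
  | ExWhileStep e c s1 s2 s3 t1 t2 :
      is_pair (eval s1 e) -> exec c s1 t1 s2 -> exec (CWhile e c) s2 t2 s3 ->
      exec (CWhile e c) s1 (ecost s1 e + t1 + t2).+1 s3.

(* Variable 0 carries the input and, at the end, the output. *)
Definition computes (c : cmd) (inp : tree) (t : nat) (out : tree) : Prop :=
  exists s : store, exec c (upd (fun=> Leaf) 0 inp) t s /\ s 0 = out.

Definition enc_bool (b : bool) : tree := if b then Pair Leaf Leaf else Leaf.

(* Unary; harmless for complexity, since every number encoded below is smaller *)
(* than the number of vertices of the input graph.                             *)
Definition enc_nat (n : nat) : tree := iter n (Pair Leaf) Leaf.

Definition enc_seq (T : Type) (enc : T -> tree) (s : seq T) : tree :=
  foldr (fun x => Pair (enc x)) Leaf s.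

(* The adjacency matrix, with the vertices taken in the order of enum V. *)
Definition enc_graph (V : finType) (e : rel V) : tree :=
  enc_seq (enc_seq enc_bool) [seq [seq e u v | v <- enum V] | u <- enum V].

Definition commuting_graph (gT : finGroupType) : rel gT :=
  [rel x y | (x != y) && ((x * y)%g == (y * x)%g)].

Definition extraspecial_of_order (m : nat) (gT : finGroupType) : Prop :=
  extraspecial [set: gT] /\ #|gT| = m.

Definition commuting_labelling
    (V : finType) (e : rel V) (gT : finGroupType) (g : V -> gT) : Prop :=
  bijective g /\ forall u v, e u v = commuting_graph (g u) (g v).

(* The Cayley table of gT when the elements are numbered 0, 1, ... along s. *)
Definition mul_table (gT : finGroupType) (s : seq gT) : seq (seq nat) :=
  [seq [seq index (x * y)%g s | y <- s] | x <- s].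

(* A positive answer names the group elements by numbers and is made of the    *)
(* Cayley table of the group, which gives these names their meaning, together  *)
(* with the list of the names of the labels of the vertices.                   *)
Definition enc_labelling (V : finType) (gT : finGroupType) (s : seq gT)
    (g : V -> gT) : tree :=
  Pair (enc_seq (enc_seq enc_nat) (mul_table s))
       (enc_seq enc_nat [seq index (g v) s | v <- enum V]).

Definition is_extraspecial_commuting_graph
    (m : nat) (V : finType) (e : rel V) : Prop :=
  exists (gT : finGroupType) (g : V -> gT),
    extraspecial_of_order m gT /\ commuting_labelling e g.

Definition correct_answer
    (m : nat) (V : finType) (e : rel V) (out : tree) : Prop :=
  (is_extraspecial_commuting_graph m e ->
     exists (gT : finGroupType) (s : seq gT) (g : V -> gT),
       [/\ extraspecial_of_order m gT,
           perm_eq s (enum gT),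
           commuting_labelling e g
         & out = enc_labelling s g])
  /\ (~ is_extraspecial_commuting_graph m e -> out = Leaf).

(* Main.v *)
Require Import Defs.
From HB Require Import structures.
From mathcomp Require Import all_boot all_order all_algebra all_fingroup all_solvable.
From mathcomp Require Import zify ring.

Set Implicit Arguments.
Unset Strict Implicit.
Unset Printing Implicit Defensive.

(** The commuting graph of an extraspecial group G of order p ^ (2 r + 1) only records an alternating
    form: two elements commute if and only if their images in G / Z(G) = F_p ^ (2 r) are orthogonal
    for the form defined by commutators. Non-degenerate alternating forms have hyperbolic bases, so
    there is only one graph to recognize, the commuting graph of the Heisenberg group [heis p r],
    and the task is to compute an isomorphism from the input onto it.

    The algorithm, [label_graph], writes down the elements s_0, s_1, ... of [heis p r] in a suitable
    order and matches them greedily, without backtracking: s_j is sent to the first unused vertex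
    that is joined to the vertices chosen for the s_i with i < j in the same way as s_j is joined to
    the s_i, and that is joined to all vertices if and only if s_j is central. A run that never gets
    stuck has found an isomorphism, whatever the input is ([run_sound]); if a run gets stuck, the
    answer is negative. So what matters is that no choice can be wrong when some isomorphism exists
    ([run_complete]). The invariant is that the choices made so far extend to an isomorphism. It
    is preserved if every element v that looks like s_j from s_0, ..., s_(j-1) is carried to s_j, up
    to twins, by a symmetry of the model that keeps all earlier s_i in their classes of twins
    ([good]); twins are elements with the same centralizer, and they can be exchanged at will
    ([exact_of_twins]).

    The order of the elements makes this true ([chain_vector_seq]). With e_i, f_i for the standard
    hyperbolic basis, it starts with e_0, f_0, e_1, f_1, ...: partial hyperbolic bases extend, and
    any two bases are related by a symmetry ([extraspecial_labelling]). Then come the e_0 + e_i and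
    e_0 + f_0, for which one can still rescale the basis vectors ([good_scaling], [good_unit]). This
    uses up all the freedom, and from then on every vector is determined up to a scalar by the
    earlier vectors orthogonal to it ([pinned]). Within the plane pairs (e_0, f_0), (e_i, f_i), a
    chain of such vectors leads from the ratio k to the ratio k + 1 ([step_v], [step_t], [step_g]);
    this is how the prime field is coordinatized from the incidence of points and hyperplanes. Once
    all ratios are available, the vectors with two non-zero coordinates in the first pair are pinned
    ([pinned_full_head]), and these pin all the others ([pinned_any]).

    On the side of complexity, no program is written out. The predicate [ptime] says that a function
    between encoded types has a polynomial-time program that may run at any offset in the store; it
    is closed under composition, pairing, conditionals and [foldl], and the closure under [foldl]
    only asks for a polynomial bound on the size of the accumulator. The algorithm is then an
    ordinary function on lists, shown to be [ptime] by composition. *)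

(** * Encoded types and polynomial bounds *)

Class Enc (A : Type) := enc : A -> tree.
#[global] Instance Enc_tree : Enc tree := id.
#[global] Instance Enc_unit : Enc unit := fun=> Leaf.
#[global] Instance Enc_bool : Enc bool := enc_bool.
#[global] Instance Enc_nat : Enc nat := enc_nat.
#[global] Instance Enc_prod A B `{Enc A, Enc B} : Enc (A * B) :=
  fun z => Pair (enc z.1) (enc z.2).
#[global] Instance Enc_seq A `{Enc A} : Enc (seq A) := enc_seq enc.

Definition esize {A} `{Enc A} (x : A) := tree_size (enc x).

Lemma tree_size_gt0 t : 0 < tree_size t. Proof. by case: t. Qed.
Lemma esize_gt0 A `{Enc A} (x : A) : 0 < esize x.
Proof. exact: tree_size_gt0. Qed.

Section Bounds.
Context {A : Type} {eA : Enc A}.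
Implicit Types N : A -> nat.

(** Encodings have positive size, so that a monomial in the size is a general polynomial bound. *)
Definition pbound N := exists a k, forall x, N x <= a * esize x ^ k.

Lemma pbound_le N N' : (forall x, N x <= N' x) -> pbound N' -> pbound N.
Proof. by move=> le [a [k H]]; exists a, k => x; apply: leq_trans (H x). Qed.

Lemma pbound_const c : pbound (fun=> c).
Proof. by exists c, 0 => x; rewrite expn0 muln1. Qed.

Lemma pbound_esize : pbound esize.
Proof. by exists 1, 1 => x; rewrite expn1 mul1n. Qed.

Lemma pboundD N N' : pbound N -> pbound N' -> pbound (fun x => N x + N' x).
Proof.
move=> [a [k H]] [a' [k' H']]; exists (a + a'), (k + k') => x.
have t0 := esize_gt0 x.
rewrite mulnDl leq_add // (leq_trans (H x), leq_trans (H' x)) // leq_mul2l;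
  apply/orP; right; by rewrite leq_pexp2l ?leq_addr ?leq_addl.
Qed.

Lemma pboundM N N' : pbound N -> pbound N' -> pbound (fun x => N x * N' x).
Proof.
move=> [a [k H]] [a' [k' H']]; exists (a * a'), (k + k') => x.
by rewrite expnD mulnACA leq_mul.
Qed.

Lemma pboundX N k : pbound N -> pbound (fun x => N x ^ k).
Proof.
move=> bN; elim: k => [|k IH]; first exact: pbound_const.
by apply: (pbound_le _ (pboundM bN IH)) => x; rewrite expnS.
Qed.
End Bounds.

Lemma pbound_comp A B `{Enc A, Enc B} (N : B -> nat) (f : A -> B) :
  pbound N -> pbound (fun x => esize (f x)) -> pbound (fun x => N (f x)).
Proof.
move=> [a [k bN]] bf; apply: (pbound_le (fun x => bN (f x))).
exact: pboundM (pbound_const a) (pboundX k bf).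
Qed.

(** * Polynomial-time functions *)

(** Programs that may be embedded anywhere: all of their variables are [d] and above,
    whatever these contain at the start. *)
Definition ptime A B `{Enc A, Enc B} (f : A -> B) :=
  exists (C : nat -> cmd) (N : A -> nat), pbound N /\
  forall d s x, s d = enc x -> exists t s',
    [/\ exec (C d) s t s', s' d = enc (f x),
        (forall y, y < d -> s' y = s y) & t <= N x].

(** Time bounds space, as an assignment costs at least the size of the tree that it stores. *)
Lemma exec_size c s t s' : exec c s t s' ->
  forall y, tree_size (s' y) <= tree_size (s y) + t.
Proof.
elim=> {c s t s'} //=.
- by move=> s y; rewrite leq_addr.
- move=> s x e y; rewrite /upd; case: eqP => _; last by rewrite leq_addr.
  by case: e => [z||e1 e2|e1|e1] /=; lia.
- by move=> c1 c2 s1 s2 s3 t1 t2 _ H1 _ H2 y; move: (H1 y) (H2 y); lia.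
- by move=> e c1 c2 s s' t _ H y; move: (H y); lia.
- by move=> e c s _ y; lia.
- by move=> e c s1 s2 s3 t1 t2 _ _ H1 _ H2 y; move: (H1 y) (H2 y); lia.
Qed.

Lemma ptime_size A B (eA : Enc A) (eB : Enc B) (f : A -> B) :
  ptime f -> pbound (fun x => esize (f x)).
Proof.
case=> C [N [bN H]]; apply: pbound_le (pboundD pbound_esize bN) => x.
have [t [s' [ex eq_out _ le]]] := H 0 (upd (fun=> Leaf) 0 (enc x)) x erefl.
by have := exec_size ex 0; rewrite eq_out /upd eqxx /esize; lia.
Qed.

Section Ptime.
Context {X A B D : Type} {eX : Enc X} {eA : Enc A} {eB : Enc B} {eD : Enc D}.

Lemma ptime_ext (f g : A -> B) : f =1 g -> ptime f -> ptime g.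
Proof.
move=> fg [C [N [bN H]]]; exists C, N; split=> // d s x /H[t [s' [? ? ? ?]]].
by exists t, s'; rewrite -fg.
Qed.

(** Changing only the type under which a tree is read costs nothing. *)
Lemma ptime_cast (f : A -> B) : (forall x, enc (f x) = enc x) -> ptime f.
Proof.
move=> fE; exists (fun=> CSkip), (fun=> 1); split; first exact: pbound_const.
move=> d s x sd; exists 1, s; split=> //; [exact: ExSkip | by rewrite fE].
Qed.

Lemma ptime_comp (f : A -> B) (g : B -> D) :
  ptime f -> ptime g -> ptime (fun x => g (f x)).
Proof.
move=> pf pg; have bf := ptime_size pf.
case: pf pg => [C [N [bN H]]] [C' [N' [bN' H']]].
exists (fun d => CSeq (C d) (C' d)), (fun x => N x + N' (f x)).
split; first exact: pboundD bN (pbound_comp bN' bf).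
move=> d s x /H[t [s1 [ex1 o1 k1 t1]]].
have [t' [s2 [ex2 o2 k2 t2]]] := H' _ _ _ o1.
exists (t + t'), s2; split=> //; first exact: ExSeq ex1 ex2.
  by move=> y yd; rewrite k2 // k1.
exact: leq_add.
Qed.

Lemma ptime_const (b : B) : ptime (fun _ : A => b).
Proof.
pose fix build t := if t is Pair u v then EPair (build u) (build v) else ELeaf.
have evalE s t : eval s (build t) = t.
  by elim: t => //= u -> v ->.
have costE s s' t : ecost s (build t) = ecost s' (build t).
  by elim: t => //= u -> v ->; rewrite !evalE.
exists (fun d => CAssign d (build (enc b))).
exists (fun=> (ecost (fun=> Leaf) (build (enc b))).+1).
split; first exact: pbound_const.
move=> d s x _; eexists; eexists; split; first exact: ExAssign.
- by rewrite /upd eqxx evalE.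
- by move=> y yd; rewrite /upd ltn_eqF.
- by rewrite (costE s (fun=> Leaf)).
Qed.

Lemma ptime_pair (f : X -> A) (g : X -> B) :
  ptime f -> ptime g -> ptime (fun x => (f x, g x)).
Proof.
move=> pf pg; have bf := ptime_size pf; have bg := ptime_size pg.
case: pf pg => [C [N [bN H]]] [C' [N' [bN' H']]].
exists (fun d => CSeq (CAssign d.+1 (EVar d)) (CSeq (C d.+1)
  (CSeq (CAssign d.+2 (EVar d)) (CSeq (C' d.+2)
  (CAssign d (EPair (EVar d.+1) (EVar d.+2))))))).
exists (fun x => 6 + 2 * esize x + N x + N' x + 2 * esize (f x) + 2 * esize (g x)).
split.
  by repeat first [exact: bN | exact: bN' | exact: bf | exact: bg
    | exact: pbound_esize | exact: pbound_const | apply: pboundD | apply: pboundM].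
move=> d s x sd.
set s1 := upd s d.+1 (enc x).
have s1d : s1 d.+1 = enc x by rewrite /s1 /upd eqxx.
have [t1 [s2 [ex1 o1 k1 le1]]] := H _ _ _ s1d.
set s3 := upd s2 d.+2 (enc x).
have s3d : s3 d.+2 = enc x by rewrite /s3 /upd eqxx.
have [t2 [s4 [ex2 o2 k2 le2]]] := H' _ _ _ s3d.
have s2d : s2 d = enc x by rewrite k1 // /s1 /upd ltn_eqF // sd.
have s4d1 : s4 d.+1 = enc (f x) by rewrite k2 // /s3 /upd ltn_eqF // o1.
eexists; eexists; split.
- apply: ExSeq; first exact: ExAssign.
  rewrite /= sd -/s1; apply: ExSeq; first exact: ex1.
  apply: ExSeq; first exact: ExAssign.
  rewrite /= s2d -/s3; apply: ExSeq; first exact: ex2.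
  exact: ExAssign.
- by rewrite /= /upd eqxx s4d1 o2.
- move=> y yd; have [yd1 yd2] : y < d.+1 /\ y < d.+2 by lia.
  by rewrite /upd ltn_eqF // k2 // /s3 /upd ltn_eqF // k1 // /s1 /upd ltn_eqF.
- by rewrite /= sd s2d s4d1 o2 /esize; move: le1 le2; rewrite /esize; lia.
Qed.

Lemma ptime_efst (f : X -> A) :
  (forall x, enc (f x) = if enc x is Pair u _ then u else Leaf) -> ptime f.
Proof.
move=> fE; exists (fun d => CAssign d (EFst (EVar d))), (fun x => 2 * esize x + 1).
split; first exact: pboundD (pboundM (pbound_const _) pbound_esize) (pbound_const _).
move=> d s x sd; eexists; eexists; split; first exact: ExAssign.
- by rewrite /upd eqxx /= sd -fE.
- by move=> z zd; rewrite /upd ltn_eqF.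
- by rewrite /= sd /esize; case: (enc x) => [|u v] /=; lia.
Qed.

Lemma ptime_esnd (f : X -> A) :
  (forall x, enc (f x) = if enc x is Pair _ u then u else Leaf) -> ptime f.
Proof.
move=> fE; exists (fun d => CAssign d (ESnd (EVar d))), (fun x => 2 * esize x + 1).
split; first exact: pboundD (pboundM (pbound_const _) pbound_esize) (pbound_const _).
move=> d s x sd; eexists; eexists; split; first exact: ExAssign.
- by rewrite /upd eqxx /= sd -fE.
- by move=> z zd; rewrite /upd ltn_eqF.
- by rewrite /= sd /esize; case: (enc x) => [|u v] /=; lia.
Qed.

Lemma ptime_if (b : X -> bool) (f g : X -> A) :
  ptime b -> ptime f -> ptime g -> ptime (fun x => if b x then f x else g x).
Proof.
move=> [C [N [bN H]]] [C1 [N1 [bN1 H1]]] [C2 [N2 [bN2 H2]]].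
exists (fun d => CSeq (CAssign d.+1 (EVar d)) (CSeq (C d.+1)
  (CIf (EVar d.+1) (C1 d) (C2 d)))).
exists (fun x => esize x + N x + N1 x + N2 x + 8).
split.
  by repeat first [exact: bN | exact: bN1 | exact: bN2
    | exact: pbound_esize | exact: pbound_const | apply: pboundD | apply: pboundM].
move=> d s x sd.
set s1 := upd s d.+1 (enc x).
have s1d : s1 d.+1 = enc x by rewrite /s1 /upd eqxx.
have [t1 [s2 [ex1 o1 k1 le1]]] := H _ _ _ s1d.
have s2d : s2 d = enc x by rewrite k1 // /s1 /upd ltn_eqF // sd.
have keep y : y < d -> s2 y = s y.
  move=> yd; have yd1 : y < d.+1 by lia.
  by rewrite k1 // /s1 /upd ltn_eqF.
have E : is_pair (s2 d.+1) = b x by rewrite o1; case: (b x).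
have E3 : tree_size (s2 d.+1) <= 3 by rewrite o1; case: (b x).
case bx: (b x).
- have [t2 [s3 [ex2 o2 k2 le2]]] := H1 _ _ _ s2d.
  eexists; exists s3; split.
  + apply: ExSeq; first exact: ExAssign.
    rewrite /= sd -/s1; apply: ExSeq; first exact: ex1.
    by apply: ExIf; rewrite /= E bx; apply: ex2.
  + exact: o2.
  + by move=> y yd; rewrite k2 // keep.
  + by rewrite /= sd; move: le1 le2 E3; rewrite /esize; lia.
- have [t2 [s3 [ex2 o2 k2 le2]]] := H2 _ _ _ s2d.
  eexists; exists s3; split.
  + apply: ExSeq; first exact: ExAssign.
    rewrite /= sd -/s1; apply: ExSeq; first exact: ex1.
    by apply: ExIf; rewrite /= E bx; apply: ex2.
  + exact: o2.
  + by move=> y yd; rewrite k2 // keep.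
  + by rewrite /= sd; move: le1 le2 E3; rewrite /esize; lia.
Qed.

Lemma esize_cons (a : A) l : esize (a :: l) = (esize a + esize l).+1.
Proof. by []. Qed.

(** The only iteration principle. The cost of a step is polynomial in the size of its argument, hence
    polynomial in the input as soon as the accumulators are; the list bounds the number of steps. *)
Lemma ptime_foldl (step : X -> B -> A -> B) (b0 : X -> B) (l : X -> seq A)
    (N : X -> nat) :
  ptime (fun z : X * (B * A) => step z.1 z.2.1 z.2.2) -> ptime b0 -> ptime l ->
  pbound N ->
  (forall x l1 l2, l x = l1 ++ l2 -> esize (foldl (step x) (b0 x) l1) <= N x) ->
  ptime (fun x => foldl (step x) (b0 x) (l x)).
Proof.
move=> [C [Ns [[a [k bNs]] H]]] pb pl bN HN.
have bl := ptime_size pl; have bb := ptime_size pb.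
case: pb pl => [Cb [Nb [bNb Hb]]] [Cl [Nl [bNl Hl]]].
pose W d := CWhile (EVar d.+1)
  (CSeq (CAssign d.+3 (EPair (EVar d) (EPair (EVar d.+2) (EFst (EVar d.+1)))))
  (CSeq (C d.+3) (CSeq (CAssign d.+2 (EVar d.+3))
                       (CAssign d.+1 (ESnd (EVar d.+1)))))).
exists (fun d => CSeq (CAssign d.+1 (EVar d)) (CSeq (Cl d.+1)
  (CSeq (CAssign d.+2 (EVar d)) (CSeq (Cb d.+2)
  (CSeq (W d) (CAssign d (EVar d.+2))))))).
(* [M x] bounds the argument of every step and [K x] the time of one turn of the loop. *)
pose M (x : X) := @esize X eX x + N x + @esize (seq A) (@Enc_seq A eA) (l x) + 2.
pose K (x : X) := 10 * M x + a * M x ^ k + 10.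
exists (fun x => 6 + 2 * esize x + Nl x + Nb x + N x + (esize (l x) + 1) * K x).
have bM : pbound M.
  by repeat first [exact: bN | exact: bl
    | exact: pbound_esize | exact: pbound_const | apply: pboundD].
split.
  by repeat first [exact: bN | exact: bl | exact: bNl | exact: bNb | exact: pboundX
    | exact: pbound_esize | exact: pbound_const | apply: pboundD | apply: pboundM].
move=> d s x sd.
have loop l2 : forall l1 s, l x = l1 ++ l2 -> s d = enc x -> s d.+1 = enc l2 ->
    s d.+2 = enc (foldl (step x) (b0 x) l1) ->
    exists t s', [/\ exec (W d) s t s', s' d.+2 = enc (foldl (step x) (b0 x) (l x)),
      (forall y, y <= d -> s' y = s y) & t <= esize l2 * K x].
  elim: l2 => [|y l2 IH] l1 {sd}s lE sd s1 s2.
    eexists; exists s; split.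
    - by apply: ExWhileStop; rewrite /= s1.
    - by rewrite s2 lE cats0.
    - by [].
    - by rewrite /= s1 /= /esize /K mul1n; lia.
  set b := foldl _ _ _ in s2.
  have bb' : esize b <= N x by apply: HN lE.
  have ly : esize (y :: l2) <= esize (l x).
    rewrite lE; elim: (l1) => [|z l3 IH3]; first by rewrite leqnn.
    by rewrite cat_cons [X in _ <= X]esize_cons; lia.
  set st1 := upd s d.+3 (enc (x, (b, y))).
  have st1d : st1 d.+3 = enc (x, (b, y)) by rewrite /st1 /upd eqxx.
  have [t1 [st2 [ex1 o1 k1 le1]]] := H _ _ _ st1d.
  set st3 := upd st2 d.+2 (enc (step x b y)).
  have k2 z : z <= d.+2 -> st2 z = s z.
    by move=> zd; rewrite k1 // /st1 /upd ltn_eqF.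
  set st4 := upd st3 d.+1 (enc l2).
  have st3d1 : st3 d.+1 = enc (y :: l2) by rewrite /st3 /upd ltn_eqF // k2.
  have k3 z : z <= d -> st4 z = s z.
    move=> zd; rewrite /st4 /st3 /upd !ltn_eqF ?k2 //; lia.
  have [| | | |t2 [s' [ex2 o2 k4 le2]]] := IH (rcons l1 y) st4.
  - by rewrite cat_rcons.
  - by rewrite k3.
  - by rewrite /st4 /upd eqxx.
  - by rewrite /st4 /st3 /upd gtn_eqF // eqxx foldl_rcons.
  have lx : esize (x, (b, y)) <= M x.
    by move: bb' ly; rewrite esize_cons /M /esize /=; lia.
  have le1' : t1 <= a * M x ^ k.
    apply: leq_trans le1 _; apply: leq_trans (bNs _) _.
    by rewrite leq_mul2l; case: (k) => [|k']; rewrite ?expn0 ?leq_exp2r ?lx ?orbT.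
  have st4E : st4 = upd st3 d.+1 (eval st3 (ESnd (EVar d.+1))).
    by rewrite /= st3d1.
  have st3E : st3 = upd st2 d.+2 (eval st2 (EVar d.+3)) by rewrite /= o1.
  have bn : esize (step x b y) <= N x.
    by rewrite -[step x b y](foldl_rcons (step x)); apply: HN; rewrite lE -cat_rcons.
  eexists; exists s'; split.
  - apply: ExWhileStep; [by rewrite /= s1 | | exact: ex2].
    apply: ExSeq; first exact: ExAssign.
    rewrite /= sd s2 s1 /= -/st1; apply: ExSeq; first exact: ex1.
    apply: ExSeq; first exact: ExAssign.
    rewrite -st3E st4E; exact: ExAssign.
  - by [].
  - by move=> z zd; rewrite k4 // k3.
  - rewrite /= st3d1 sd s2 s1 o1 /=.
    rewrite esize_cons in ly *.
    have : (esize l2 + 1) * K x <= (esize y + esize l2).+1 * K x.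
      by rewrite leq_mul2r; lia.
    apply: leq_trans; rewrite mulnDl mul1n addnC.
    rewrite -[Enc_seq l2]/(enc l2).
    move: (tree_size (enc l2) * K x) le2 le1' bn bb' ly; rewrite /K /M /esize /=; lia.
set s1 := upd s d.+1 (enc x).
have s1d : s1 d.+1 = enc x by rewrite /s1 /upd eqxx.
have [t1 [s2 [ex1 o1 k1 le1]]] := Hl _ _ _ s1d.
set s3 := upd s2 d.+2 (enc x).
have s3d : s3 d.+2 = enc x by rewrite /s3 /upd eqxx.
have [t2 [s4 [ex2 o2 k2 le2]]] := Hb _ _ _ s3d.
have s2k y : y <= d -> s2 y = s y.
  by move=> yd; rewrite k1 // /s1 /upd ltn_eqF.
have s4k y : y <= d.+1 -> s4 y = s2 y.
  by move=> yd; rewrite k2 // /s3 /upd ltn_eqF.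
have [| | | |t3 [s5 [ex3 o3 k3 le3]]] := loop (l x) [::] s4.
- by [].
- by rewrite s4k // s2k.
- by rewrite s4k.
- by [].
eexists; eexists; split.
- apply: ExSeq; first exact: ExAssign.
  rewrite /= sd -/s1; apply: ExSeq; first exact: ex1.
  apply: ExSeq; first exact: ExAssign.
  rewrite /= s2k // sd -/s3; apply: ExSeq; first exact: ex2.
  apply: ExSeq; first exact: ex3.
  exact: ExAssign.
- by rewrite /= /upd eqxx o3.
- move=> y yd; have yd' := ltnW yd.
  by rewrite /upd ltn_eqF // k3 // s4k ?s2k // ltnW.
- have := HN x (l x) [::]; rewrite cats0 => /(_ erefl).
  rewrite /= s2k // sd o3 mulnDl; move: le1 le2 le3; rewrite /esize; lia.
Qed.

End Ptime.

(** * Basic operations on lists and numbers *)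

Section Projections.
Context {X A B D : Type} {eX : Enc X} {eA : Enc A} {eB : Enc B} {eD : Enc D}.

Lemma ptime_id : ptime (fun x : X => x).
Proof. exact: ptime_cast. Qed.

Lemma ptime_comp2 (F : A -> B -> D) (f : X -> A) (g : X -> B) :
  ptime (fun z : A * B => F z.1 z.2) -> ptime f -> ptime g ->
  ptime (fun x => F (f x) (g x)).
Proof. by move=> pF pf pg; apply: ptime_comp (ptime_pair pf pg) pF. Qed.

Lemma ptime_proj1 (f : X -> A * B) : ptime f -> ptime (fun x => (f x).1).
Proof. by move=> pf; apply: ptime_comp pf _; apply: ptime_efst. Qed.

Lemma ptime_proj2 (f : X -> A * B) : ptime f -> ptime (fun x => (f x).2).
Proof. by move=> pf; apply: ptime_comp pf _; apply: ptime_esnd. Qed.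

End Projections.

Section Operations.
Context {X A B D : Type} {eX : Enc X} {eA : Enc A} {eB : Enc B} {eD : Enc D}.

Lemma ptime_cons (f : X -> A) (g : X -> seq A) :
  ptime f -> ptime g -> ptime (fun x => f x :: g x).
Proof. by move=> pf pg; apply: ptime_comp2 pf pg; apply: ptime_cast. Qed.

Lemma ptime_S (f : X -> nat) : ptime f -> ptime (fun x => (f x).+1).
Proof.
move=> pf; apply: (@ptime_comp2 _ _ _ _ _ _ _ _ (fun (_ : unit) n => n.+1) (fun=> tt)).
- exact: ptime_cast.
- exact: ptime_const.
- exact: pf.
Qed.

Lemma ptime_negb (b : X -> bool) : ptime b -> ptime (fun x => ~~ b x).
Proof.
by move=> pb; apply: (ptime_if pb); apply: ptime_const.
Qed.

Lemma ptime_andb (b c : X -> bool) :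
  ptime b -> ptime c -> ptime (fun x => b x && c x).
Proof. by move=> pb pc; apply: (ptime_if pb pc); apply: ptime_const. Qed.

Lemma ptime_eqb (b c : X -> bool) :
  ptime b -> ptime c -> ptime (fun x => b x == c x).
Proof.
move=> pb pc; apply: (@ptime_ext _ _ _ _ (fun x => if b x then c x else ~~ c x)).
  by move=> x; case: (b x); case: (c x).
by apply: ptime_if => //; apply: ptime_negb.
Qed.

Lemma esize_nat (n : nat) : esize n = n.*2.+1.
Proof.
elim: n => // n IH; have -> : esize n.+1 = (esize n).+2 by []; rewrite IH; lia.
Qed.

Lemma esize_pair (a : A) (b : B) : esize (a, b) = (esize a + esize b).+1.
Proof. by []. Qed.

Lemma esize_seq (l : seq A) : esize l = (sumn [seq (esize a).+1 | a <- l]).+1.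
Proof. by elim: l => //= a l IH; rewrite esize_cons IH /=; lia. Qed.

Lemma esize_cat (l1 l2 : seq A) : (esize (l1 ++ l2)).+1 = esize l1 + esize l2.
Proof. by rewrite !esize_seq map_cat sumn_cat; lia. Qed.

Lemma esize_rev (l : seq A) : esize (rev l) = esize l.
Proof. by rewrite !esize_seq map_rev sumn_rev. Qed.

Lemma size_esize (l : seq A) : (size l).*2 < esize l.
Proof.
elim: l => // a l IH; rewrite esize_cons [size _]/=.
have a0 : 0 < esize a by exact: esize_gt0.
by lia.
Qed.

Lemma esize_bound (l : seq A) M : all (fun a => esize a <= M) l ->
  esize l <= (size l * M.+1).+1.
Proof.
by elim: l => //= a l IH /andP[aM /IH]; rewrite esize_cons; lia.
Qed.

(** A number is encoded as the list of as many units, so iterating is folding over that list. *)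
Lemma ptime_iter (step : X -> A -> A) (a0 : X -> A) (n N : X -> nat) :
  ptime (fun z : X * A => step z.1 z.2) -> ptime a0 -> ptime n -> pbound N ->
  (forall x i, i <= n x -> esize (iter i (step x) (a0 x)) <= N x) ->
  ptime (fun x => iter (n x) (step x) (a0 x)).
Proof.
move=> ps pa pn bN HN.
have E x l : foldl (fun a (_ : unit) => step x a) (a0 x) l
    = iter (size l) (step x) (a0 x).
  by elim/last_ind: l => //= l u IH; rewrite foldl_rcons size_rcons IH.
apply: (@ptime_ext _ _ _ _ (fun x => foldl (fun a _ => step x a) (a0 x) (nseq (n x) tt))).
  by move=> x; rewrite E size_nseq.
apply: (@ptime_foldl _ _ _ _ _ _ (fun x a _ => step x a) _ _ N) => //.
- apply: (@ptime_comp2 _ _ _ _ _ _ _ _ step) ps _ _.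
  + by apply: ptime_efst.
  + by apply: ptime_proj1; apply: ptime_esnd.
- apply: ptime_comp pn _; apply: ptime_cast => k.
  by elim: k => //= k IH; rewrite /enc /= in IH *; rewrite IH.
move=> x l1 l2 /(congr1 size); rewrite E size_nseq size_cat => nE.
by apply: HN; rewrite nE leq_addr.
Qed.
End Operations.

Ltac pbound_tac := repeat first [ assumption | apply: pbound_const
  | apply: pboundD | apply: pboundM | apply: pboundX
  | apply: pbound_esize | (apply: ptime_size; assumption) ].

Lemma pboundS A (eA : Enc A) (N : A -> nat) : pbound N -> pbound (fun x => (N x).+1).
Proof.
by move=> bN; apply: (pbound_le _ (pboundD bN (pbound_const 1))) => x; rewrite addn1.
Qed.

Section Lists.
Context {X A B : Type} {eX : Enc X} {eA : Enc A} {eB : Enc B}.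

Lemma ptime_behead (l : X -> seq A) : ptime l -> ptime (fun x => behead (l x)).
Proof. by move=> pl; apply: ptime_comp pl _; apply: ptime_esnd; case. Qed.

Lemma ptime_nilp (l : X -> seq A) : ptime l -> ptime (fun x => nilp (l x)).
Proof.
move=> pl.
apply: (@ptime_ext _ _ _ _ (fun x => foldl (fun _ _ => false) true (l x))).
  by move=> x; case: (l x) => //= a s; elim: s.
apply: (@ptime_foldl _ _ _ _ _ _ (fun _ _ _ => false) _ _ (fun=> 3)) => //.
- exact: ptime_const.
- exact: ptime_const.
- exact: pbound_const.
- by move=> x l1 l2 _; case: foldl.
Qed.

Lemma ptime_head (d : X -> A) (l : X -> seq A) : ptime d -> ptime l ->
  ptime (fun x => head (d x) (l x)).
Proof.
move=> pd pl.
pose step (_ : X) (o : bool * A) (a : A) := if o.1 then o else (true, a).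
have stepT x a l0 : foldl (step x) (true, a) l0 = (true, a) by elim: l0.
apply: (@ptime_ext _ _ _ _ (fun x => (foldl (step x) (false, d x) (l x)).2)).
  by move=> x; case: (l x) => //= a s; rewrite stepT.
apply: ptime_proj2.
apply: (@ptime_foldl _ _ _ _ _ _ step _ _ (fun x => esize (d x) + esize (l x) + 4)) => //.
- apply: ptime_if.
  + by do 2 apply: ptime_proj1; apply: ptime_esnd.
  + by apply: ptime_proj1; apply: ptime_esnd.
  + apply: ptime_pair; first exact: ptime_const.
    by apply: ptime_proj2; apply: ptime_esnd.
- by apply: ptime_pair pd; apply: ptime_const.
- by pbound_tac.
- move=> x [|a l1] l2 lE; first by rewrite /= esize_pair /esize /=; lia.
  by rewrite /= stepT lE esize_pair cat_cons esize_cons /esize /=; lia.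
Qed.

Lemma ptime_size_seq (l : X -> seq A) : ptime l -> ptime (fun x => size (l x)).
Proof.
move=> pl.
have E l0 n : foldl (fun n _ => n.+1) n l0 = size (l0 : seq A) + n.
  by elim: l0 n => //= a s IH n; rewrite IH addnS.
apply: (@ptime_ext _ _ _ _ (fun x => foldl (fun n _ => n.+1) 0 (l x))).
  by move=> x; rewrite E addn0.
apply: (@ptime_foldl _ _ _ _ _ _ (fun _ n _ => n.+1) _ _ (fun x => esize (l x))) => //.
- by apply: ptime_S; apply: ptime_proj1; apply: ptime_esnd.
- exact: ptime_const.
- by pbound_tac.
- move=> x l1 l2 lE; rewrite E addn0 esize_nat lE.
  pose proof (@size_esize _ _ (l1 ++ l2)) as HX; move: HX; rewrite size_cat; lia.
Qed.

Lemma ptime_catrev (l l' : X -> seq A) : ptime l -> ptime l' ->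
  ptime (fun x => catrev (l x) (l' x)).
Proof.
move=> pl pl'.
have E l0 l1 : foldl (fun s a => a :: s) l1 l0 = catrev l0 l1 :> seq A.
  by elim: l0 l1 => //= a s IH l1; rewrite IH.
apply: (@ptime_ext _ _ _ _ (fun x => foldl (fun s a => a :: s) (l' x) (l x))).
  by move=> x; rewrite E.
apply: (@ptime_foldl _ _ _ _ _ _ (fun _ s a => a :: s) _ _
  (fun x => esize (l x) + esize (l' x))) => //.
- apply: ptime_cons.
  + by apply: ptime_proj2; apply: ptime_esnd.
  + by apply: ptime_proj1; apply: ptime_esnd.
- by pbound_tac.
- move=> x l1 l2 lE; rewrite E catrevE lE.
  pose proof (@esize_cat _ _ (rev l1) (l' x)) as H1.
  pose proof (@esize_cat _ _ l1 l2) as H2; move: H1 H2; rewrite esize_rev.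
  by lia.
Qed.

Lemma ptime_rev (l : X -> seq A) : ptime l -> ptime (fun x => rev (l x)).
Proof. by move=> pl; apply: ptime_catrev pl _; apply: ptime_const. Qed.

Lemma ptime_cat (l l' : X -> seq A) : ptime l -> ptime l' ->
  ptime (fun x => l x ++ l' x).
Proof.
move=> pl pl'; apply: (@ptime_ext _ _ _ _ (fun x => catrev (rev (l x)) (l' x))).
  by move=> x; rewrite catrevE revK.
by apply: ptime_catrev pl'; apply: ptime_rev.
Qed.

Lemma ptime_rcons (l : X -> seq A) (a : X -> A) : ptime l -> ptime a ->
  ptime (fun x => rcons (l x) (a x)).
Proof.
move=> pl pa; apply: (@ptime_ext _ _ _ _ (fun x => l x ++ [:: a x])).
  by move=> x; rewrite cats1.
by apply: ptime_cat pl _; apply: ptime_cons pa _; apply: ptime_const.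
Qed.

End Lists.

Section Maps.
Context {X A B : Type} {eX : Enc X} {eA : Enc A} {eB : Enc B}.

Lemma ptime_map (f : X -> A -> B) (l : X -> seq A) :
  ptime (fun z : X * A => f z.1 z.2) -> ptime l ->
  ptime (fun x => [seq f x a | a <- l x]).
Proof.
move=> pf pl.
have E x l0 l1 : foldl (fun s a => f x a :: s) l1 l0 = catrev [seq f x a | a <- l0] l1.
  by elim: l0 l1 => //= a s IH l1; rewrite IH.
apply: (@ptime_ext _ _ _ _ (fun x => rev (foldl (fun s a => f x a :: s) [::] (l x)))).
  by move=> x; rewrite E catrevE cats0 revK.
apply: ptime_rev.
have [a [k bf]] := ptime_size pf.
pose M (x : X) := a * (@esize X eX x + @esize (seq A) (@Enc_seq A eA) (l x) + 1) ^ k.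
apply: (@ptime_foldl _ _ _ _ _ _ (fun x s a => f x a :: s) _ _
  (fun x => (esize (l x) * (M x).+1).+1)) => //.
- apply: ptime_cons.
  + apply: (@ptime_comp2 _ _ _ _ _ _ _ _ f) => //; first exact: ptime_efst.
    by apply: ptime_proj2; apply: ptime_esnd.
  + by apply: ptime_proj1; apply: ptime_esnd.
- exact: ptime_const.
- by apply: pboundS; apply: pboundM; [|apply: pboundS]; pbound_tac.
- move=> x l1 l2 lE; rewrite E catrevE cats0 esize_rev.
  have le1 : size l1 <= esize (l x).
    pose proof (@size_esize _ _ (l1 ++ l2)) as HX.
    by move: HX; rewrite size_cat -lE; lia.
  have : all (fun b => esize b <= M x) [seq f x a | a <- l1].
    have : esize l1 <= esize (l x).
      rewrite lE; pose proof (@esize_cat _ _ l1 l2) as HX; move: HX.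
      by pose proof (@esize_gt0 _ _ l2); lia.
    elim: (l1) => //= y s IH; rewrite esize_cons => le; apply/andP; split; last first.
      by apply: IH; lia.
    apply: leq_trans (bf (x, y)) _; rewrite leq_mul2l esize_pair.
    by case: (k) => [|k']; rewrite ?expn0 ?leq_exp2r ?orbT //; lia.
  move/esize_bound; rewrite size_map => /leq_trans -> //.
  by rewrite ltnS leq_mul2r le1 orbT.
Qed.

Lemma ptime_all (f : X -> A -> bool) (l : X -> seq A) :
  ptime (fun z : X * A => f z.1 z.2) -> ptime l ->
  ptime (fun x => all (f x) (l x)).
Proof.
move=> pf pl.
have E x l0 b : foldl (fun b a => b && f x a) b l0 = b && all (f x) l0.
  by elim: l0 b => //= [b|a s IH b]; rewrite ?andbT // IH andbA.
apply: (@ptime_ext _ _ _ _ (fun x => foldl (fun b a => b && f x a) true (l x))).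
  by move=> x; rewrite E.
apply: (@ptime_foldl _ _ _ _ _ _ (fun x b a => b && f x a) _ _ (fun=> 3)) => //.
- apply: ptime_andb; first by apply: ptime_proj1; apply: ptime_esnd.
  apply: (@ptime_comp2 _ _ _ _ _ _ _ _ f) => //; first exact: ptime_efst.
  by apply: ptime_proj2; apply: ptime_esnd.
- exact: ptime_const.
- by pbound_tac.
- by move=> x l1 l2 _; case: foldl.
Qed.

Lemma ptime_find (f : X -> A -> bool) (l : X -> seq A) :
  ptime (fun z : X * A => f z.1 z.2) -> ptime l ->
  ptime (fun x => find (f x) (l x)).
Proof.
move=> pf pl.
pose step x (o : bool * nat) a :=
  if o.1 then o else if f x a then (true, o.2) else (false, o.2.+1).
have stepT x n l0 : foldl (step x) (true, n) l0 = (true, n) by elim: l0.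
have E x l0 n : foldl (step x) (false, n) l0 = (has (f x) l0, n + find (f x) l0).
  elim: l0 n => //= [n|a s IH n]; first by rewrite addn0.
  rewrite {2}/step /=; case: (f x a); rewrite ?stepT ?addn0 //.
  by rewrite IH addSnnS.
apply: (@ptime_ext _ _ _ _ (fun x => (foldl (step x) (false, 0) (l x)).2)).
  by move=> x; rewrite E.
apply: ptime_proj2.
apply: (@ptime_foldl _ _ _ _ _ _ step _ _ (fun x => esize (l x) + 4)) => //.
- have p1 : ptime (fun z : X * ((bool * nat) * A) => z.2.1).
    by apply: ptime_proj1; apply: ptime_esnd.
  apply: ptime_if; [exact: ptime_proj1 | exact: p1 |].
  apply: ptime_if.
  + apply: (@ptime_comp2 _ _ _ _ _ _ _ _ f) => //; first exact: ptime_efst.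
    by apply: ptime_proj2; apply: ptime_esnd.
  + by apply: ptime_pair; [exact: ptime_const | exact: ptime_proj2].
  + by apply: ptime_pair; [exact: ptime_const | apply: ptime_S; exact: ptime_proj2].
- exact: ptime_const.
- by pbound_tac.
- move=> x l1 l2 lE; rewrite E add0n esize_pair esize_nat.
  have := find_size (f x) l1; pose proof (@size_esize _ _ (l1 ++ l2)) as HX.
  move: HX; rewrite size_cat -lE.
  have : esize (has (f x) l1) <= 3 by case: has.
  by lia.
Qed.
End Maps.

Section Flatten.
Context {X A B : Type} {eX : Enc X} {eA : Enc A} {eB : Enc B}.

Lemma ptime_flatten (l : X -> seq (seq A)) : ptime l ->
  ptime (fun x => flatten (l x)).
Proof.
move=> pl.
have E l0 (s : seq A) : foldl cat s l0 = s ++ flatten l0.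
  by elim: l0 s => //= [s|a l1 IH s]; rewrite ?cats0 // IH catA.
apply: (@ptime_ext _ _ _ _ (fun x => foldl cat [::] (l x))).
  by move=> x; rewrite E.
apply: (@ptime_foldl _ _ _ _ _ _ (fun _ => cat) _ _ (fun x => esize (l x))) => //.
- apply: ptime_cat; first by apply: ptime_proj1; apply: ptime_esnd.
  by apply: ptime_proj2; apply: ptime_esnd.
- exact: ptime_const.
- by pbound_tac.
- move=> x l1 l2 ->; rewrite E cat0s.
  elim: l1 => [|s l1 IH] /=; first exact: esize_gt0.
  rewrite esize_cons; pose proof (@esize_cat _ _ s (flatten l1)) as HX; move: HX; lia.
Qed.

Lemma ptime_filter (f : X -> A -> bool) (l : X -> seq A) :
  ptime (fun z : X * A => f z.1 z.2) -> ptime l ->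
  ptime (fun x => filter (f x) (l x)).
Proof.
move=> pf pl.
apply: (@ptime_ext _ _ _ _
  (fun x => flatten [seq if f x a then [:: a] else [::] | a <- l x])).
  by move=> x; elim: (l x) => //= a s <-; case: (f x a).
apply: ptime_flatten; apply: (@ptime_map _ _ _ _ _ _ (fun x a => if f x a then _ else _)) => //.
apply: ptime_if pf _ _; last exact: ptime_const.
by apply: ptime_cons; [exact: ptime_esnd | exact: ptime_const].
Qed.

Lemma ptime_drop (n : X -> nat) (l : X -> seq A) : ptime n -> ptime l ->
  ptime (fun x => drop (n x) (l x)).
Proof.
move=> pn pl.
have E i s : iter i behead s = drop i s :> seq A.
  by elim: i s => [|i IH] s; rewrite ?drop0 // iterSr IH; case: s.
apply: (@ptime_ext _ _ _ _ (fun x => iter (n x) behead (l x))) => [x|]; first exact: E.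
apply: (@ptime_iter _ _ _ _ (fun _ => behead) _ _ (fun x => esize (l x))) => //.
- by apply: ptime_behead; apply: ptime_esnd.
- by pbound_tac.
- move=> x i _; rewrite E -{2}(cat_take_drop i (l x)).
  pose proof (@esize_cat _ _ (take i (l x)) (drop i (l x))) as HX; move: HX.
  have : 0 < esize (take i (l x)) by exact: esize_gt0.
  by lia.
Qed.

Lemma ptime_nth (d : X -> A) (l : X -> seq A) (n : X -> nat) :
  ptime d -> ptime l -> ptime n -> ptime (fun x => nth (d x) (l x) (n x)).
Proof.
move=> pd pl pn.
apply: (@ptime_ext _ _ _ _ (fun x => head (d x) (drop (n x) (l x)))).
  by move=> x; rewrite -nth0 nth_drop addn0.
by apply: ptime_head pd _; apply: ptime_drop.
Qed.

Lemma ptime_iota0 (n : X -> nat) : ptime n -> ptime (fun x => iota 0 (n x)).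
Proof.
move=> pn.
have E i : iter i (fun s => rcons s (size s)) [::] = iota 0 i.
  by elim: i => // i IH; rewrite iterS IH -addn1 iotaD cats1 size_iota.
apply: (@ptime_ext _ _ _ _ (fun x => iter (n x) (fun s => rcons s (size s)) [::])).
  by move=> x; rewrite E.
apply: (@ptime_iter _ _ _ _ (fun _ s => rcons s (size s)) _ _
  (fun x => (esize (n x) * (esize (n x)).+1).+1)) => //.
- apply: ptime_rcons; first exact: ptime_esnd.
  by apply: ptime_size_seq; apply: ptime_esnd.
- exact: ptime_const.
- by apply: pboundS; apply: pboundM; [|apply: pboundS]; pbound_tac.
- move=> x i le; rewrite E.
  have : all (fun j => esize j <= esize (n x)) (iota 0 i).
    by apply/allP => j; rewrite mem_iota !esize_nat; lia.
  move/esize_bound; rewrite size_iota => /leq_trans -> //.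
  by rewrite ltnS leq_mul2r esize_nat; lia.
Qed.
End Flatten.

Lemma ptime_addn X (eX : Enc X) (m n : X -> nat) : ptime m -> ptime n -> ptime (fun x => m x + n x).
Proof.
move=> pm pn; apply: (@ptime_ext _ _ _ _ (fun x => iter (m x) S (n x))).
  by move=> x; rewrite iter_succn addnC.
apply: (@ptime_iter _ _ _ _ (fun _ => S) _ _ (fun x => esize (m x) + esize (n x))) => //.
- by apply: ptime_S; apply: ptime_esnd.
- by pbound_tac.
- by move=> x i le; rewrite iter_succn !esize_nat; lia.
Qed.

Lemma ptime_muln X (eX : Enc X) (m n : X -> nat) : ptime m -> ptime n -> ptime (fun x => m x * n x).
Proof.
move=> pm pn; apply: (@ptime_ext _ _ _ _ (fun x => iter (m x) (addn (n x)) 0)).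
  by move=> x; rewrite iter_addn_0 mulnC.
apply: (@ptime_iter _ _ _ _ (fun x => addn (n x)) _ _
  (fun x => (esize (m x) * esize (n x)).+1)) => //.
- apply: ptime_addn; last exact: ptime_esnd.
  by apply: ptime_comp pn; apply: ptime_efst.
- exact: ptime_const.
- by apply: pboundS; pbound_tac.
- move=> x i le; rewrite iter_addn_0 !esize_nat.
  have : n x * i <= n x * m x by rewrite leq_mul2l le orbT.
  by nia.
Qed.

Lemma ptime_predn X (eX : Enc X) (m : X -> nat) : ptime m -> ptime (fun x => (m x).-1).
Proof. by move=> pm; apply: ptime_comp pm _; apply: ptime_esnd; case. Qed.

Lemma ptime_subn X (eX : Enc X) (m n : X -> nat) : ptime m -> ptime n -> ptime (fun x => m x - n x).
Proof.
move=> pm pn; apply: (@ptime_ext _ _ _ _ (fun x => iter (n x) predn (m x))).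
  by move=> x; rewrite iter_predn.
apply: (@ptime_iter _ _ _ _ (fun _ => predn) _ _ (fun x => esize (m x))) => //.
- by apply: ptime_predn; apply: ptime_esnd.
- by pbound_tac.
- by move=> x i le; rewrite iter_predn !esize_nat; lia.
Qed.

Lemma ptime_leq X (eX : Enc X) (m n : X -> nat) : ptime m -> ptime n -> ptime (fun x => m x <= n x).
Proof.
move=> pm pn.
apply: (@ptime_ext _ _ _ _ (fun x => iter (m x - n x) (fun=> false) true)).
  by move=> x; rewrite /leq; case: subn.
apply: (@ptime_iter _ _ _ _ (fun _ _ => false) _ _ (fun=> 3)) => //.
- exact: ptime_const.
- exact: ptime_const.
- exact: ptime_subn.
- exact: pbound_const.
- by move=> x i _; case: (iter _ _ _).
Qed.

Lemma ptime_eqn X (eX : Enc X) (m n : X -> nat) : ptime m -> ptime n -> ptime (fun x => m x == n x).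
Proof.
move=> pm pn; apply: (@ptime_ext _ _ _ _ (fun x => (m x <= n x) && (n x <= m x))).
  by move=> x; rewrite -eqn_leq.
by apply: ptime_andb; apply: ptime_leq.
Qed.

(** Counting modulo [n x] avoids division. *)
Lemma ptime_modn X (eX : Enc X) (m n : X -> nat) : ptime m -> ptime n -> ptime (fun x => m x %% n x).
Proof.
move=> pm pn; pose step x c := if c.+1 == n x then 0 else c.+1.
have E x i : iter i (step x) 0 = i %% n x.
  elim: i => [|i IH]; first by rewrite mod0n.
  rewrite iterS IH /step -[i.+1]addn1 -modnDml addn1.
  case: (posnP (n x)) => [->|n0]; first by rewrite !modn0.
  case: eqP => [->|/eqP ne]; first by rewrite modnn.
  by rewrite [RHS]modn_small // ltn_neqAle ne ltn_mod.
apply: (@ptime_ext _ _ _ _ (fun x => iter (m x) (step x) 0)) => [x|]; first exact: E.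
apply: (@ptime_iter _ _ _ _ step _ _ (fun x => esize (m x))) => //.
- apply: ptime_if; [|exact: ptime_const|by apply: ptime_S; apply: ptime_esnd].
  apply: ptime_eqn; first by apply: ptime_S; apply: ptime_esnd.
  by apply: ptime_comp pn; apply: ptime_efst.
- exact: ptime_const.
- by pbound_tac.
- move=> x i le; rewrite E !esize_nat; have := leq_mod i (n x); lia.
Qed.

Lemma ptime_comp1 X A B (eX : Enc X) (eA : Enc A) (eB : Enc B) (F : A -> B)
    (f : X -> A) : ptime F -> ptime f ->
  ptime (fun x => F (f x)).
Proof. by move=> pF pf; apply: ptime_comp pf pF. Qed.

Lemma ptime_comp3 X A B C D (eX : Enc X) (eA : Enc A) (eB : Enc B) (eC : Enc C)
    (eD : Enc D) (F : A -> B -> C -> D) (f : X -> A) (g : X -> B) (h : X -> C) :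
  ptime (fun z : A * B * C => F z.1.1 z.1.2 z.2) -> ptime f -> ptime g -> ptime h ->
  ptime (fun x => F (f x) (g x) (h x)).
Proof.
move=> pF pf pg ph.
exact: (ptime_comp1 pF (ptime_pair (ptime_pair pf pg) ph)).
Qed.

Lemma ptime_comp4 X A B C D E (eX : Enc X) (eA : Enc A) (eB : Enc B) (eC : Enc C)
    (eD : Enc D) (eE : Enc E) (F : A -> B -> C -> D -> E)
    (f : X -> A) (g : X -> B) (h : X -> C) (k : X -> D) :
  ptime (fun z : A * B * C * D => F z.1.1.1 z.1.1.2 z.1.2 z.2) ->
  ptime f -> ptime g -> ptime h -> ptime k ->
  ptime (fun x => F (f x) (g x) (h x) (k x)).
Proof.
move=> pF pf pg ph pk.
exact: (ptime_comp1 pF (ptime_pair (ptime_pair (ptime_pair pf pg) ph) pk)).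
Qed.

(** Dispatches on the head of the function body, since unification alone would unfold it. *)
Ltac ptime_step := cbv beta; first [ assumption | lazymatch goal with
  | |- ptime (fun _ => ?b) => exact: ptime_const
  | |- ptime (fun x => x) => exact: ptime_id
  | |- ptime (fun x => (@?f x, @?g x)) => apply: ptime_pair
  | |- ptime (iota 0) => exact: (ptime_iota0 ptime_id)
  | |- ptime size => exact: (ptime_size_seq ptime_id)
  | |- ptime (@fst _ _) => by apply: ptime_efst
  | |- ptime (@snd _ _) => by apply: ptime_esnd
  | |- ptime (fun x => fst (@?f x)) => apply: ptime_proj1
  | |- ptime (fun x => snd (@?f x)) => apply: ptime_proj2
  | |- ptime (fun x => cons (@?f x) (@?g x)) => apply: ptime_cons
  | |- ptime (fun x => S (@?f x)) => apply: ptime_S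
  | |- ptime (fun x => predn (@?f x)) => apply: ptime_predn
  | |- ptime (fun x => addn (@?f x) (@?g x)) => apply: ptime_addn
  | |- ptime (fun x => muln (@?f x) (@?g x)) => apply: ptime_muln
  | |- ptime (fun x => subn (@?f x) (@?g x)) => apply: ptime_subn
  | |- ptime (fun x => modn (@?f x) (@?g x)) => apply: ptime_modn
  | |- ptime (fun x => leq (@?f x) (@?g x)) => apply: ptime_leq
  | |- ptime (fun x => negb (@?f x)) => apply: ptime_negb
  | |- ptime (fun x => andb (@?f x) (@?g x)) => apply: ptime_andb
  | |- ptime (fun x => @eq_op _ (@?f x) (@?g x)) =>
         first [apply: ptime_eqn | apply: ptime_eqb]
  | |- ptime (fun x => behead (@?f x)) => apply: ptime_behead
  | |- ptime (fun x => nilp (@?f x)) => apply: ptime_nilp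
  | |- ptime (fun x => size (@?f x)) => apply: ptime_size_seq
  | |- ptime (fun x => cat (@?f x) (@?g x)) => apply: ptime_cat
  | |- ptime (fun x => rcons (@?f x) (@?g x)) => apply: ptime_rcons
  | |- ptime (fun x => flatten (@?f x)) => apply: ptime_flatten
  | |- ptime (fun x => head (@?d x) (@?f x)) => apply: ptime_head
  | |- ptime (fun x => nth (@?d x) (@?f x) (@?g x)) => apply: ptime_nth
  | |- ptime (fun x => iota 0 (@?f x)) => apply: ptime_iota0
  | |- _ => apply: ptime_if
  end ].
Ltac ptime_tac := repeat ptime_step.

Lemma ptime_orb X (eX : Enc X) (b c : X -> bool) :
  ptime b -> ptime c -> ptime (fun x => b x || c x).
Proof. by move=> pb pc; apply: (ptime_if pb) => //; apply: ptime_const. Qed.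

Lemma ptime_sumn X (eX : Enc X) (l : X -> seq nat) : ptime l ->
  ptime (fun x => sumn (l x)).
Proof.
move=> pl; have E l0 n : foldl addn n l0 = n + sumn l0.
  by elim: l0 n => //= [n|a s IH n]; rewrite ?addn0 // IH addnA.
apply: (@ptime_ext _ _ _ _ (fun x => foldl addn 0 (l x))) => [x|]; first by rewrite E.
apply: (@ptime_foldl _ _ _ _ _ _ (fun _ => addn) _ _ (fun x => esize (l x))) => //.
- by ptime_tac.
- exact: ptime_const.
- by pbound_tac.
- move=> x l1 l2 ->; rewrite E add0n esize_nat !esize_seq map_cat sumn_cat.
  elim: l1 => //= a s IH; rewrite esize_nat; lia.
Qed.

(** Programs for equality are built along the construction of the type. *)
Definition eqtime (T : eqType) (eT : Enc T) := ptime (fun z : T * T => z.1 == z.2).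

Lemma ptime_eq (X : Type) (T : eqType) (eX : Enc X) (eT : Enc T) (f g : X -> T) :
  eqtime eT -> ptime f -> ptime g -> ptime (fun x => f x == g x).
Proof. by move=> eqT pf pg; apply: (ptime_comp1 eqT (ptime_pair pf pg)). Qed.

Lemma eqtime_nat : eqtime Enc_nat.
Proof. by rewrite /eqtime; ptime_tac. Qed.

Lemma eqtime_prod (T U : eqType) (eT : Enc T) (eU : Enc U) :
  eqtime eT -> eqtime eU -> eqtime (@Enc_prod T U eT eU).
Proof.
move=> eqT eqU.
apply: (@ptime_ext _ _ _ _ (fun z : (T * U) * (T * U) =>
  (z.1.1 == z.2.1) && (z.1.2 == z.2.2))); first by case=> [[a b] [c d]].
by apply: ptime_andb; apply: ptime_eq => //; ptime_tac.
Qed.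

Lemma eqtime_seq (T : eqType) (eT : Enc T) (d : T) :
  eqtime eT -> eqtime (@Enc_seq T eT).
Proof.
move=> eqT.
apply: (@ptime_ext _ _ _ _ (fun z : seq T * seq T => (size z.1 == size z.2) &&
  all (fun i => nth d z.1 i == nth d z.2 i) (iota 0 (size z.1)))).
  case=> l l' /=; apply/andP/eqP => [[/eqP sz /allP H]|->]; last first.
    by split=> //; apply/allP.
  by apply: (eq_from_nth sz) => i lt; apply/eqP/H; rewrite mem_iota.
apply: ptime_andb; first by ptime_tac.
apply: ptime_all; last by ptime_tac.
by apply: ptime_eq => //; ptime_tac.
Qed.

Lemma ptime_mem (X : Type) (T : eqType) (eX : Enc X) (eT : Enc T)
    (f : X -> T) (l : X -> seq T) :
  eqtime eT -> ptime f -> ptime l -> ptime (fun x => f x \in l x).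
Proof.
move=> eqT pf pl.
apply: (@ptime_ext _ _ _ _ (fun x => ~~ all (fun a => f x != a) (l x))).
  move=> x; rewrite -has_predC -has_pred1 /=; apply: eq_has => a /=.
  by rewrite negbK eq_sym.
apply: ptime_negb; apply: ptime_all => //; apply: ptime_negb.
by apply: ptime_eq => //; [apply: ptime_comp1 pf _; apply: ptime_efst | apply: ptime_esnd].
Qed.

Lemma ptime_index (X : Type) (T : eqType) (eX : Enc X) (eT : Enc T)
    (f : X -> T) (l : X -> seq T) :
  eqtime eT -> ptime f -> ptime l -> ptime (fun x => index (f x) (l x)).
Proof.
move=> eqT pf pl; apply: ptime_find => //; cbv beta.
by apply: ptime_eq => //; [apply: ptime_esnd | apply: ptime_comp1 pf _; apply: ptime_efst].
Qed.

(** Unlike [undup], [dedup] keeps the first occurrence of each entry. *)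
Definition dedup (T : eqType) (l : seq T) : seq T :=
  foldl (fun (s : seq T) a => if a \in s then s else rcons s a) [::] l.

Lemma ptime_dedup (X : Type) (T : eqType) (eX : Enc X) (eT : Enc T) (l : X -> seq T) :
  eqtime eT -> ptime l -> ptime (fun x => dedup (l x)).
Proof.
move=> eqT pl.
apply: (@ptime_foldl _ _ _ _ _ _ (fun _ (s : seq T) a => if a \in s then s else rcons s a)
  _ _ (fun x => esize (l x))) => //.
- by apply: ptime_if; [apply: ptime_mem => // | | ]; ptime_tac; apply: ptime_esnd.
- exact: ptime_const.
- by pbound_tac.
- move=> x l1 l2 ->; apply: (@leq_trans (esize l1)); last first.
    rewrite !esize_seq map_cat sumn_cat; lia.
  elim/last_ind: l1 => // l1 a IH; rewrite foldl_rcons -!cats1.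
  pose proof (@esize_cat _ _ l1 [:: a]) as H1.
  case: ifP => _; first by rewrite esize_cons in H1; lia.
  by pose proof (@esize_cat _ _ (dedup l1) [:: a]) as H2; 
    rewrite /dedup in H2; lia.
Qed.

(** * The algorithm *)

Definition smallest_factor n := (find (fun k => n %% k.+2 == 0) (iota 0 n)).+2.

Lemma ptime_smallest_factor : ptime smallest_factor.
Proof.
do 2 apply: ptime_S; apply: (@ptime_find _ _ _ _ (fun n k => n %% k.+2 == 0)); by ptime_tac.
Qed.

Notation vec := (seq (nat * nat)).

Definition extend p (L : seq vec) : seq vec :=
  flatten [seq flatten [seq [seq (i, j) :: v | v <- L] | j <- iota 0 p] | i <- iota 0 p].

(** The vectors of length r are obtained without knowing r: on an input of size p ^ (2 r + 1) the
    number of vectors, p ^ (2 i) after i extensions, stays below n / p exactly as long as i < r. *)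
Definition all_vectors p n : seq vec :=
  iter n (fun L => if n <= size L * p then L else extend p L) [:: [::]].

Lemma sumn_map_const (T : Type) (l : seq T) c : sumn [seq c | _ <- l] = size l * c.
Proof. by elim: l => //= a l ->; rewrite mulSn. Qed.

Lemma size_extend p L : size (extend p L) = p * (p * size L).
Proof.
rewrite /extend size_flatten /shape -map_comp.
transitivity (sumn [seq p * size L | _ <- iota 0 p]); last first.
  by rewrite sumn_map_const size_iota.
congr sumn; apply: eq_map => a /=; rewrite size_flatten /shape -map_comp.
transitivity (sumn [seq size L | _ <- iota 0 p]); last first.
  by rewrite sumn_map_const size_iota.
by congr sumn; apply: eq_map => b /=; rewrite size_map.
Qed.

Lemma ptime_extend : ptime (fun z : nat * seq vec => extend z.1 z.2).
Proof.
apply: ptime_flatten.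
apply: (@ptime_map _ _ _ _ _ _ (fun z i =>
  flatten [seq [seq (i, j) :: v | v <- z.2] | j <- iota 0 z.1])); last by ptime_tac.
apply: ptime_flatten.
apply: (@ptime_map _ _ _ _ _ _ (fun z j => [seq (z.2, j) :: v | v <- z.1.2]));
  last by ptime_tac.
by apply: (@ptime_map _ _ _ _ _ _ (fun z v => (z.1.2, z.2) :: v)); ptime_tac.
Qed.

Lemma ptime_all_vectors : ptime (fun z : nat * nat => all_vectors z.1 z.2).
Proof.
pose step (z : nat * nat) L := if z.2 <= size L * z.1 then L else extend z.1 L.
pose N (z : nat * nat) := (1 + z.2 * z.1 * z.1) * (1 + z.2 * (4 * z.1 + 2)).+1.
rewrite /all_vectors.
apply: (@ptime_iter _ _ _ _ step (fun=> [:: [::]]) snd (fun z => (N z).+1)) => //.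
- apply: ptime_if; [by ptime_tac | by ptime_tac |].
  by apply: (@ptime_comp2 _ _ _ _ _ _ _ _ extend); [exact: ptime_extend| |]; ptime_tac.
- exact: ptime_const.
- exact: ptime_esnd.
- have b1 : pbound (fun z : nat * nat => z.1).
    by apply: pbound_le pbound_esize => -[p n]; rewrite esize_pair !esize_nat /=; lia.
  have b2 : pbound (fun z : nat * nat => z.2).
    by apply: pbound_le pbound_esize => -[p n]; rewrite esize_pair !esize_nat /=; lia.
  by rewrite /N; apply: pboundS; apply: pboundM; [|apply: pboundS]; pbound_tac.
- move=> [p n] i /= le.
  have [sz ub] : size (iter i (step (p, n)) [:: [::]]) <= 1 + n * p * p /\
     all (fun v => esize v <= 1 + i * (4 * p + 2)) (iter i (step (p, n)) [:: [::]]).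
    elim: i {le} => [|i [IH1 IH2]]; first by rewrite /= ; split=> //; lia.
    set L := iter i _ _ in IH1 IH2; rewrite iterS -/L /step /=.
    have mono : all (fun v => esize v <= 1 + i.+1 * (4 * p + 2)) L.
      by apply: sub_all IH2 => v; rewrite mulSn; lia.
    case: ifP => [_|/negbT]; first by split.
    rewrite -ltnNge => lt; split.
      rewrite size_extend.
      have : size L * p * p <= n * p by rewrite leq_mul2r (ltnW lt) orbT.
      by nia.
    apply/allP => v /flattenP[/= ? /mapP[a a_p ->] /flattenP[? /mapP[b b_p ->] /mapP[w wL ->]]].
    have := allP IH2 _ wL; rewrite esize_cons esize_pair !esize_nat.
    move: a_p b_p; rewrite !mem_iota mulSn; lia.
  apply: leq_trans (esize_bound ub) _; rewrite ltnS /N /=.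
  apply: leq_mul => //; rewrite ltnS leq_add2l leq_mul2r le orbT //.
Qed.

(** A vector is the list of its pairs of coordinates (a_i, b_i), with entries below p; an element of
    the group is a vector together with a central coordinate. *)
Definition axis_vector r i (ab : nat * nat) : vec :=
  [seq if t == i then ab else (0, 0) | t <- iota 0 r].

Definition plane_vector r i (ab cd : nat * nat) : vec :=
  [seq if t == 0 then ab else if t == i then cd else (0, 0) | t <- iota 0 r].

(** The vectors that force the ratios between the pairs 0 and i; each is determined by the ones that
    precede it. The entry p - 1 stands for -1. *)
Definition block p r i : seq vec :=
  [:: plane_vector r i (0, 1) (0, p - 1); plane_vector r i (1, 1) (1, p - 1);
      plane_vector r i (0, 0) (1, p - 1); plane_vector r i (1, 0) (0, 1)] ++
  flatten [seq [:: plane_vector r i (k, 1) (1, p - 1);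
                   plane_vector r i (k.+1 %% p, 1) (1, 0);
                   plane_vector r i (0, 1) (0, (p - 1) * k.+1 %% p)] | k <- iota 0 p].

Definition frame_vectors r : seq vec :=
  flatten [seq [:: axis_vector r i (1, 0); axis_vector r i (0, 1)] | i <- iota 0 r].

(** These use up the freedom to rescale the vectors of the hyperbolic basis. *)
Definition scaling_vectors r : seq vec :=
  rcons [seq plane_vector r i.+1 (1, 0) (1, 0) | i <- iota 0 r.-1] (axis_vector r 0 (1, 1)).

Definition head_vectors p r : seq vec :=
  frame_vectors r ++ scaling_vectors r
  ++ flatten [seq block p r i.+1 | i <- iota 0 r.-1]
  ++ [seq axis_vector r 0 (k.+1, 1) | k <- iota 0 p.-1].

Definition full_head (v : vec) : bool := ((head (0, 0) v).1 != 0) && ((head (0, 0) v).2 != 0).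

Definition element_list p (L : seq vec) : seq (vec * nat) :=
  dedup ([seq (v, 0) | v <- head_vectors p (size (head [::] L)) ++ filter full_head L]
         ++ flatten [seq [seq (v, c) | c <- iota 0 p] | v <- L]).

Definition mul_code p (x y : vec * nat) : vec * nat :=
  ([seq (((nth (0, 0) x.1 t).1 + (nth (0, 0) y.1 t).1) %% p,
         ((nth (0, 0) x.1 t).2 + (nth (0, 0) y.1 t).2) %% p) | t <- iota 0 (size x.1)],
   (x.2 + y.2 + sumn [seq (nth (0, 0) x.1 t).1 * (nth (0, 0) y.1 t).2
                     | t <- iota 0 (size x.1)]) %% p).

Definition code_table p (s : seq (vec * nat)) : seq (seq nat) :=
  [seq [seq index (mul_code p x y) s | y <- s] | x <- s].

Definition commuting_matrix p (s : seq (vec * nat)) : seq (seq bool) :=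
  [seq [seq (x != y) && (mul_code p x y == mul_code p y x) | y <- s] | x <- s].

Definition adj (M : seq (seq bool)) i j : bool := nth false (nth [::] M i) j.

Definition universal (M : seq (seq bool)) i : bool :=
  all (fun j => adj M i j || (j == i)) (iota 0 (size M)).

Definition fits (M M0 : seq (seq bool)) (xs : seq nat) i : bool :=
  (i \notin xs) && (universal M i == universal M0 (size xs))
  && all (fun j => adj M i (nth 0 xs j) == adj M0 (size xs) j) (iota 0 (size xs)).

(** When no vertex fits, [find] returns the number of vertices, which is not the index of a vertex. *)
Definition greedy_step M M0 xs :=
  rcons xs (find (fits M M0 xs) (iota 0 (size M))).

Definition greedy M M0 : seq nat := iter (size M) (greedy_step M M0) [::].

Definition model_elements (M : seq (seq bool)) : seq (vec * nat) :=
  element_list (smallest_factor (size M))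
    (all_vectors (smallest_factor (size M)) (size M)).

Definition matching (M : seq (seq bool)) : seq nat :=
  greedy M (commuting_matrix (smallest_factor (size M)) (model_elements M)).

Definition label_graph (M : seq (seq bool)) : tree :=
  if all (fun i => i < size M) (matching M)
  then enc (code_table (smallest_factor (size M)) (model_elements M),
            [seq index i (matching M) | i <- iota 0 (size M)])
  else Leaf.

(** * The algorithm runs in polynomial time *)

Lemma ptime_axis_vector X (eX : Enc X) (r i : X -> nat) (ab : X -> nat * nat) :
  ptime r -> ptime i -> ptime ab -> ptime (fun x => axis_vector (r x) (i x) (ab x)).
Proof.
apply: ptime_comp3.
apply: (@ptime_map _ _ _ _ _ _ (fun z t => if t == z.1.2 then z.2 else (0, 0)));
  by ptime_tac.
Qed.

Lemma ptime_plane_vector X (eX : Enc X) (r i : X -> nat) (ab cd : X -> nat * nat) :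
  ptime r -> ptime i -> ptime ab -> ptime cd ->
  ptime (fun x => plane_vector (r x) (i x) (ab x) (cd x)).
Proof.
apply: ptime_comp4.
apply: (@ptime_map _ _ _ _ _ _ (fun z t => if t == 0 then z.1.2 else
  if t == z.1.1.2 then z.2 else (0, 0))); by ptime_tac.
Qed.

Ltac ptime_vec := repeat first [apply: ptime_axis_vector | apply: ptime_plane_vector | ptime_step].

Lemma ptime_block X (eX : Enc X) (p r i : X -> nat) :
  ptime p -> ptime r -> ptime i -> ptime (fun x => block (p x) (r x) (i x)).
Proof.
apply: ptime_comp3.
apply: ptime_cat; first by ptime_vec.
apply: ptime_flatten; apply: (@ptime_map _ _ _ _ _ _ (fun z k =>
  [:: plane_vector z.1.2 z.2 (k, 1) (1, z.1.1 - 1);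
      plane_vector z.1.2 z.2 (k.+1 %% z.1.1, 1) (1, 0);
      plane_vector z.1.2 z.2 (0, 1) (0, (z.1.1 - 1) * k.+1 %% z.1.1)])); by ptime_vec.
Qed.

Lemma ptime_head_vectors X (eX : Enc X) (p r : X -> nat) :
  ptime p -> ptime r -> ptime (fun x => head_vectors (p x) (r x)).
Proof.
apply: ptime_comp2.
apply: ptime_cat.
  apply: ptime_flatten; apply: (@ptime_map _ _ _ _ _ _ (fun z i =>
    [:: axis_vector z.2 i (1, 0); axis_vector z.2 i (0, 1)])); by ptime_vec.
apply: ptime_cat.
  apply: ptime_rcons; last by ptime_vec.
  apply: (@ptime_map _ _ _ _ _ _ (fun z i => plane_vector z.2 i.+1 (1, 0) (1, 0)));
    by ptime_vec.
apply: ptime_cat.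
  apply: ptime_flatten; apply: (@ptime_map _ _ _ _ _ _ (fun z i => block z.1 z.2 i.+1)).
    by apply: ptime_block; ptime_tac.
  by ptime_tac.
by apply: (@ptime_map _ _ _ _ _ _ (fun z k => axis_vector z.2 0 (k.+1, 1))); ptime_vec.
Qed.

Lemma eqtime_vec : eqtime (@Enc_seq _ (@Enc_prod _ _ Enc_nat Enc_nat)).
Proof. by apply: (eqtime_seq (0, 0)); apply: eqtime_prod; exact: eqtime_nat. Qed.

Lemma eqtime_code : eqtime (@Enc_prod _ _ (@Enc_seq _ (@Enc_prod _ _ Enc_nat Enc_nat)) Enc_nat).
Proof. by apply: eqtime_prod; [exact: eqtime_vec | exact: eqtime_nat]. Qed.

Lemma ptime_element_list X (eX : Enc X) (p : X -> nat) (L : X -> seq vec) :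
  ptime p -> ptime L -> ptime (fun x => element_list (p x) (L x)).
Proof.
apply: ptime_comp2.
apply: ptime_dedup; first exact: eqtime_code.
apply: ptime_cat.
  apply: (@ptime_map _ _ _ _ _ _ (fun _ v => (v, 0))); first by ptime_tac.
  apply: ptime_cat; first by apply: ptime_head_vectors; ptime_tac.
  by apply: (@ptime_filter _ _ _ _ (fun _ => full_head)); rewrite /full_head; ptime_tac.
apply: ptime_flatten; apply: (@ptime_map _ _ _ _ _ _ (fun z v => [seq (v, c) | c <- iota 0 z.1]));
  last by ptime_tac.
by apply: (@ptime_map _ _ _ _ _ _ (fun z c => (z.2, c))); ptime_tac.
Qed.

Lemma ptime_mul_code X (eX : Enc X) (p : X -> nat) (x y : X -> vec * nat) :
  ptime p -> ptime x -> ptime y -> ptime (fun z => mul_code (p z) (x z) (y z)).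
Proof.
apply: ptime_comp3.
apply: ptime_pair.
  apply: (@ptime_map _ _ _ _ _ _ (fun z t =>
    (((nth (0, 0) z.1.2.1 t).1 + (nth (0, 0) z.2.1 t).1) %% z.1.1,
     ((nth (0, 0) z.1.2.1 t).2 + (nth (0, 0) z.2.1 t).2) %% z.1.1))); by ptime_tac.
apply: ptime_modn; last by ptime_tac.
apply: ptime_addn; first by ptime_tac.
apply: ptime_sumn; apply: (@ptime_map _ _ _ _ _ _ (fun z t =>
  (nth (0, 0) z.1.2.1 t).1 * (nth (0, 0) z.2.1 t).2)); by ptime_tac.
Qed.

Lemma ptime_code_table X (eX : Enc X) (p : X -> nat) (s : X -> seq (vec * nat)) :
  ptime p -> ptime s -> ptime (fun x => code_table (p x) (s x)).
Proof.
apply: ptime_comp2.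
apply: (@ptime_map _ _ _ _ _ _ (fun z x => [seq index (mul_code z.1 x y) z.2 | y <- z.2]));
  last by ptime_tac.
apply: (@ptime_map _ _ _ _ _ _ (fun z y => index (mul_code z.1.1 z.2 y) z.1.2));
  last by ptime_tac.
by apply: ptime_index; [exact: eqtime_code | apply: ptime_mul_code | ]; ptime_tac.
Qed.

Lemma ptime_commuting_matrix X (eX : Enc X) (p : X -> nat) (s : X -> seq (vec * nat)) :
  ptime p -> ptime s -> ptime (fun x => commuting_matrix (p x) (s x)).
Proof.
apply: ptime_comp2.
apply: (@ptime_map _ _ _ _ _ _ (fun z x => [seq (x != y) &&
  (mul_code z.1 x y == mul_code z.1 y x) | y <- z.2])); last by ptime_tac.
apply: (@ptime_map _ _ _ _ _ _ (fun z y => (z.2 != y) &&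
  (mul_code z.1.1 z.2 y == mul_code z.1.1 y z.2))); last by ptime_tac.
apply: ptime_andb; [apply: ptime_negb|];
  (apply: ptime_eq; [exact: eqtime_code| |]); do ?[apply: ptime_mul_code]; by ptime_tac.
Qed.

Lemma ptime_adj X (eX : Enc X) (M : X -> seq (seq bool)) (i j : X -> nat) :
  ptime M -> ptime i -> ptime j -> ptime (fun x => adj (M x) (i x) (j x)).
Proof. by move=> pM p_i pj; rewrite /adj; ptime_tac. Qed.

Lemma ptime_universal X (eX : Enc X) (M : X -> seq (seq bool)) (i : X -> nat) :
  ptime M -> ptime i -> ptime (fun x => universal (M x) (i x)).
Proof.
apply: ptime_comp2.
apply: (@ptime_all _ _ _ _ (fun z j => adj z.1 z.2 j || (j == z.2))); last by ptime_tac.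
by apply: ptime_orb; [apply: ptime_adj|]; ptime_tac.
Qed.

Lemma ptime_fits X (eX : Enc X) (M M0 : X -> seq (seq bool)) (xs : X -> seq nat) (i : X -> nat) :
  ptime M -> ptime M0 -> ptime xs -> ptime i ->
  ptime (fun x => fits (M x) (M0 x) (xs x) (i x)).
Proof.
apply: ptime_comp4; apply: ptime_andb; last first.
  apply: (@ptime_all _ _ _ _ (fun z j =>
    adj z.1.1.1 z.2 (nth 0 z.1.2 j) == adj z.1.1.2 (size z.1.2) j)); last by ptime_tac.
  by apply: ptime_eqb; apply: ptime_adj; ptime_tac.
apply: ptime_andb.
  by apply: ptime_negb; apply: ptime_mem; [exact: eqtime_nat| |]; ptime_tac.
by apply: ptime_eqb; apply: ptime_universal; ptime_tac.
Qed.

Lemma ptime_greedy X (eX : Enc X) (M M0 : X -> seq (seq bool)) :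
  ptime M -> ptime M0 -> ptime (fun x => greedy (M x) (M0 x)).
Proof.
apply: ptime_comp2.
apply: (@ptime_iter _ _ _ _ (fun z => greedy_step z.1 z.2) _ _
  (fun z => (esize z.1 * (esize z.1).+1).+1)).
- apply: ptime_rcons; first by ptime_tac.
  apply: (@ptime_find _ _ _ _ (fun z => fits z.1.1 z.1.2 z.2)); last by ptime_tac.
  by apply: ptime_fits; ptime_tac.
- exact: ptime_const.
- by ptime_tac.
- have b : pbound (fun z : seq (seq bool) * seq (seq bool) => esize z.1).
    by apply: pbound_le pbound_esize => -[u v]; rewrite esize_pair /=; lia.
  by apply: pboundS; apply: pboundM; [|apply: pboundS].
move=> {M M0} [M M0] i /= le.
have [sz ub] : size (iter i (greedy_step M M0) [::]) = i /\
    all (fun j => esize j <= esize M) (iter i (greedy_step M M0) [::]).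
  elim: i {le} => // i [sz ub]; rewrite iterS size_rcons sz; split=> //.
  rewrite all_rcons ub andbT esize_nat.
  have := find_size (fits M M0 (iter i (greedy_step M M0) [::])) (iota 0 (size M)).
  by rewrite size_iota; pose proof (@size_esize _ _ M); lia.
apply: leq_trans (esize_bound ub) _; rewrite ltnS leq_mul2r sz.
by pose proof (@size_esize _ _ M); lia.
Qed.

Lemma ptime_model_elements X (eX : Enc X) (M : X -> seq (seq bool)) :
  ptime M -> ptime (fun x => model_elements (M x)).
Proof.
move=> pM; have ps : ptime (fun x => smallest_factor (size (M x))).
  by apply: (ptime_comp1 ptime_smallest_factor); ptime_tac.
apply: ptime_element_list => //.
by apply: (@ptime_comp2 _ _ _ _ _ _ _ _ all_vectors); [exact: ptime_all_vectors| |]; ptime_tac.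
Qed.

Lemma ptime_label_graph : ptime label_graph.
Proof.
have pM : ptime (fun M : seq (seq bool) => M) by exact: ptime_id.
have ps : ptime (fun M : seq (seq bool) => smallest_factor (size M)).
  exact: (ptime_comp1 ptime_smallest_factor (ptime_size_seq pM)).
have pe := ptime_model_elements pM.
have pm : ptime matching.
  by apply: ptime_greedy => //; apply: ptime_commuting_matrix.
apply: ptime_if; last exact: ptime_const.
  apply: (@ptime_all _ _ _ _ (fun M i => i < size M)) => //.
  by ptime_tac.
apply: (@ptime_comp1 _ (seq (seq nat) * seq nat) tree _ _ _ enc); first exact: ptime_cast.
apply: ptime_pair; first exact: ptime_code_table.
apply: (@ptime_map _ _ _ _ _ _ (fun M i => index i (matching M))); last by ptime_tac.
apply: ptime_index; [exact: eqtime_nat | by ptime_tac |].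
by apply: (ptime_comp1 pm); ptime_tac.
Qed.

Import GRing.Theory.

(** * The alternating form and the Heisenberg group *)

Section Form.
Variables p r : nat.
Local Open Scope ring_scope.

Implicit Types v w : {ffun 'I_r -> 'F_p * 'F_p}.

Definition cocycle v w : 'F_p := \sum_i (v i).1 * (w i).2.

Definition sform v w : 'F_p := \sum_i ((v i).1 * (w i).2 - (w i).1 * (v i).2).

Definition single (i : nat) (ab : 'F_p * 'F_p) : {ffun 'I_r -> 'F_p * 'F_p} :=
  [ffun j : 'I_r => if (j : nat) == i then ab else 0].

Lemma sform_cocycle v w : sform v w = cocycle v w - cocycle w v.
Proof. by rewrite /sform /cocycle big_split /= sumrN. Qed.

Lemma sformvv v : sform v v = 0.
Proof. by rewrite sform_cocycle subrr. Qed.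

Lemma sform_opp v w : sform v w = - sform w v.
Proof. by rewrite !sform_cocycle opprB. Qed.

Lemma sform_single v (i : 'I_r) ab : sform v (single i ab) = (v i).1 * ab.2 - ab.1 * (v i).2.
Proof.
rewrite /sform (bigD1 i) //= ffunE eqxx big1 ?addr0 // => j ne.
by rewrite ffunE (negPf (ne : (j : nat) != i)) mulr0 mul0r subrr.
Qed.

Lemma sform_nondeg v : (forall w, sform v w = 0) -> v = 0.
Proof.
move=> H; apply/ffunP => i; rewrite ffunE.
move: (H (single i (0, 1))) (H (single i (1, 0))); rewrite !sform_single /=.
rewrite mulr1 mul0r subr0 mulr0 mul1r sub0r => H1 /eqP; rewrite oppr_eq0 => /eqP H2.
by case: (v i) H1 H2 => a b /= -> ->.
Qed.

Lemma cocycleDl v1 v2 w : cocycle (v1 + v2) w = cocycle v1 w + cocycle v2 w.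
Proof. by rewrite -big_split; apply: eq_bigr => i _; rewrite ffunE mulrDl. Qed.
Lemma cocycleDr v w1 w2 : cocycle v (w1 + w2) = cocycle v w1 + cocycle v w2.
Proof. by rewrite -big_split; apply: eq_bigr => i _; rewrite ffunE mulrDr. Qed.
Lemma cocycleNl v w : cocycle (- v) w = - cocycle v w.
Proof. by rewrite -sumrN; apply: eq_bigr => i _; rewrite ffunE mulNr. Qed.
Lemma cocycle0l w : cocycle 0 w = 0.
Proof. by rewrite /cocycle big1 // => i _; rewrite ffunE mul0r. Qed.
End Form.

Definition heis (p r : nat) : predArgType := ({ffun 'I_r -> 'F_p * 'F_p} * 'F_p)%type.
HB.instance Definition _ p r := Finite.on (heis p r).

Section HeisGroup.
Variables p r : nat.
Local Open Scope ring_scope.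
Implicit Types x y : heis p r.

Definition heis_mul x y : heis p r := (x.1 + y.1, x.2 + y.2 + cocycle x.1 y.1).
Definition heis_one : heis p r := (0, 0).
Definition heis_inv x : heis p r := (- x.1, cocycle x.1 x.1 - x.2).

Lemma heis_mulA : associative heis_mul.
Proof.
move=> [v a] [w b] [u c]; rewrite /heis_mul /= addrA; congr pair.
by rewrite cocycleDl cocycleDr; ring.
Qed.
Lemma heis_mul1 : left_id heis_one heis_mul.
Proof. by move=> [v a]; rewrite /heis_mul /= !add0r cocycle0l addr0. Qed.
Lemma heis_mulV : left_inverse heis_one heis_inv heis_mul.
Proof.
by move=> [v a]; rewrite /heis_mul /= addNr subrK cocycleNl addrN.
Qed.
End HeisGroup.

HB.instance Definition _ p r := Finite_isGroup.Build (heis p r)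
  (@heis_mulA p r) (@heis_mul1 p r) (@heis_mulV p r).

Section Extraspecial.
Variables (p r : nat) (p_pr : prime p) (r_gt0 : 0 < r).
Implicit Types x y : heis p r.

Lemma card_heis : #|heis p r| = p ^ (2 * r + 1).
Proof.
rewrite card_prod card_ffun card_prod !(card_Fp p_pr) card_ord.
by rewrite mulnn -expnM expnD expn1.
Qed.

Lemma heis_commuteP x y : (x * y == y * x)%g = (sform x.1 y.1 == 0%R).
Proof.
rewrite sform_cocycle subr_eq0; apply/eqP/eqP => [|H].
  move/(congr1 snd) => H; apply: (@addrI _ (x.2 + y.2)%R); rewrite [LHS]H.
  by congr (_ + _)%R; exact: addrC.
rewrite /mulg /= /heis_mul H; congr pair; first exact: addrC.
by congr (_ + _)%R; exact: addrC.
Qed.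

Lemma center_heis : 'Z([set: heis p r])%g = [set x : heis p r | x.1 == 0%R].
Proof.
apply/setP => x; rewrite [RHS]inE; apply/centerP/eqP => [[_ cx]|x0].
  apply: sform_nondeg => w; apply/eqP; rewrite -(heis_commuteP x (w, 0%R)).
  by apply/eqP; apply: cx; rewrite inE.
split=> [|y _]; first by rewrite inE.
apply/eqP; rewrite heis_commuteP sform_opp x0 /sform big1 ?oppr0 // => i _.
by rewrite ffunE mulr0 mul0r subrr.
Qed.

Lemma card_center_heis : #|'Z([set: heis p r])%g| = p.
Proof.
rewrite center_heis -[RHS](card_Fp p_pr).
rewrite -(card_imset _ (f := fun c : 'F_p => ((0%R, c) : heis p r))); last by move=> ? ? [].
apply: eq_card => -[v c]; rewrite inE /=; apply/eqP/imsetP => [->|[c' _ [-> _]] //].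
by exists c.
Qed.

Lemma heis_expg1 x n : (x ^+ n)%g.1 = (x.1 *+ n)%R.
Proof. by elim: n => // n IH; rewrite expgS mulrS -IH. Qed.

Lemma heis_extraspecial : extraspecial [set: heis p r].
Proof.
have pG : (p.-group [set: heis p r])%g.
  by rewrite /pgroup cardsT card_heis pnatX pnat_id.
have sGZ : ([set: heis p r]^`(1) \subset 'Z([set: heis p r]))%g.
  rewrite gen_subG; apply/subsetP => _ /imset2P[x y _ _ ->].
  rewrite /= center_heis inE; apply/eqP.
  have E : forall u v : heis p r, (u * v)%g.1 = (u.1 + v.1)%R by [].
  have V : forall u : heis p r, (u^-1)%g.1 = (- u.1)%R by [].
  rewrite commgEl /conjg !E !V; apply/ffunP => i; rewrite !ffunE.
  by case: (x.1 i) (y.1 i) => a b [c d]; congr pair; rewrite /=; ring.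
have GZ : ([set: heis p r]^`(1) = 'Z([set: heis p r]))%g.
  apply/eqP; rewrite eqEsubset sGZ /=; apply/contraT => nsub.
  have := prime_TIg (G := 'Z([set: heis p r])%G) (H := [set: heis p r]^`(1)%G).
  rewrite /= card_center_heis => /(_ p_pr nsub).
  rewrite (setIidPr sGZ) => /commG1P /=.
  move/subsetP => ab; pose i := Ordinal r_gt0.
  have := ab (single r i (1, 0)%R, 0%R) (in_setT _).
  move/centP => /(_ (single r i (0, 1)%R, 0%R) (in_setT _)) /eqP.
  rewrite heis_commuteP sform_single /= ffunE eqxx /= mulr1 mul0r subr0.
  by rewrite oner_eq0.
split; last by rewrite card_center_heis.
split=> //; rewrite (Phi_joing pG) GZ; apply/eqP; rewrite eqEsubset joing_subl andbT.
rewrite join_subG subxx (MhoE _ pG) gen_subG; apply/subsetP => _ /imsetP[x _ ->].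
rewrite /= center_heis inE heis_expg1 expn1; apply/eqP/ffunP => i.
by rewrite ffunMnE ffunE pairMnE !(mulrn_pchar (pchar_Fp p_pr)).
Qed.
End Extraspecial.

Local Close Scope ring_scope.

(** * Hyperbolic pairs in extraspecial groups *)

Lemma expg_Fp (gT : finGroupType) (p : nat) (z : gT) (a b : 'F_p) :
  prime p -> (z ^+ p = 1)%g -> (z ^+ (a + b)%R = z ^+ a * z ^+ b)%g.
Proof.
move=> pp zp; rewrite -expgD -[RHS](expg_mod _ zp) /=.
by rewrite [X in (_ %% X)%N](Fp_cast pp).
Qed.

(** The commutators of an extraspecial group lie in its centre, a group of prime order; their
    logarithm to the base of a generator [z] of the centre is an alternating form. *)
Lemma commutator_form (gT : finGroupType) (p r : nat) :
  prime p -> extraspecial [set: gT] -> #|gT| = p ^ (2 * r + 1) ->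
  exists (kap : gT -> gT -> 'F_p) (z : gT),
    [/\ forall x y w, kap (x * y)%g w = (kap x w + kap y w)%R,
        forall x y, kap y x = (- kap x y)%R,
        forall x y, (kap x y == 0%R) = ((x * y)%g == (y * x)%g),
        #[z]%g = p /\ forall w, kap z w = 0%R
      & #|[set x | [forall y, kap x y == 0%R]]| = p].
Proof.
move=> pp [[_ dG] prZ] cardG.
set G := [set: gT]; set Z := 'Z(G)%g in dG prZ *.
have cZ : #|Z| = p.
  have : #|Z| %| p ^ (2 * r + 1).
    by rewrite -cardG -cardsT cardSg // center_sub.
  by rewrite (Euclid_dvdX _ _ prZ) dvdn_prime2 // => /andP[/eqP].
have /cyclicP[z defZ] : cyclic Z by rewrite prime_cyclic // cZ.
have oz : #[z]%g = p by rewrite orderE -defZ.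
have zp : (z ^+ p = 1)%g by rewrite -oz expg_order.
have zinj (a b : 'F_p) : (z ^+ a)%g = (z ^+ b)%g -> a = b.
  move/eqP; rewrite eq_expg_mod_order oz => /eqP.
  have lt (c : 'F_p) : c < p by rewrite -[X in _ < X](Fp_cast pp).
  by rewrite !modn_small // => /val_inj.
pose lg u : 'F_p := odflt 0%R [pick k : 'F_p | u == (z ^+ k)%g].
have lgE u : u \in Z -> (z ^+ lg u)%g = u.
  rewrite defZ => /cyclePmin[m]; rewrite oz => mp uE; rewrite /lg.
  case: pickP => [k /eqP -> //|/(_ (inZp m)) /=].
  by rewrite uE modn_small ?eqxx // Fp_cast.
have lgX (k : 'F_p) : lg (z ^+ k)%g = k.
  by apply: zinj; apply: lgE; rewrite defZ mem_cycle.
have lgM u v : u \in Z -> v \in Z -> lg (u * v)%g = (lg u + lg v)%R.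
  by move=> /lgE uE /lgE vE; rewrite -{1}uE -{1}vE -(expg_Fp _ _ pp zp) lgX.
have comZ x y : [~ x, y]%g \in Z by rewrite -dG mem_commg ?inE.
have Zc u x : u \in Z -> (u * x = x * u)%g.
  by case/centerP => _ H; apply: H; rewrite inE.
have com1 x y : (lg [~ x, y]%g == 0%R) = ((x * y)%g == (y * x)%g).
  apply/eqP/eqP => [l0|xy].
    by apply/commgP/eqP; rewrite -(lgE _ (comZ x y)) l0 expg0.
  by have /commgP/eqP -> : commute x y by []; rewrite -[1%g](expg0 z) (lgX 0%R).
exists (fun x y => lg [~ x, y]%g), z; split=> //.
- move=> x y w; rewrite commMgJ /conjg (Zc _ y (comZ x w)) mulKg.
  exact: lgM (comZ _ _) (comZ _ _).
- move=> x y; apply/eqP; rewrite -addr_eq0 -lgM // -[X in (_ * X)%g]invgR mulgV.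
  by rewrite -[1%g](expg0 z) (lgX 0%R).
- split=> // w; apply/eqP; rewrite com1; apply/eqP/Zc.
  by rewrite defZ cycle_id.
- transitivity #|Z|; last exact: cZ.
  apply: eq_card => x; rewrite inE.
  apply/forallP/centerP => [H|[_ H] y].
    by split=> [|y _]; rewrite ?inE //; apply/eqP; rewrite -com1.
  by rewrite com1; apply/eqP; apply: H; rewrite inE.
Qed.

Section Frames.
Variables (gT : finGroupType) (p r : nat) (kap : gT -> gT -> 'F_p) (z : gT).
Hypothesis p_pr : prime p.
Hypothesis cardG : #|gT| = p ^ (2 * r + 1).
Hypothesis kapMl : forall x y w, kap (x * y)%g w = (kap x w + kap y w)%R.
Hypothesis kapN : forall x y, kap y x = (- kap x y)%R.
Hypothesis kap_eq0 : forall x y, (kap x y == 0%R) = ((x * y)%g == (y * x)%g).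
Hypothesis oz : #[z]%g = p.
Hypothesis kapz : forall w, kap z w = 0%R.
Hypothesis card_rad : #|[set x | [forall y, kap x y == 0%R]]| = p.

Local Open Scope ring_scope.

Lemma kapxx x : kap x x = 0.
Proof. by apply/eqP; rewrite kap_eq0. Qed.

Lemma kapMr x y w : kap x (y * w)%g = kap x y + kap x w.
Proof. by rewrite kapN kapMl opprD -!kapN. Qed.

Lemma kap1l w : kap 1%g w = 0.
Proof. by apply/eqP; rewrite kap_eq0 mul1g mulg1. Qed.

Lemma kapVl x w : kap x^-1%g w = - kap x w.
Proof. by apply/eqP; rewrite -addr_eq0 -kapMl mulVg kap1l. Qed.

Lemma kapVr x w : kap x w^-1%g = - kap x w.
Proof. by rewrite kapN kapVl opprK kapN. Qed.

Lemma kapXl x n w : kap (x ^+ n)%g w = n%:R * kap x w.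
Proof.
elim: n => [|n IH]; first by rewrite expg0 kap1l mul0r.
by rewrite expgS kapMl IH -nat1r mulrDl mul1r.
Qed.

Lemma kapXFp x (a : 'F_p) w : kap (x ^+ a)%g w = a * kap x w.
Proof. by rewrite kapXl natr_Zp. Qed.

(** The elements [x j], [y j] with j < i form hyperbolic pairs, up to scaling, that are mutually
    orthogonal. *)
Definition frame (i : nat) (x y : nat -> gT) : Prop :=
  forall j k, (j < i)%N -> (k < i)%N ->
  [/\ kap (x j) (x k) = 0, kap (y j) (y k) = 0 & (kap (x j) (y k) == 0) = (j != k)].

(** The elements of the group that stand for the linear combinations of a frame. *)
Definition span_elt i (x y : nat -> gT) (v : {ffun 'I_i -> 'F_p * 'F_p}) : gT :=
  (\prod_(j < i) (x j ^+ (v j).1 * y j ^+ (v j).2))%g.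

Lemma kap_span i x y (v : {ffun 'I_i -> 'F_p * 'F_p}) w :
  kap (span_elt x y v) w = \sum_(j < i) ((v j).1 * kap (x j) w + (v j).2 * kap (y j) w).
Proof.
rewrite /span_elt; elim/big_rec2: _ => [|j u a _ <-]; first exact: kap1l.
by rewrite !kapMl !kapXFp.
Qed.

Lemma kap_span_x i x y (v : {ffun 'I_i -> 'F_p * 'F_p}) (k : 'I_i) : frame i x y ->
  kap (span_elt x y v) (x k) = - ((v k).2 * kap (x k) (y k)).
Proof.
move=> fr; rewrite kap_span (bigD1 k) //= big1 => [|j ne].
  by rewrite kapxx mulr0 add0r addr0 kapN mulrN.
have [-> _ _] := fr j k (ltn_ord _) (ltn_ord _).
have [_ _] := fr k j (ltn_ord _) (ltn_ord _).
rewrite eq_sym in ne; rewrite (ne : (k : nat) != j) => /eqP e.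
by rewrite [kap (y j) _]kapN e oppr0 !mulr0 addr0.
Qed.

Lemma kap_span_y i x y (v : {ffun 'I_i -> 'F_p * 'F_p}) (k : 'I_i) : frame i x y ->
  kap (span_elt x y v) (y k) = (v k).1 * kap (x k) (y k).
Proof.
move=> fr; rewrite kap_span (bigD1 k) //= big1 => [|j ne].
  by rewrite kapxx mulr0 !addr0.
have [_ -> ] := fr j k (ltn_ord _) (ltn_ord _).
by rewrite (ne : (j : nat) != k) => /eqP ->; rewrite !mulr0 addr0.
Qed.

Definition coord i (x y : nat -> gT) g : {ffun 'I_i -> 'F_p * 'F_p} :=
  [ffun j : 'I_i => (kap g (y j) / kap (x j) (y j), - kap g (x j) / kap (x j) (y j))].

(** Orthogonal projection to the complement of a frame. *)
Definition proj i x y g := (g * (span_elt x y (coord i x y g))^-1)%g.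

Lemma frame_neq0 i x y (j : 'I_i) : frame i x y -> kap (x j) (y j) != 0.
Proof. by move=> /(_ j j (ltn_ord _) (ltn_ord _))[_ _ ->]; rewrite eqxx. Qed.

Lemma proj_x i x y g (k : 'I_i) : frame i x y -> kap (proj i x y g) (x k) = 0.
Proof.
move=> fr; rewrite kapMl kapVl kap_span_x // opprK ffunE /= divfK ?subrr //.
exact: frame_neq0 fr.
Qed.

Lemma proj_y i x y g (k : 'I_i) : frame i x y -> kap (proj i x y g) (y k) = 0.
Proof.
move=> fr; rewrite kapMl kapVl kap_span_y // ffunE /= divfK ?subrr //.
exact: frame_neq0 fr.
Qed.

Definition central g := [forall y, kap g y == 0].

(** Modulo the span of [i] hyperbolic pairs, every element commutes with these pairs; were all the
    elements that do so central, the group would have at most p * p ^ (2 i) elements. *)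
Lemma frame_extend_x i x y : (i < r)%N -> frame i x y ->
  exists g, ~~ central g /\
    forall j, (j < i)%N -> kap g (x j) = 0 /\ kap g (y j) = 0.
Proof.
move=> ir fr.
have [g ncg] : exists g, ~~ central (proj i x y g).
  apply/existsP; apply: contraT; rewrite negb_exists => /forallP H.
  pose f (u : gT * {ffun 'I_i -> 'F_p * 'F_p}) := (u.1 * span_elt x y u.2)%g.
  pose S := setX [set g | central g] [set: {ffun 'I_i -> 'F_p * 'F_p}].
  have : (#|gT| <= #|S|)%N.
    rewrite -cardsT; apply: leq_trans (leq_imset_card f _).
    apply/subset_leq_card/subsetP => g _; apply/imsetP.
    exists (proj i x y g, coord i x y g); last by rewrite /f /= mulgKV.
    by rewrite !inE /= -[central _]negbK H.
  rewrite cardsX card_rad cardsT card_ffun card_prod !(card_Fp p_pr) card_ord.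
  rewrite mulnn -expnM -expnS cardG leq_exp2l ?prime_gt1 //; clear -ir; lia.
exists (proj i x y g); split=> // j ji.
by split; [apply: (proj_x g (Ordinal ji)) | apply: (proj_y g (Ordinal ji))].
Qed.

Lemma frame_extend_y i x y g : frame i x y -> ~~ central g ->
  (forall j, (j < i)%N -> kap g (x j) = 0 /\ kap g (y j) = 0) ->
  exists h, kap g h != 0 /\ forall j, (j < i)%N -> kap h (x j) = 0 /\ kap h (y j) = 0.
Proof.
move=> fr; rewrite negb_forall => /existsP[u gu] gxy.
exists (proj i x y u); split; last first.
  by move=> j ji; split; [apply: (proj_x u (Ordinal ji)) | apply: (proj_y u (Ordinal ji))].
rewrite kapMr kapVr [kap g (span_elt _ _ _)]kapN kap_span big1 ?oppr0 ?addr0 // => j _.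
have [gx gy] := gxy j (ltn_ord _).
by rewrite [kap (x j) g]kapN [kap (y j) g]kapN gx gy oppr0 !mulr0 addr0.
Qed.

Lemma frame_rec i x y g h : frame i x y ->
  (forall j, (j < i)%N -> kap g (x j) = 0 /\ kap g (y j) = 0) ->
  kap g h != 0 -> (forall j, (j < i)%N -> kap h (x j) = 0 /\ kap h (y j) = 0) ->
  frame i.+1 (fun j => if j == i then g else x j) (fun j => if j == i then h else y j).
Proof.
move=> fr gxy gh hxy j k; rewrite !ltnS (leq_eqVlt j) (leq_eqVlt k).
case: (eqVneq j i) => [->|ji] /=; case: (eqVneq k i) => [->|ki] //= lj lk.
- by rewrite ?eqxx !kapxx (negPf gh).
- have [-> gy] := gxy _ lk; have [hx ->] := hxy _ lk.
  by rewrite gy eqxx.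
- have [gx gy] := gxy _ lj; have [hx hy] := hxy _ lj.
  by rewrite [kap (x j) g]kapN [kap (y j) h]kapN [kap (x j) h]kapN gx hy hx oppr0 eqxx ji.
- exact: fr.
Qed.

Lemma frame_complete i x y : (i <= r)%N -> frame i x y ->
  exists x' y', frame r x' y' /\ forall j, (j < i)%N -> x' j = x j /\ y' j = y j.
Proof.
move: {2}(r - i)%N (erefl (r - i)%N) => n; elim: n i x y => [|n IH] i x y ri ir fr.
  have -> : r = i by apply/eqP; rewrite eqn_leq ir -subn_eq0 ri.
  by exists x, y.
have lt : (i < r)%N by rewrite -subn_gt0 ri.
have ri' : (r - i.+1 = n)%N by rewrite subnS ri.
have [g [ncg gxy]] := frame_extend_x lt fr.
have [h [gh hxy]] := frame_extend_y fr ncg gxy.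
have [x' [y' [fr' E]]] := IH _ _ _ ri' lt (frame_rec fr gxy gh hxy).
exists x', y'; split=> // j ji; have [-> ->] := E j (ltnW ji).
by rewrite ltn_eqF.
Qed.

(** Coordinates with respect to a full frame identify the group with [heis p r] as far as commuting
    is concerned. The vectors [y i] need not be dual to the [x i], hence the correction by a scalar,
    because of which [y i] is only hit up to its centralizer. *)
Lemma frame_labelling x y : frame r x y ->
  exists k : heis p r -> gT, [/\ bijective k,
    forall u w, ((k u * k w)%g == (k w * k u)%g) = ((u * w)%g == (w * u)%g),
    forall i : 'I_r, k (single r i (1, 0), 0) = x i
  & forall (i : 'I_r) g, ((k (single r i (0, 1)%R, 0%R) * g)%g == (g * k (single r i (0, 1)%R, 0%R))%g)
      = ((y i * g)%g == (g * y i)%g)].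
Proof.
move=> fr.
pose sc (v : {ffun 'I_r -> 'F_p * 'F_p}) : {ffun 'I_r -> 'F_p * 'F_p} :=
  [ffun j : 'I_r => ((v j).1, (v j).2 / kap (x j) (y j))].
pose k (u : heis p r) := (span_elt x y (sc u.1) * z ^+ u.2)%g.
have zp : (z ^+ p = 1)%g by rewrite -oz expg_order.
have kapk u w : kap (k u) w = kap (span_elt x y (sc u.1)) w.
  by rewrite /k kapMl kapXFp kapz mulr0 addr0.
have kk u w : kap (k u) (k w) = sform u.1 w.1.
  rewrite kapk kap_span; apply: eq_bigr => j _.
  rewrite [kap (x j) _]kapN [kap (y j) _]kapN !kapk kap_span_x // kap_span_y //.
  rewrite !ffunE /= opprK divfK ?(frame_neq0 _ fr) // mulrN mulrCA.
  by rewrite -mulrA mulVf ?(frame_neq0 _ fr) // mulr1 [(w.1 j).1 * _]mulrC.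
exists k; split.
- apply: inj_card_bij; last by rewrite card_heis // cardG.
  move=> u w kE; have vE : u.1 = w.1.
    apply/ffunP => j; have nz := frame_neq0 j fr.
    have := congr1 (kap^~ (x j)) kE; have := congr1 (kap^~ (y j)) kE.
    rewrite /= !kapk !kap_span_x ?kap_span_y // !ffunE /= !divfK // => /(mulIf nz) e1 /oppr_inj e2.
    by case: (u.1 j) (w.1 j) e1 e2 => a b [c d] /= -> ->.
  move: kE; rewrite /k vE => /mulgI/eqP; rewrite eq_expg_mod_order oz => /eqP.
  have lt (c : 'F_p) : (c < p)%N by rewrite -[X in (_ < X)%N](Fp_cast p_pr).
  rewrite !modn_small // => /val_inj cE.
  by case: u w vE cE => [a b] [c d] /= -> ->.
- by move=> u w; rewrite -kap_eq0 kk heis_commuteP.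
- move=> i; rewrite /k /= mulg1 /span_elt.
  transitivity (\prod_(j < r | j == i) x j)%g; last exact: big_pred1_eq.
  rewrite [RHS]big_mkcond; apply: eq_bigr => j _ /=.
  rewrite !ffunE; case: (eqVneq j i) => [->|ne]; first by rewrite eqxx mul0r mulg1.
  by rewrite (negPf (ne : (j : nat) != i)) mul0r mulg1.
- move=> i g; rewrite -!kap_eq0 kapk kap_span (bigD1 i) //= big1 => [|j ne].
    rewrite !ffunE eqxx mul0r add0r addr0 mul1r mulf_eq0 invr_eq0.
    by rewrite (negPf (frame_neq0 _ fr)).
  by rewrite !ffunE (negPf (ne : (j : nat) != i)) !mul0r addr0.
Qed.
End Frames.

Local Open Scope ring_scope.

(** * Vectors determined by orthogonality *)

Section Vectors.
Variables p r : nat.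
Local Notation F := 'F_p.
Local Notation V := {ffun 'I_r -> F * F}.
Implicit Types v w m t : V.

Definition scale (l : F) v : V := [ffun i => (l * (v i).1, l * (v i).2)].

Lemma scale1 v : scale 1 v = v.
Proof. by apply/ffunP => i; rewrite ffunE !mul1r; case: (v i). Qed.

Lemma sform_scalel l v w : sform (scale l v) w = l * sform v w.
Proof. by rewrite /sform mulr_sumr; apply: eq_bigr => i _; rewrite ffunE /=; ring. Qed.

Lemma sform_scaler l v w : sform v (scale l w) = l * sform v w.
Proof. by rewrite /sform mulr_sumr; apply: eq_bigr => i _; rewrite ffunE /=; ring. Qed.

Lemma sformDr v w t : sform v (w + t) = sform v w + sform v t.
Proof. by rewrite !sform_cocycle cocycleDl cocycleDr; ring. Qed.

Lemma sformDl v w t : sform (v + w) t = sform v t + sform w t.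
Proof. by rewrite !sform_cocycle cocycleDl cocycleDr; ring. Qed.

Lemma sformNl v w : sform (- v) w = - sform v w.
Proof. by rewrite /sform -sumrN; apply: eq_bigr => i _; rewrite ffunE /=; ring. Qed.

Lemma sform0l v : sform 0 v = 0.
Proof. by rewrite /sform big1 // => i _; rewrite ffunE /= mul0r mulr0 subrr. Qed.

Definition same_perp (pre : seq V) v m := {in pre, forall t, (sform v t == 0) = (sform m t == 0)}.

(** The line of [m] can be recovered from the vectors of [pre] orthogonal to it. *)
Definition pinned (pre : seq V) m := forall v, (v == 0) = (m == 0) ->
  same_perp pre v m -> exists2 l, l != 0 & v = scale l m.

Lemma pinned_sub pre pre' m : {subset pre <= pre'} -> pinned pre m -> pinned pre' m.
Proof. by move=> sub pin v v0 sp; apply: pin => // t /sub; apply: sp. Qed.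

Definition frame_seq n : seq V :=
  flatten [seq [:: single r i (1, 0); single r i (0, 1)] | i <- iota 0 n].

Lemma mem_frame_seq n i : (i < n)%N ->
  single r i (1, 0) \in frame_seq n /\ single r i (0, 1) \in frame_seq n.
Proof.
move=> lt; split; apply/flatten_mapP; exists i; rewrite ?mem_iota //;
  by rewrite !inE eqxx ?orbT.
Qed.

Lemma same_perp_frame pre v m (i : 'I_r) : {subset frame_seq r <= pre} ->
  same_perp pre v m ->
  (((v i).1 == 0) = ((m i).1 == 0)) /\ (((v i).2 == 0) = ((m i).2 == 0)).
Proof.
move=> sub sp; have [e f] := mem_frame_seq (ltn_ord i).
have := sp _ (sub _ e); have := sp _ (sub _ f); rewrite !sform_single /=.
by rewrite !mulr1 !mul0r !mulr0 !mul1r !subr0 !sub0r !oppr_eq0.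
Qed.

Lemma same_perp_frame0 pre v m (i : 'I_r) : {subset frame_seq r <= pre} ->
  same_perp pre v m -> m i = 0 -> v i = 0.
Proof.
move=> sub sp; have [] := same_perp_frame i sub sp.
case: (v i) (m i) => a b [c d] /= e1 e2 [c0 d0].
by move: e1 e2; rewrite c0 d0 eqxx => /eqP -> /eqP ->.
Qed.

Variable o : 'I_r.
Hypothesis o0 : (o : nat) = 0%N.

Definition plane (i : nat) (ab cd : F * F) : V :=
  [ffun t : 'I_r => if (t : nat) == 0%N then ab else if (t : nat) == i then cd else 0].

Lemma plane_o i ab cd : plane i ab cd o = ab.
Proof. by rewrite ffunE o0. Qed.

Lemma plane_i (i : 'I_r) ab cd : i != o -> plane i ab cd i = cd.
Proof.
by move=> ne; rewrite ffunE eqxx -o0 (negPf (ne : (i : nat) != o)).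
Qed.

Lemma plane_j i (j : 'I_r) ab cd : j != o -> (j : nat) != i -> plane i ab cd j = 0.
Proof. by move=> ne ji; rewrite ffunE (negPf ji) -o0 (negPf (ne : (j : nat) != o)). Qed.

Lemma single_plane (i : 'I_r) ab : i != o -> single r 0 ab = plane i ab 0.
Proof. by move=> ne; apply/ffunP => j; rewrite !ffunE; case: eqP => //; case: eqP. Qed.

Lemma sform_plane v (i : 'I_r) ab cd : i != o ->
  sform v (plane i ab cd) = ((v o).1 * ab.2 - ab.1 * (v o).2) + ((v i).1 * cd.2 - cd.1 * (v i).2).
Proof.
move=> ne; rewrite /sform (bigD1 o) //= (bigD1 i) //= plane_o plane_i //.
rewrite big1 ?addr0 // => j /andP[jo ji].
by rewrite plane_j // mulr0 mul0r subrr.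
Qed.

(** For a vector supported on the pairs [0] and [i], being pinned only depends on four
    coordinates. *)
Lemma pinned_plane (pre : seq V) (i : 'I_r) (a b c d : F) : i != o -> {subset frame_seq r <= pre} ->
  (forall a' b' c' d' : F, (a' == 0) = (a == 0) -> (b' == 0) = (b == 0) ->
    (c' == 0) = (c == 0) -> (d' == 0) = (d == 0) ->
    (forall x y z u : F, plane i (x, y) (z, u) \in pre ->
      (a * y - x * b) + (c * u - z * d) = 0 -> (a' * y - x * b') + (c' * u - z * d') = 0) ->
    exists2 l, l != 0 & [/\ a' = l * a, b' = l * b, c' = l * c & d' = l * d]) ->
  pinned pre (plane i (a, b) (c, d)).
Proof.
move=> ne sub H v v0 sp.
have [eo1 eo2] := same_perp_frame o sub sp; have [ei1 ei2] := same_perp_frame i sub sp.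
rewrite plane_o /= in eo1 eo2; rewrite plane_i //= in ei1 ei2.
have [x y z w xpre|l l0 [E1 E2 E3 E4]] := H _ _ _ _ eo1 eo2 ei1 ei2.
  by move=> m0; have := sp _ xpre; rewrite !sform_plane // plane_o plane_i // m0 eqxx => /eqP.
exists l => //; apply/ffunP => j; rewrite !ffunE.
case: (eqVneq j o) => [->|jo].
  by rewrite o0 eqxx /= -E1 -E2; case: (v o).
have j0 : ((j : nat) == 0%N) = false by rewrite -o0 (negPf (jo : (j : nat) != o)).
rewrite !j0.
case: (eqVneq j i) => [->|ji]; first by rewrite !eqxx /= -E3 -E4; case: (v i).
rewrite (negPf (ji : (j : nat) != i)) /= !mulr0.
by rewrite (same_perp_frame0 sub sp) // plane_j.
Qed.

(** Certificates for linear consequences of three equations, checked by [ring]. *)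
Lemma lin3 (x y e1 e2 e3 k1 k2 k3 : F) : e1 = 0 -> e2 = 0 -> e3 = 0 ->
  x - y = k1 * e1 + k2 * e2 + k3 * e3 -> x = y.
Proof. by move=> -> -> -> /eqP; rewrite !mulr0 !addr0 subr_eq0 => /eqP. Qed.

(** Orthogonality to a known vector (x, y, z, u) on the pairs 0 and i is a linear equation between the
    four coordinates of an unknown vector, and the frame tells which of them vanish. Each step below
    collects enough equations to leave a single line. From (1, 0, 1, 0) and (1, 1, 0, 0) one gets
    (0, 1, 0, -1), (1, 1, 1, -1), (0, 0, 1, -1) and (1, 0, 0, 1); then (0, 1, 0, -k) gives
    (k, 1, 1, -1), which gives (k + 1, 1, 1, 0), which gives (0, 1, 0, -(k + 1)). *)

Section Steps.
Variables (pre : seq V) (i : 'I_r).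
Hypotheses (io : i != o) (frame_pre : {subset frame_seq r <= pre}).
Local Notation known a b c d := (plane i (a, b) (c, d) \in pre).
Local Notation fixes a b c d := (pinned pre (plane i (a, b) (c, d))).

Ltac zero_of E := apply/eqP; rewrite E ?eqxx ?oppr_eq0 ?oner_eq0.

Lemma step_g1 : known 1 0 1 0 -> fixes 0 1 0 (-1).
Proof.
move=> k1; apply: pinned_plane => // a b c d ea eb ec ed H.
have h1 := H _ _ _ _ k1 ltac:(ring).
have a0 : a = 0 by zero_of ea.
have c0 : c = 0 by zero_of ec.
exists b; first by rewrite eb oner_eq0.
split; rewrite ?a0 ?c0 ?mulr0 ?mulr1 //.
by apply: (@lin3 _ _ _ 0 0 (-1) 0 0 h1) => //; ring.
Qed.

Lemma step_w : known 1 1 0 0 -> known 1 0 1 0 -> known 0 1 0 (-1) -> fixes 1 1 1 (-1).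
Proof.
move=> k1 k2 k3; apply: pinned_plane => // a b c d ea eb ec ed H.
have h1 := H _ _ _ _ k1 ltac:(ring).
have h2 := H _ _ _ _ k2 ltac:(ring).
have h3 := H _ _ _ _ k3 ltac:(ring).
exists a; first by rewrite ea oner_eq0.
split.
- by rewrite mulr1.
- by apply: (@lin3 _ _ _ _ _ (-1) 0 0 h1 h2 h3); ring.
- by apply: (@lin3 _ _ _ _ _ 0 0 (-1) h1 h2 h3); ring.
- by apply: (@lin3 _ _ _ _ _ 1 (-1) 0 h1 h2 h3); ring.
Qed.

Lemma step_cd : known 1 1 1 (-1) -> fixes 0 0 1 (-1).
Proof.
move=> k1; apply: pinned_plane => // a b c d ea eb ec ed H.
have h1 := H _ _ _ _ k1 ltac:(ring).
have a0 : a = 0 by zero_of ea.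
have b0 : b = 0 by zero_of eb.
exists c; first by rewrite ec oner_eq0.
split; rewrite ?a0 ?b0 ?mulr0 ?mulr1 //.
by apply: (@lin3 _ _ _ _ _ (-1) 1 (-1) h1 a0 b0) => //; ring.
Qed.

Lemma step_ad : known 1 1 1 (-1) -> fixes 1 0 0 1.
Proof.
move=> k1; apply: pinned_plane => // a b c d ea eb ec ed H.
have h1 := H _ _ _ _ k1 ltac:(ring).
have b0 : b = 0 by zero_of eb.
have c0 : c = 0 by zero_of ec.
exists a; first by rewrite ea oner_eq0.
split; rewrite ?b0 ?c0 ?mulr0 ?mulr1 //.
by apply: (@lin3 _ _ _ _ _ (-1) (-1) (-1) h1 b0 c0) => //; ring.
Qed.

Lemma step_v k : known 0 1 0 (- k) -> known 0 0 1 (-1) -> known 1 0 1 0 ->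
  fixes k 1 1 (-1).
Proof.
move=> k1 k2 k3; apply: pinned_plane => // a b c d ea eb ec ed H.
have h1 := H _ _ _ _ k1 ltac:(ring).
have h2 := H _ _ _ _ k2 ltac:(ring).
have h3 := H _ _ _ _ k3 ltac:(ring).
exists c; first by rewrite ec oner_eq0.
split.
- by apply: (@lin3 _ _ _ _ _ 1 0 0 h1 h2 h3); ring.
- by apply: (@lin3 _ _ _ _ _ 0 1 (-1) h1 h2 h3); ring.
- by rewrite mulr1.
- by apply: (@lin3 _ _ _ _ _ 0 (-1) 0 h1 h2 h3); ring.
Qed.

Lemma step_t k : known k 1 1 (-1) -> known 1 0 0 1 -> fixes (k + 1) 1 1 0.
Proof.
move=> k1 k2; apply: pinned_plane => // a b c d ea eb ec ed H.
have h1 := H _ _ _ _ k1 ltac:(ring).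
have h2 := H _ _ _ _ k2 ltac:(ring).
have d0 : d = 0 by zero_of ed.
exists b; first by rewrite eb oner_eq0.
split; rewrite ?d0 ?mulr0 ?mulr1 //.
- by apply: (@lin3 _ _ _ _ _ 1 1 1 h1 h2 d0); ring.
- by apply: (@lin3 _ _ _ _ _ 0 1 0 h1 h2 d0); ring.
Qed.

Lemma step_g k : known k 1 1 0 -> fixes 0 1 0 (- k).
Proof.
move=> k1; apply: pinned_plane => // a b c d ea eb ec ed H.
have h1 := H _ _ _ _ k1 ltac:(ring).
have a0 : a = 0 by zero_of ea.
have c0 : c = 0 by zero_of ec.
exists b; first by rewrite eb oner_eq0.
split; rewrite ?a0 ?c0 ?mulr0 ?mulr1 //.
by apply: (@lin3 _ _ _ _ _ (-1) 1 0 h1 a0 c0) => //; ring.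
Qed.

Lemma step_ab k : known k 1 1 0 -> fixes k 1 0 0.
Proof.
move=> k1; apply: pinned_plane => // a b c d ea eb ec ed H.
have h1 := H _ _ _ _ k1 ltac:(ring).
have c0 : c = 0 by zero_of ec.
have d0 : d = 0 by zero_of ed.
exists b; first by rewrite eb oner_eq0.
split; rewrite ?c0 ?d0 ?mulr0 ?mulr1 //.
by apply: (@lin3 _ _ _ _ _ 1 0 1 h1 c0 d0) => //; ring.
Qed.
End Steps.

(** The orthogonality to the vectors built above yields all the ratios of the coordinates of [m] to
    its first one. *)
Lemma pinned_full_head (pre : seq V) m : {subset frame_seq r <= pre} ->
  (forall k, k != 0 -> single r 0 (k, 1) \in pre) ->
  (forall (i : 'I_r) k, i != o -> plane i (k, 1) (1, 0) \in pre) ->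
  (forall (i : 'I_r) k, i != o -> plane i (0, 1) (0, - k) \in pre) ->
  (m o).1 != 0 -> (m o).2 != 0 -> pinned pre m.
Proof.
move=> sub pab pt pg a0 b0 v _ sp.
have tr t : t \in pre -> sform m t = 0 -> sform v t = 0.
  by move=> tp mt; apply/eqP; rewrite sp // mt.
have [eo1 eo2] := same_perp_frame o sub sp.
set a := (m o).1 in a0 eo1 *; set b := (m o).2 in b0 eo2 *.
have ea : (v o).1 = (v o).1 / a * a by rewrite divfK.
exists ((v o).1 / a); first by rewrite mulf_neq0 ?invr_eq0 ?eo1.
have eb : (v o).2 = (v o).1 / a * b.
  have := tr _ (pab (a / b) _); rewrite mulf_neq0 ?invr_eq0 // => /(_ isT).
  rewrite -[X in single r X]o0 !sform_single /= -/a -/b !mulr1.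
  rewrite divfK // subrr => /(_ erefl) /eqP; rewrite subr_eq0 => /eqP ->.
  by field; rewrite a0 b0.
apply/ffunP => i; rewrite [RHS]ffunE; case: (eqVneq i o) => [->|io].
  by rewrite -/a -/b -ea -eb; case: (v o).
have [ei1 ei2] := same_perp_frame i sub sp.
have ec : (v i).1 = (v o).1 / a * (m i).1.
  case: (eqVneq (m i).1 0) ei1 => [-> /eqP ->|c0 _]; first by rewrite mulr0.
  have := tr _ (pg i (a / (m i).1) io); rewrite !sform_plane //= -/a -/b.
  move=> h; have {}h := h ltac:(by field).
  have: (v i).1 * a = (v o).1 * (m i).1; last first.
    by move=> e; rewrite -[LHS](mulfK a0) e mulrAC.
  apply: (@lin3 _ _ _ 0 0 (- (m i).1) 0 0 h) => //.
  by field.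
have ed : (v i).2 = (v o).1 / a * (m i).2.
  have := tr _ (pt i ((a - (m i).2) / b) io); rewrite !sform_plane //= -/a -/b.
  move=> h; have {}h := h ltac:(by field).
  move: h; rewrite eb => h.
  apply: (@lin3 _ _ _ 0 0 (-1) 0 0 h) => //.
  by field; rewrite a0 b0.
by rewrite -ec -ed; case: (v i).
Qed.
End Vectors.

Local Close Scope ring_scope.

Local Open Scope ring_scope.

(** Stated without the form, whose values depend on the choice of a generator of the centre. *)
Definition comm_frame (gT : finGroupType) (i : nat) (x y : nat -> gT) : Prop :=
  forall j k, (j < i)%N -> (k < i)%N ->
  [/\ commute (x j) (x k), commute (y j) (y k)
    & ((x j * y k)%g == (y k * x j)%g) = (j != k)].

Section ExtraspecialFrames.
Variables (gT : finGroupType) (p r : nat).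
Hypotheses (p_pr : prime p) (exG : extraspecial [set: gT]) (cardG : #|gT| = (p ^ (2 * r + 1))%N).

Lemma comm_frame_rec i (x y : nat -> gT) g h : comm_frame i x y ->
  (forall j, (j < i)%N -> commute g (x j) /\ commute g (y j)) ->
  ~ commute g h -> (forall j, (j < i)%N -> commute h (x j) /\ commute h (y j)) ->
  comm_frame i.+1 (fun j => if j == i then g else x j) (fun j => if j == i then h else y j).
Proof.
move=> fr gxy gh hxy.
have [kap [z [kapMl kapN kap0 [oz kapz] rad]]] := commutator_form p_pr exG cardG.
have kapP u w : commute u w <-> kap u w = 0.
  by split=> [c|/eqP]; [apply/eqP; rewrite kap0; apply/eqP | rewrite kap0 => /eqP].
have fr1 : frame kap i x y.
  by move=> j k ji ki; have [/kapP -> /kapP -> e] := fr j k ji ki; rewrite kap0.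
have gxy1 j : (j < i)%N -> kap g (x j) = 0 /\ kap g (y j) = 0.
  by move=> /gxy[/kapP -> /kapP ->].
have hxy1 j : (j < i)%N -> kap h (x j) = 0 /\ kap h (y j) = 0.
  by move=> /hxy[/kapP -> /kapP ->].
have gh1 : kap g h != 0 by apply/eqP => /kapP.
have fr2 := frame_rec kapN kap0 fr1 gxy1 gh1 hxy1.
by move=> j k ji ki; have [/kapP ? /kapP ?] := fr2 j k ji ki; rewrite kap0.
Qed.

Lemma comm_frame_partner i (x y : nat -> gT) g : comm_frame i x y ->
  (exists h, ~ commute g h) ->
  (forall j, (j < i)%N -> commute g (x j) /\ commute g (y j)) ->
  exists h, ~ commute g h /\ forall j, (j < i)%N -> commute h (x j) /\ commute h (y j).
Proof.
move=> fr ncg gxy.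
have [kap [z [kapMl kapN kap0 [oz kapz] rad]]] := commutator_form p_pr exG cardG.
have kapP u w : commute u w <-> kap u w = 0.
  by split=> [c|/eqP]; [apply/eqP; rewrite kap0; apply/eqP | rewrite kap0 => /eqP].
have fr1 : frame kap i x y.
  by move=> j k ji ki; have [/kapP -> /kapP -> e] := fr j k ji ki; rewrite kap0.
have gxy1 j : (j < i)%N -> kap g (x j) = 0 /\ kap g (y j) = 0.
  by move=> /gxy[/kapP -> /kapP ->].
have ncg1 : ~~ central kap g.
  by apply/forallPn; case: ncg => h ncg; exists h; apply/eqP => /kapP.
have [h [/eqP gh hxy]] := frame_extend_y kapMl kapN kap0 fr1 ncg1 gxy1.
exists h; split; first by move/kapP.
by move=> j /hxy[/kapP ? /kapP ?].
Qed.

Lemma extraspecial_labelling i (x y : nat -> gT) : (i <= r)%N -> comm_frame i x y ->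
  exists k : heis p r -> gT, [/\ bijective k,
    forall u w, ((k u * k w)%g == (k w * k u)%g) = ((u * w)%g == (w * u)%g),
    forall j, (j < i)%N -> k (single r j (1, 0), 0) = x j
  & forall j g, (j < i)%N ->
      ((k (single r j (0, 1)%R, 0%R) * g)%g == (g * k (single r j (0, 1)%R, 0%R))%g)
      = ((y j * g)%g == (g * y j)%g)].
Proof.
move=> ir fr.
have [kap [z [kapMl kapN kap0 [oz kapz] rad]]] := commutator_form p_pr exG cardG.
have kapP u w : commute u w <-> kap u w = 0.
  by split=> [c|/eqP]; [apply/eqP; rewrite kap0; apply/eqP | rewrite kap0 => /eqP].
have fr1 : frame kap i x y.
  move=> j k ji ki; have [/kapP -> /kapP -> e] := fr j k ji ki.
  by rewrite kap0.
have [x' [y' [fr' E]]] := frame_complete p_pr cardG kapMl kapN kap0 rad ir fr1.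
have [k [bk ck kx ky]] := frame_labelling p_pr cardG kapMl kapN kap0 oz kapz fr'.
exists k; split=> // j; [move=> ji | move=> g ji]; have [Ex Ey] := E j ji.
  by rewrite -Ex (kx (Ordinal (leq_trans ji ir))).
by rewrite -Ey (ky (Ordinal (leq_trans ji ir))).
Qed.
End ExtraspecialFrames.

Section PinnedAny.
Variables (p r : nat).
Hypotheses (p_pr : prime p) (p_odd : odd p).
Local Notation F := 'F_p.
Local Notation V := {ffun 'I_r -> F * F}.

Lemma two_neq0 : (2%:R : F) != 0.
Proof.
rewrite -(dvdn_pcharf (pchar_Fp p_pr)) dvdn_prime2 //.
by apply: contraTneq p_odd => ->.
Qed.

(** This is where p has to be odd: 1 and 2 are distinct and non-zero. *)
Lemma other_scalar (a : F) : exists2 l : F, l != 0 & l != a.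
Proof.
case: (eqVneq a 1) => [->|ne]; last by exists 1; rewrite ?oner_eq0 // eq_sym.
exists 2%:R; first exact: two_neq0.
by rewrite -subr_eq0 -[2%N]/(1 + 1)%N natrD addrK oner_eq0.
Qed.

(** Non-zero linear forms are proportional when the kernel of one contains that of the other. *)
Lemma perp_proportional (v m : V) : v != 0 -> m != 0 ->
  (forall t, sform m t = 0 -> sform v t = 0) -> exists2 l, l != 0 & v = scale l m.
Proof.
move=> v0 m0 H.
have [t0 mt0] : exists t0, sform m t0 != 0.
  apply/existsP; apply: contraR m0; rewrite negb_exists => /forallP H0.
  by apply/eqP/sform_nondeg => w; apply/eqP; rewrite -[_ == _]negbK H0.
have E : v = scale (sform v t0 / sform m t0) m.
  apply/eqP; rewrite -subr_eq0; apply/eqP/sform_nondeg => w.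
  have := H (w + scale (- (sform m w / sform m t0)) t0).
  rewrite !sformDr !sform_scaler mulNr divfK // subrr => /(_ erefl) vw.
  rewrite sformDl sformNl sform_scalel -[RHS]vw; field.
  by rewrite mt0.
exists (sform v t0 / sform m t0) => //.
apply: contra_neq v0 => l0; rewrite E l0.
by apply/ffunP => i; rewrite !ffunE !mul0r.
Qed.

Variable o : 'I_r.
Hypothesis o0 : (o : nat) = 0%N.

Definition full_vector (t : V) := ((t o).1 != 0) && ((t o).2 != 0).

(** Let [s] be a vector orthogonal to [m] with two non-zero coordinates in the first pair. Any vector
    orthogonal to [m] is the sum of a non-zero multiple of [s] and of another vector with both these
    properties, so orthogonality to the vectors of [pre] controls the whole hyperplane. There is no
    such [s] only when [m] is a multiple of e_0 or f_0, and then the frame suffices. *)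
Lemma pinned_any (pre : seq V) m : (1 < r)%N -> {subset frame_seq p r r <= pre} ->
  (forall t, full_vector t -> t \in pre) -> pinned pre m.
Proof.
move=> r1 sub full v v0m sp.
case: (eqVneq m 0) v0m => [-> /eqP -> | m0 v0].
  by exists 1; rewrite ?oner_eq0 // scale1.
case: (boolP [exists s, full_vector s && (sform m s == 0)]) => [|nex].
  case/existsP => s /andP[sf /eqP ms].
  have tr t : full_vector t -> sform m t = 0 -> sform v t = 0.
    by move=> /full tp mt; apply/eqP; rewrite sp // mt.
  apply: perp_proportional; rewrite ?v0 // => t mt.
  case: (boolP (full_vector t)) => [tf|]; first exact: tr.
  rewrite negb_and !negbK => t0.
  have [l l0 tl] : exists2 l, l != 0 & full_vector (t + scale (- l) s).
    case/andP: sf => s1 s2; case/orP: t0 => /eqP t0.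
      have [l l0 la] := other_scalar ((t o).2 / (s o).2).
      exists l => //; rewrite /full_vector !ffunE /= t0 add0r mulf_neq0 ?oppr_eq0 //=.
      apply: contra_neq la => e; apply: (mulIf s2); rewrite divfK //.
      by apply/eqP; rewrite eq_sym -subr_eq0 -mulNr e.
    have [l l0 la] := other_scalar ((t o).1 / (s o).1).
    exists l => //; rewrite /full_vector !ffunE /= t0 add0r andbC mulf_neq0 ?oppr_eq0 //=.
    apply: contra_neq la => e; apply: (mulIf s1); rewrite divfK //.
    by apply/eqP; rewrite eq_sym -subr_eq0 -mulNr e.
  have := tr _ tl; rewrite !sformDr !sform_scaler ms mt mulr0 addr0 => /(_ erefl).
  by rewrite (tr s) // mulr0 addr0.
have rest0 (i : 'I_r) : i != o -> m i = 0.
  move=> io; apply: contraNeq nex => mi; apply/existsP.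
  case: (eqVneq (m i).1 0) => [c0|c0].
    have d0 : (m i).2 != 0.
      by apply: contra_neq mi; case: (m i) c0 => c d /= -> ->.
    exists (plane r i (1, 1) (((m o).1 - (m o).2) / (m i).2, 0)).
    rewrite /full_vector plane_o // [_.1]/= [_.2]/= oner_eq0 andTb (sform_plane o0) //=.
    by apply/eqP; field.
  exists (plane r i (1, 1) (0, ((m o).2 - (m o).1) / (m i).1)).
  rewrite /full_vector plane_o // [_.1]/= [_.2]/= oner_eq0 andTb (sform_plane o0) //=.
  by apply/eqP; field.
have mo : ((m o).1 == 0) || ((m o).2 == 0).
  rewrite -[_ || _]negbK negb_or; apply: contra nex => mf.
  by apply/existsP; exists m; rewrite /full_vector mf sformvv eqxx.
have mo' : m o != 0.
  apply: contra_neq m0 => mo0; apply/ffunP => i; rewrite [RHS]ffunE.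
  by case: (eqVneq i o) => [->|/rest0].
have [e1 e2] := same_perp_frame o sub sp.
have vrest (i : 'I_r) : i != o -> v i = 0.
  by move=> /rest0; apply: same_perp_frame0 sub sp.
case/orP: mo => /eqP z0.
  have b0 : (m o).2 != 0 by apply: contra_neq mo'; case: (m o) z0 => c d /= -> ->.
  exists ((v o).2 / (m o).2); first by rewrite mulf_neq0 ?invr_eq0 ?e2.
  apply/ffunP => i; rewrite ffunE; case: (eqVneq i o) => [->|io].
    rewrite divfK // z0 mulr0; move: e1; rewrite z0 eqxx => /eqP.
    by case: (v o) => a b /= ->.
  by rewrite (vrest i io) (rest0 i io) /= mulr0.
have a0 : (m o).1 != 0 by apply: contra_neq mo'; case: (m o) z0 => c d /= -> ->.
exists ((v o).1 / (m o).1); first by rewrite mulf_neq0 ?invr_eq0 ?e1.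
apply/ffunP => i; rewrite ffunE; case: (eqVneq i o) => [->|io].
  rewrite divfK // z0 mulr0; move: e2; rewrite z0 eqxx => /eqP.
  by case: (v o) => a b /= ->.
by rewrite (vrest i io) (rest0 i io) /= mulr0.
Qed.
End PinnedAny.

Local Close Scope ring_scope.

Local Open Scope ring_scope.

(** * Choices that cannot be wrong *)

Section Chain.
Variables (T : eqType) (P : seq T -> T -> Prop).

Fixpoint chain (pre l : seq T) : Prop :=
  if l is m :: l' then P pre m /\ chain (rcons pre m) l' else True.

Lemma chain_cat pre l l' : chain pre l -> chain (pre ++ l) l' -> chain pre (l ++ l').
Proof.
elim: l pre => [|m l IH] pre /=; first by rewrite cats0.
by case=> Pm cl cl'; split=> //; apply: IH; rewrite ?cat_rcons.
Qed.

Lemma chain_split pre l1 m l2 : chain pre (l1 ++ m :: l2) -> P (pre ++ l1) m.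
Proof.
elim: l1 pre => [|x l1 IH] pre /=; first by rewrite cats0; case.
by case=> _ /IH; rewrite cat_rcons.
Qed.

Lemma chain_flatten pre (f : nat -> seq T) n :
  (forall i, (i < n)%N -> chain (pre ++ flatten [seq f j | j <- iota 0 i]) (f i)) ->
  chain pre (flatten [seq f j | j <- iota 0 n]).
Proof.
elim: n => [|n IH] // H; rewrite -addn1 iotaD map_cat flatten_cat.
apply: chain_cat; first by apply: IH => i lt; apply: H; apply: ltnW.
by rewrite /= cats0; apply: H.
Qed.

Hypothesis P_sub : forall pre pre' m, {subset pre <= pre'} -> P pre m -> P pre' m.

Lemma chain_all pre l : (forall m, m \in l -> P pre m) -> chain pre l.
Proof.
elim: l pre => //= m l IH pre H; split; first by apply: H; rewrite mem_head.
apply: IH => x xl; apply: (@P_sub pre); last by apply: H; rewrite inE xl orbT.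
by move=> y yp; rewrite mem_rcons inE yp orbT.
Qed.
End Chain.

Lemma chain_impl (T : eqType) (P Q : seq T -> T -> Prop) pre l :
  (forall pre' m, P pre' m -> Q pre' m) -> chain P pre l -> chain Q pre l.
Proof.
by move=> PQ; elim: l pre => //= m l IH pre [/PQ Pm /IH].
Qed.

Section Good.
Variables (p r : nat).
Hypotheses (p_pr : prime p) (p_odd : odd p) (r_gt1 : (1 < r)%N).
Local Notation F := 'F_p.
Local Notation V := {ffun 'I_r -> F * F}.
Local Notation W := (heis p r).

(** Twins have the same centralizer; the form only sees the first components. *)
Definition twin (u w : W) := forall t, (sform u.1 t == 0) = (sform w.1 t == 0).

Lemma twin_trans u w t : twin u w -> twin w t -> twin u t.
Proof. by move=> H H' x; rewrite H H'. Qed.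

Lemma twin_scale l (v : V) (c c' : F) : l != 0 -> twin (scale l v, c) (v, c').
Proof. by move=> l0 t; rewrite /= sform_scalel mulf_eq0 (negPf l0). Qed.

Definition perp_auto (f : W -> W) := bijective f /\
  forall u w, (sform (f u).1 (f w).1 == 0) = (sform u.1 w.1 == 0).

(** [good pre m] is what makes the choice of a vertex for [m] irrevocable: any vertex [v] that the
    pattern of commutation with [pre] cannot tell from [m] is the image of [m] under a symmetry that
    does not disturb [pre]. *)
Definition good (pre : seq V) (m : V) := forall v : V, (v == 0) = (m == 0) ->
  same_perp pre v m ->
  exists f, [/\ perp_auto f, forall t c, t \in pre -> twin (f (t, c)) (t, c)
    & forall c, twin (f (v, c)) (m, c)].

Lemma good_pinned pre m : pinned pre m -> good pre m.
Proof.
move=> pin v v0 sp; have [l l0 ->] := pin v v0 sp.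
exists id; split=> // [|c]; last exact: twin_scale.
by split=> //; exists id.
Qed.

(** Symmetries are found as labellings from the model to the model, that is, in the wrong direction. *)
Lemma perp_auto_inv (k : W -> W) : perp_auto k ->
  exists f, perp_auto f /\ forall u w, twin (k u) w -> twin (f w) u.
Proof.
case=> -[f kf fk] kP; exists f; split.
  split=> [|u w]; first by exists k.
  by rewrite -{2}(fk u) -{2}(fk w) kP.
move=> u w tw t; rewrite -[t](congr1 fst (kf (t, 0))) -kP fk.
by rewrite kf -(kP u (t, 0)); symmetry; apply: tw.
Qed.

Lemma heis_perp_auto (k : W -> W) : bijective k ->
  (forall u w, ((k u * k w)%g == (k w * k u)%g) = ((u * w)%g == (w * u)%g)) -> perp_auto k.
Proof. by move=> bk H; split=> // u w; rewrite -!heis_commuteP H. Qed.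

Lemma sform_single2 j k (ab cd : F * F) : (j < r)%N ->
  sform (single r j ab) (single r k cd) = if j == k then ab.1 * cd.2 - cd.1 * ab.2 else 0.
Proof.
move=> jr; rewrite sform_opp (sform_single _ (Ordinal jr)) ffunE /=.
by case: eqP => _ /=; ring.
Qed.

Lemma commute_sform (u w : W) : commute u w <-> sform u.1 w.1 = 0.
Proof.
by split=> [c|/eqP]; [apply/eqP; rewrite -heis_commuteP; apply/eqP |
  rewrite -heis_commuteP => /eqP].
Qed.

Let xs j : W := (single r j (1, 0), 0).
Let ys j : W := (single r j (0, 1), 0).

Lemma heis_frame i : (i <= r)%N -> comm_frame i xs ys.
Proof.
move=> ir j k ji ki; have jr := leq_trans ji ir.
split; try by apply/commute_sform; rewrite /= sform_single2 //; case: eqP => _ //=; ring.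
rewrite heis_commuteP sform_single2 //; case: (j =P k) => _; last by rewrite eqxx.
by rewrite mul0r subr0 mulr1 oner_eq0.
Qed.

(** A symmetry that carries a frame containing [v] to the standard one, up to twins, with [v] going
    to [m]. *)
Lemma good_of_frame i (x y : nat -> W) (pre : seq V) (m v : V) : (i <= r)%N -> comm_frame i x y ->
  (forall t, t \in pre -> (exists2 j, (j < i)%N & t = single r j (1, 0) /\ twin (x j) (t, 0))
    \/ (exists2 j, (j < i)%N & t = single r j (0, 1) /\ twin (y j) (t, 0))) ->
  (exists2 j, (j < i)%N & m = single r j (1, 0) /\ twin (x j) (v, 0))
    \/ (exists2 j, (j < i)%N & m = single r j (0, 1) /\ twin (y j) (v, 0)) ->
  exists f, [/\ perp_auto f, forall t c, t \in pre -> twin (f (t, c)) (t, c)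
    & forall c, twin (f (v, c)) (m, c)].
Proof.
move=> ir fr Hpre Hm.
have rg : (0 < r)%N by apply: ltnW.
have [k [bk ck kx ky]] := extraspecial_labelling p_pr (heis_extraspecial p_pr rg)
  (card_heis r p_pr) ir fr.
have kauto := heis_perp_auto bk ck.
have [f [fauto H]] := perp_auto_inv kauto.
have tx j c t : (j < i)%N -> twin (x j) (t, 0) -> twin (f (t, c)) (single r j (1, 0), c).
  by move=> ji tw; apply: (H (_, 0)); rewrite kx.
have ty j c t : (j < i)%N -> twin (y j) (t, 0) -> twin (f (t, c)) (single r j (0, 1), c).
  move=> ji tw; apply: (H (_, 0)); apply: twin_trans tw.
  by move=> u; rewrite -!(heis_commuteP _ (u, 0)) ky.
exists f; split=> // [t c /Hpre|c].
  by case=> -[j ji [-> tw]]; [apply: tx | apply: ty].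
by case: Hm => -[j ji [-> tw]]; [apply: tx | apply: ty].
Qed.

Lemma frame_seqP i t : t \in frame_seq p r i ->
  exists2 j, (j < i)%N & t = single r j (1, 0) \/ t = single r j (0, 1).
Proof.
case/flatten_mapP => j; rewrite mem_iota => /= ji; rewrite !inE => /orP[]/eqP ->;
  by exists j; auto.
Qed.

(** The pattern says that [v] is orthogonal to the frame so far, so that [v] and a suitable partner
    extend it by one more pair. *)
Lemma good_single_x i : (i < r)%N -> good (frame_seq p r i) (single r i (1, 0)).
Proof.
move=> ir v v0 sp.
have rg : (0 < r)%N by apply: ltnW.
have vn0 : v != 0.
  rewrite v0; apply/eqP => /ffunP/(_ (Ordinal ir))/(congr1 fst)/eqP.
  by rewrite !ffunE eqxx oner_eq0.
have fr := heis_frame (ltnW ir).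
have exW := heis_extraspecial p_pr rg; have cW := card_heis r p_pr.
have vc j : (j < i)%N -> commute ((v, 0) : W) (xs j) /\ commute ((v, 0) : W) (ys j).
  move=> ji; have [m1 m2] := mem_frame_seq p r ji.
  by split; apply/commute_sform/eqP; rewrite sp // sform_single2 // gtn_eqF.
have [h [vh hc]] : exists h : W, ~ commute ((v, 0) : W) h /\
    forall j, (j < i)%N -> commute h (xs j) /\ commute h (ys j).
  apply: (comm_frame_partner p_pr exW cW fr) => //.
  have [w vw] : exists w : V, sform v w != 0.
    apply/existsP; apply: contraR vn0; rewrite negb_exists => /forallP H.
    by apply/eqP/sform_nondeg => w; apply/eqP; rewrite -[_ == _]negbK H.
  by exists ((w, 0) : W) => /commute_sform/eqP; apply/negP.
have fr' := comm_frame_rec p_pr exW cW fr vc vh hc.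
apply: (good_of_frame ir fr') => [t /frame_seqP[j ji [] ->]|].
- by left; exists j; rewrite ?(ltn_eqF ji) ?leqW.
- by right; exists j; rewrite ?(ltn_eqF ji) ?leqW.
- by left; exists i; rewrite ?eqxx.
Qed.

Lemma good_single_y i : (i < r)%N ->
  good (rcons (frame_seq p r i) (single r i (1, 0))) (single r i (0, 1)).
Proof.
move=> ir v _ sp.
have rg : (0 < r)%N by apply: ltnW.
have exW := heis_extraspecial p_pr rg; have cW := card_heis r p_pr.
have fr := heis_frame (ltnW ir).
have sp' t : t \in frame_seq p r i -> (sform v t == 0) = (sform (single r i (0, 1)) t == 0).
  by move=> ti; apply: sp; rewrite mem_rcons inE ti orbT.
have vc j : (j < i)%N -> commute ((v, 0) : W) (xs j) /\ commute ((v, 0) : W) (ys j).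
  move=> ji; have [m1 m2] := mem_frame_seq p r ji.
  by split; apply/commute_sform/eqP; rewrite sp' // sform_single2 // gtn_eqF.
have xc j : (j < i)%N -> commute (xs i) (xs j) /\ commute (xs i) (ys j).
  by move=> ji; split; apply/commute_sform; rewrite sform_single2 // gtn_eqF.
have xv : ~ commute (xs i) ((v, 0) : W).
  move/commute_sform/eqP; rewrite sform_opp oppr_eq0 sp ?mem_rcons ?mem_head //.
  by rewrite sform_single2 // eqxx mul0r sub0r mulr1 oppr_eq0 oner_eq0.
have fr' := comm_frame_rec p_pr exW cW fr xc xv vc.
apply: (good_of_frame ir fr') => [t|].
  rewrite mem_rcons inE => /predU1P[->|/frame_seqP[j ji [] ->]].
  - by left; exists i; rewrite ?eqxx.
  - by left; exists j; rewrite ?(ltn_eqF ji) ?leqW.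
  - by right; exists j; rewrite ?(ltn_eqF ji) ?leqW.
by right; exists i; rewrite ?eqxx.
Qed.

Lemma chain_frame n : (n <= r)%N -> chain good [::] (frame_seq p r n).
Proof.
move=> nr; apply: chain_flatten => i ir; rewrite cat0s; have ir' := leq_trans ir nr.
split; first exact: good_single_x.
by split; [exact: good_single_y|].
Qed.

(** Scaling the first half of each hyperbolic pair by [d] and the second half by [d'] multiplies
    the form by the common value of [d i * d' i]. *)
Lemma scaling_auto (d d' : 'I_r -> F) mu : mu != 0 -> (forall i, d i * d' i = mu) ->
  perp_auto (fun u => ([ffun i => (d i * (u.1 i).1, d' i * (u.1 i).2)], u.2)).
Proof.
move=> mu0 dd.
have d0 i : d i != 0 by apply: contraNneq mu0 => e; rewrite -(dd i) e mul0r.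
have d'0 i : d' i != 0 by apply: contraNneq mu0 => e; rewrite -(dd i) e mulr0.
split.
  apply: injF_bij => -[u c] [w c'] /= [] /ffunP E ->; congr pair; apply/ffunP => i.
  have := E i; rewrite !ffunE => Ei.
  have e1 := mulfI (d0 i) (congr1 fst Ei); have e2 := mulfI (d'0 i) (congr1 snd Ei).
  by case: (u i) (w i) e1 e2 => a b [a' b'] /= -> ->.
move=> u w /=; have -> : sform [ffun i => (d i * (u.1 i).1, d' i * (u.1 i).2)]
    [ffun i => (d i * (w.1 i).1, d' i * (w.1 i).2)] = mu * sform u.1 w.1.
  rewrite /sform mulr_sumr; apply: eq_bigr => i _; rewrite !ffunE /= -(dd i); ring.
by rewrite mulf_eq0 (negPf mu0).
Qed.
End Good.

Local Close Scope ring_scope.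

Local Open Scope ring_scope.

Section Order.
Variables (p r : nat).
Hypotheses (p_pr : prime p) (p_odd : odd p) (r_gt1 : (1 < r)%N).
Local Notation F := 'F_p.
Local Notation V := {ffun 'I_r -> F * F}.
Variable o : 'I_r.
Hypothesis o0 : (o : nat) = 0%N.
Local Notation good := (@good p r).

(** * The order of the elements *)

Definition scaling_seq n : seq V := [seq plane r i.+1 (1, 0) (1, 0) | i <- iota 0 n].

Lemma twin_refl (u : heis p r) : twin u u. Proof. by []. Qed.

(** The pattern leaves [v] = a e_0 + c e_(i+1) with a and c non-zero. Multiplying e_(i+1) by a / c
    and f_(i+1) by c / a is a symmetry. *)
Lemma good_scaling i : (i.+1 < r)%N ->
  good (frame_seq p r r ++ scaling_seq i) (plane r i.+1 (1, 0) (1, 0)).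
Proof.
move=> ir v _ sp; pose I := Ordinal ir.
have Io : I != o by rewrite -val_eqE /= o0.
have sub : {subset frame_seq p r r <= frame_seq p r r ++ scaling_seq i}.
  by move=> t tf; rewrite mem_cat tf.
have [eo1 eo2] := same_perp_frame o sub sp; have [ei1 ei2] := same_perp_frame I sub sp.
rewrite (plane_o o0) in eo1 eo2; rewrite (plane_i o0 _ _ Io) in ei1 ei2.
have {}eo1 : (v o).1 != 0 by rewrite eo1 oner_eq0.
have {}ei1 : (v I).1 != 0 by rewrite ei1 oner_eq0.
have {}eo2 : (v o).2 = 0 by apply/eqP; rewrite eo2 eqxx.
have {}ei2 : (v I).2 = 0 by apply/eqP; rewrite ei2 eqxx.
pose l := (v o).1 / (v I).1; have l0 : l != 0 by rewrite mulf_neq0 ?invr_eq0.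
pose d (j : 'I_r) := if j == I then l else 1.
pose d' (j : 'I_r) := if j == I then l^-1 else 1.
have dd j : d j * d' j = 1 by rewrite /d /d'; case: eqP => _; rewrite ?mulr1 ?divff.
have fauto := scaling_auto (oner_neq0 _) dd.
eexists; split; first exact: fauto.
  move=> t c; rewrite mem_cat => /orP[/frame_seqP[j jr [] ->]|].
  - have dj : d (Ordinal jr) != 0 by rewrite /d; case: (_ == I); rewrite ?oner_eq0.
    have -> : [ffun k => (d k * ((single r j (1, 0) : V) k).1, d' k * ((single r j (1, 0) : V) k).2)]
        = scale (d (Ordinal jr)) (single r j (1, 0)); last exact: twin_scale.
    apply/ffunP => k; rewrite !ffunE; case: eqP => [kj|_]; last by rewrite !mulr0.
    by rewrite !mulr0; congr (d _ * _, _); apply: val_inj.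
  - have dj : d' (Ordinal jr) != 0 by rewrite /d'; case: (_ == I); rewrite ?oner_eq0 ?invr_eq0.
    have -> : [ffun k => (d k * ((single r j (0, 1) : V) k).1, d' k * ((single r j (0, 1) : V) k).2)]
        = scale (d' (Ordinal jr)) (single r j (0, 1)); last exact: twin_scale.
    apply/ffunP => k; rewrite !ffunE; case: eqP => [kj|_]; last by rewrite !mulr0.
    by rewrite !mulr0; congr (_, d' _ * _); apply: val_inj.
  case/mapP => j; rewrite mem_iota => /= ji ->.
  have -> : [ffun k => (d k * ((plane r j.+1 (1, 0) (1, 0) : V) k).1,
               d' k * ((plane r j.+1 (1, 0) (1, 0) : V) k).2)]
        = plane r j.+1 (1, 0) (1, 0); last exact: twin_refl.
  apply/ffunP => k; rewrite !ffunE; case: (eqVneq k I) => [->|kI].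
    by rewrite /= eqSS gtn_eqF // !mulr0.
  rewrite /d /d' (negPf kI) !mul1r; case: eqP => //; case: eqP => //.
move=> c; have -> : [ffun k => (d k * (v k).1, d' k * (v k).2)]
    = scale (v o).1 (plane r i.+1 (1, 0) (1, 0)); last exact: twin_scale.
apply/ffunP => k; rewrite ffunE [RHS]ffunE.
case: (eqVneq k o) => [->|ko].
  by rewrite (plane_o o0) /d /d' eq_sym (negPf Io) eo2 !mul1r mulr0 mulr1.
case: (eqVneq k I) => [->|kI].
  by rewrite (plane_i o0 _ _ Io) /d /d' eqxx ei2 /l divfK // !mulr0 mulr1.
have z : (plane r i.+1 (1, 0) (1, 0) : V) k = 0 by apply: (plane_j o0).
by rewrite (same_perp_frame0 sub sp z) z /= !mulr0.
Qed.

(** The pattern leaves [v] = a e_0 + b f_0 with a and b non-zero. Multiplying all f_i by a / b is a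
    similitude, which preserves orthogonality. *)
Lemma good_unit n : good (frame_seq p r r ++ scaling_seq n) (single r 0 (1, 1)).
Proof.
move=> v _ sp.
have sub : {subset frame_seq p r r <= frame_seq p r r ++ scaling_seq n}.
  by move=> t tf; rewrite mem_cat tf.
have mo : (single r 0 (1, 1) : V) o = (1, 1) by rewrite ffunE o0.
have [eo1 eo2] := same_perp_frame o sub sp; rewrite mo in eo1 eo2.
have {}eo1 : (v o).1 != 0 by rewrite eo1 oner_eq0.
have {}eo2 : (v o).2 != 0 by rewrite eo2 oner_eq0.
pose l := (v o).1 / (v o).2; have l0 : l != 0 by rewrite mulf_neq0 ?invr_eq0.
have fauto := @scaling_auto p r (fun=> 1) (fun=> l) l l0 (fun=> mul1r l).
eexists; split; first exact: fauto.
  move=> t c; rewrite mem_cat => /orP[/frame_seqP[j jr [] ->]|].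
  - have -> : [ffun k => (1 * ((single r j (1, 0) : V) k).1, l * ((single r j (1, 0) : V) k).2)]
        = single r j (1, 0); last exact: twin_refl.
    by apply/ffunP => k; rewrite !ffunE mul1r; case: eqP => _; rewrite mulr0.
  - have -> : [ffun k => (1 * ((single r j (0, 1) : V) k).1, l * ((single r j (0, 1) : V) k).2)]
        = scale l (single r j (0, 1)); last exact: twin_scale.
    by apply/ffunP => k; rewrite !ffunE mul1r; case: eqP => _; rewrite !mulr0.
  case/mapP => j _ ->.
  have -> : [ffun k => (1 * ((plane r j.+1 (1, 0) (1, 0) : V) k).1,
               l * ((plane r j.+1 (1, 0) (1, 0) : V) k).2)]
        = plane r j.+1 (1, 0) (1, 0); last exact: twin_refl.
  by apply/ffunP => k; rewrite !ffunE mul1r; case: eqP => _; [|case: eqP => _]; rewrite mulr0.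
move=> c; have -> : [ffun k => (1 * (v k).1, l * (v k).2)]
    = scale (v o).1 (single r 0 (1, 1)); last exact: twin_scale.
apply/ffunP => k; rewrite ffunE [RHS]ffunE mul1r.
case: (eqVneq k o) => [->|ko]; first by rewrite mo /l divfK // mulr1.
have z : (single r 0 (1, 1) : V) k = 0.
  by rewrite ffunE -o0 (negPf (ko : (k : nat) != o)).
by rewrite (same_perp_frame0 sub sp z) z /= !mulr0.
Qed.

Definition block_seq (i : nat) : seq V :=
  [:: plane r i (0, 1) (0, -1); plane r i (1, 1) (1, -1);
      plane r i (0, 0) (1, -1); plane r i (1, 0) (0, 1)] ++
  flatten [seq [:: plane r i (k%:R, 1) (1, -1); plane r i (k.+1%:R, 1) (1, 0);
                   plane r i (0, 1) (0, - k.+1%:R)] | k <- iota 0 p].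

Lemma chain_block (pre : seq V) (i : 'I_r) : i != o -> {subset frame_seq p r r <= pre} ->
  plane r i (1, 0) (1, 0) \in pre -> single r 0 (1, 1) \in pre ->
  chain (@pinned p r) pre (block_seq i).
Proof.
move=> io sub e1 e2.
have {}e2 : plane r i (1, 1) (0, 0) \in pre by rewrite -(single_plane _ io).
have grow (x : V) q : {subset frame_seq p r r <= q} -> {subset frame_seq p r r <= rcons q x}.
  by move=> sq t /sq tq; rewrite mem_rcons inE tq orbT.
have sub1 := grow (plane r i (0, 1) (0, -1)) _ sub.
have sub2 := grow (plane r i (1, 1) (1, -1)) _ sub1.
have sub3 := grow (plane r i (0, 0) (1, -1)) _ sub2.
apply: chain_cat.
  split; first exact: (step_g1 o0).
  split.
    by apply: (step_w o0) => //; rewrite mem_rcons inE ?e1 ?e2 ?eqxx ?orbT.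
  split; first by apply: (step_cd o0) => //; rewrite mem_rcons mem_head.
  split=> //; apply: (step_ad o0) => //.
  by rewrite mem_rcons inE mem_rcons mem_head orbT.
apply: chain_flatten => k kp.
set q := _ ++ flatten _.
have preq : {subset pre <= q} by move=> t tp; rewrite /q !mem_cat tp.
have subq : {subset frame_seq p r r <= q} by move=> t /sub/preq.
have qcd : plane r i (0, 0) (1, -1) \in q by rewrite /q !(mem_cat, inE) eqxx !orbT.
have qad : plane r i (1, 0) (0, 1) \in q by rewrite /q !(mem_cat, inE) eqxx !orbT.
have qg : plane r i (0, 1) (0, - k%:R) \in q.
  (* The loop starts from (0, 1, 0, 0) = f_0, which belongs to the frame. *)
  case: k {kp} @q preq subq qcd qad => [|k] q preq subq qcd qad.
    rewrite oppr0 -(single_plane _ io) //; apply: preq; apply: sub.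
    by have [] := mem_frame_seq p r (ltnW r_gt1).
  rewrite /q mem_cat; apply/orP; right; apply/flatten_mapP; exists k.
    by rewrite mem_iota /=.
  by rewrite !inE eqxx !orbT.
split; first by apply: (step_v o0) => //; apply: preq.
split.
  rewrite -natr1; apply: (step_t o0) => //; first exact: grow.
    by rewrite mem_rcons mem_head.
  by rewrite mem_rcons inE qad orbT.
split=> //; apply: (step_g o0) => //; first exact: (grow _ _ (grow _ _ subq)).
by rewrite mem_rcons mem_head.
Qed.

(** Ratios range over 1, ..., p, where p stands for 0. *)
Lemma Fp_succ (l : F) : exists2 k, (k < p)%N & l = k.+1%:R.
Proof.
have lp (a : F) : (a < p)%N by rewrite -[X in (_ < X)%N](Fp_cast p_pr).
case: (posnP l) => [l0|l0].
  exists p.-1; first by rewrite prednK // prime_gt0.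
  rewrite prednK ?prime_gt0 // (pcharf0 (pchar_Fp p_pr)).
  by apply: val_inj.
exists l.-1; first by apply: leq_ltn_trans (lp l); apply: leq_pred.
by rewrite prednK // natr_Zp.
Qed.

(** The same order as in [element_list], in terms of vectors over the field. *)
Definition vector_seq (full rest : seq V) : seq V :=
  frame_seq p r r ++ (rcons (scaling_seq r.-1) (single r 0 (1, 1)) ++
  (flatten [seq block_seq i.+1 | i <- iota 0 r.-1] ++
  ([seq single r 0 (k.+1%:R, 1) | k <- iota 0 p.-1] ++ (full ++ rest)))).

Lemma chain_vector_seq full rest : (forall t, (t \in full) = full_vector o t) ->
  chain good [::] (vector_seq full rest).
Proof.
move=> fullP; apply: chain_cat; first exact: chain_frame.
rewrite cat0s; apply: chain_cat.
  rewrite -cats1; apply: chain_cat; last by split=> //; exact: good_unit.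
  have scal n : (n <= r.-1)%N -> chain good (frame_seq p r r) (scaling_seq n); last exact: scal.
  elim: n => // n IH nr.
  rewrite /scaling_seq -[in iota _ _]addn1 iotaD map_cat.
  apply: chain_cat; first by apply: IH; apply: ltnW.
  split=> //; apply: good_scaling.
  by move: nr; case: (r) => // r' /=; rewrite ltnS.
set pre := _ ++ rcons _ _.
have sub : {subset frame_seq p r r <= pre} by move=> t tf; rewrite /pre mem_cat tf.
have preu : single r 0 (1, 1) \in pre by rewrite /pre mem_cat mem_rcons mem_head orbT.
apply: (@chain_impl _ (@pinned p r)) => [q m|]; first exact: good_pinned.
have idx i : (i < r.-1)%N -> exists I : 'I_r, (I : nat) = i.+1 /\ I != o.
  move=> ir; have iR : (i.+1 < r)%N by move: ir; case: (r).
  by exists (Ordinal iR); split=> //; rewrite -val_eqE /= o0.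
apply: chain_cat.
  apply: chain_flatten => i ir; have [I [Ii Io]] := idx i ir; rewrite -Ii.
  apply: chain_block => //.
  - by move=> t /sub tp; rewrite mem_cat tp.
  - rewrite mem_cat /pre mem_cat mem_rcons inE.
    by apply/orP; left; apply/orP; right; apply/orP; right; apply/mapP;
      exists i; rewrite ?mem_iota // Ii.
  - by rewrite mem_cat preu.
set pre2 := pre ++ _.
have sub2 : {subset frame_seq p r r <= pre2} by move=> t /sub tf; rewrite /pre2 mem_cat tf.
have inblock (I : 'I_r) t : I != o -> t \in block_seq I -> t \in pre2.
  move=> Io tb; rewrite /pre2 mem_cat; apply/orP; right; apply/flatten_mapP.
  have I0 : (0 < I)%N by rewrite lt0n -o0.
  exists I.-1; last by rewrite prednK.
  rewrite mem_iota /=; have := ltn_ord I; move: I0; case: (I : nat) => // n _.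
  by case: (r).
have t2 (I : 'I_r) l : I != o -> plane r I (l, 1) (1, 0) \in pre2.
  move=> Io; have [k kp ->] := Fp_succ l; apply: (inblock I) => //.
  rewrite mem_cat; apply/orP; right; apply/flatten_mapP; exists k; rewrite ?mem_iota //.
  by rewrite !inE eqxx !orbT.
have g2 (I : 'I_r) l : I != o -> plane r I (0, 1) (0, - l) \in pre2.
  move=> Io; have [k kp ->] := Fp_succ l; apply: (inblock I) => //.
  rewrite mem_cat; apply/orP; right; apply/flatten_mapP; exists k; rewrite ?mem_iota //.
  by rewrite !inE eqxx !orbT.
have mono q q' m : {subset q <= q'} -> @pinned p r q m -> pinned q' m.
  exact: pinned_sub.
apply: chain_cat.
  apply: (chain_all mono) => _ /mapP[k _ ->].
  have [|I [_ Io]] := idx 0%N; first by move: r_gt1; case: (r) => // -[].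
  by rewrite (single_plane _ Io); apply: (step_ab o0) => //; apply: t2.
set pre3 := pre2 ++ _.
have sub3 : {subset pre2 <= pre3} by move=> t tf; rewrite /pre3 mem_cat tf.
apply: chain_cat.
  apply: (chain_all mono) => m; rewrite fullP => /andP[m1 m2].
  apply: (pinned_full_head o0) => //.
  - by move=> t /sub2/sub3.
  - move=> l l0; rewrite /pre3 mem_cat; apply/orP; right.
    have [k kp lk] := Fp_succ l; apply/mapP; exists k; last by rewrite lk.
    rewrite mem_iota /=; move: l0; rewrite lk.
    have [->|kn] := eqVneq k p.-1.
      by rewrite prednK ?prime_gt0 // (pcharf0 (pchar_Fp p_pr)) eqxx.
    by move: kp kn; case: (p) => //= n; rewrite ltnS leq_eqVlt => /orP[->|].
  - by move=> I l Io; apply: sub3; apply: t2.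
  - by move=> I l Io; apply: sub3; apply: g2.
apply: (chain_all mono) => m _; apply: (pinned_any p_pr p_odd o0) => //.
  by move=> t /sub2/sub3 t3; rewrite mem_cat t3.
by move=> t tf; rewrite mem_cat fullP tf orbT.
Qed.
End Order.

Local Close Scope ring_scope.

(** * Correctness of the tables *)

Lemma smallest_factor_primeX p m : prime p -> 0 < m -> smallest_factor (p ^ m) = p.
Proof.
move=> pp m0; have p1 := prime_gt1 pp.
rewrite /smallest_factor; set P := fun k => _; set n := p ^ m.
have p2 : p.-2.+2 = p by lia.
have pn : p <= n by rewrite -[X in X <= _]expn1 leq_exp2l.
have hasP : has P (iota 0 n).
  apply/hasP; exists p.-2; first by rewrite mem_iota; lia.
  by rewrite /P p2 -/(p %| n) dvdn_exp.
have lt : find P (iota 0 n) < n by rewrite -[X in _ < X](size_iota 0 n) -has_find.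
have := nth_find 0 hasP; rewrite nth_iota // add0n {1}/P => dv.
have le : find P (iota 0 n) <= p.-2.
  rewrite leqNgt; apply/negP => lt'.
  have := before_find 0 lt'; rewrite nth_iota ?add0n; last by lia.
  by rewrite /P p2 -/(p %| n) dvdn_exp.
apply/eqP; rewrite eqn_leq; apply/andP; split; first by lia.
have [q qp qd] := pdivP (isT : 1 < (find P (iota 0 n)).+2).
have : q %| n by apply: dvdn_trans qd dv.
rewrite Euclid_dvdX // dvdn_prime2 // => /andP[/eqP qE _].
by rewrite -{1}qE; apply: dvdn_leq qd.
Qed.

Lemma mem_extend p (L : seq vec) v : (v \in extend p L) =
  if v is ab :: w then [&& ab.1 < p, ab.2 < p & w \in L] else false.
Proof.
apply/flatten_mapP/idP => [[i]|].
  rewrite mem_iota => /= ip /flatten_mapP[j]; rewrite mem_iota => /= jp /mapP[w wL ->] /=.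
  by rewrite ip jp.
case: v => // -[a b] w /= /and3P[ap bp wL]; exists a; first by rewrite mem_iota.
by apply/flatten_mapP; exists b; [rewrite mem_iota | apply/mapP; exists w].
Qed.

Definition bounded_vec p (v : vec) := all (fun ab => (ab.1 < p) && (ab.2 < p)) v.

Lemma iter_extend p j : size (iter j (extend p) [:: [::]]) = p ^ (2 * j) /\
  forall v, (v \in iter j (extend p) [:: [::]]) = (size v == j) && bounded_vec p v.
Proof.
elim: j => [|j [IHs IHm]]; first by split=> // -[|? ?].
split; first by rewrite iterS size_extend IHs mulnS !expnS mulnA.
move=> v; rewrite iterS mem_extend; case: v => //= -[a b] w /=.
by rewrite IHm eqSS !andbA; case: (size w == j); rewrite ?andbT ?andbF.
Qed.

Lemma all_vectorsE p r : 1 < p ->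
  all_vectors p (p ^ (2 * r + 1)) = iter r (extend p) [:: [::]].
Proof.
move=> p1; rewrite /all_vectors; set step := fun L => _.
have S1 i : i <= r -> iter i step [:: [::]] = iter i (extend p) [:: [::]].
  elim: i => // i IH ir; rewrite !iterS IH ?(ltnW ir) // /step.
  have [-> _] := iter_extend p i; rewrite -expnSr leqNgt ltn_exp2l //.
  by have -> : (2 * i).+1 < 2 * r + 1 by lia.
have S2 i : iter (i + r) step [:: [::]] = iter r (extend p) [:: [::]].
  elim: i => [|i IH]; first exact: S1.
  rewrite addSn iterS IH /step; have [-> _] := iter_extend p r.
  by rewrite -expnSr addn1 leqnn.
have le : r <= p ^ (2 * r + 1).
  by apply: leq_trans (ltnW (ltn_expl _ p1)); lia.
by rewrite -(subnK le) S2.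
Qed.

Lemma mem_dedup (T : eqType) (l : seq T) : dedup l =i l.
Proof.
elim/last_ind: l => // l a IH x; rewrite /dedup foldl_rcons -/(dedup l) mem_rcons inE -IH.
case: ifP => [al|_]; last by rewrite mem_rcons inE.
by case: eqP => // ->.
Qed.

Lemma dedup_uniq (T : eqType) (l : seq T) : uniq (dedup l).
Proof.
elim/last_ind: l => // l a IH; rewrite /dedup foldl_rcons -/(dedup l).
by case: ifP => // an; rewrite rcons_uniq an.
Qed.

Lemma dedup_split (T : eqType) (l : seq T) s1 m s2 : dedup l = s1 ++ m :: s2 ->
  exists l1 l2, l = l1 ++ m :: l2 /\ l1 =i s1.
Proof.
elim/last_ind: l s2 => [|l a IH] s2; first by case: s1.
rewrite /dedup foldl_rcons -/(dedup l); case: ifP => [_|an].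
  move/IH => [l1 [l2 [-> E]]]; exists l1, (rcons l2 a); split=> //.
  by rewrite rcons_cat.
case/lastP: s2 => [|s2 b].
  rewrite cats1 => /rcons_inj[E ->]; exists l, [::]; split; first by rewrite cats1.
  by move=> x; rewrite -E mem_dedup.
rewrite -rcons_cons -rcons_cat => /rcons_inj[/IH[l1 [l2 [-> E]]] _].
by exists l1, (rcons l2 a); split=> //; rewrite rcons_cat.
Qed.

Section Codes.
Variables (p r : nat).
Hypotheses (p_pr : prime p) (p_odd : odd p) (r_gt1 : 1 < r).
Local Notation F := 'F_p.
Local Notation V := {ffun 'I_r -> F * F}.
Local Notation W := (heis p r).

Definition vec_value (v : vec) : V :=
  [ffun i : 'I_r => ((nth (0, 0) v i).1%:R, (nth (0, 0) v i).2%:R)%R].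

Definition code_value (x : vec * nat) : W := (vec_value x.1, x.2%:R%R).

Definition is_code (x : vec * nat) := [&& size x.1 == r, bounded_vec p x.1 & x.2 < p].

Lemma natF_inj a b : a < p -> b < p -> (a%:R = b%:R :> F)%R -> a = b.
Proof.
move=> ap bp /(congr1 (@nat_of_ord _)); rewrite !(val_Fp_nat p_pr).
by rewrite !modn_small.
Qed.

Lemma ltFp (a : F) : a < p.
Proof. by rewrite -[X in _ < X](Fp_cast p_pr). Qed.

Lemma natF_mod a : (a %% p)%:R%R = a%:R%R :> F.
Proof. by apply: val_inj; rewrite [LHS](val_Fp_nat p_pr) [RHS](val_Fp_nat p_pr) modn_mod. Qed.

Lemma code_value_inj : {in is_code &, injective code_value}.
Proof.
move=> [v a] [w b] /and3P[/= /eqP sv bv ap] /and3P[/= /eqP sw bw bp] [/ffunP E e].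
congr pair; last exact: natF_inj e.
apply: (@eq_from_nth _ (0, 0)) => [|i]; first by rewrite sv sw.
rewrite sv => ir; have := E (Ordinal ir); rewrite !ffunE /=.
have /andP[v1 v2] := allP bv _ (mem_nth (0, 0) (ltac:(by rewrite sv) : i < size v)).
have /andP[w1 w2] := allP bw _ (mem_nth (0, 0) (ltac:(by rewrite sw) : i < size w)).
move=> [/(natF_inj v1 w1) e1 /(natF_inj v2 w2) e2].
by move: e1 e2; case: nth => a1 a2; case: nth => b1 b2 /= -> ->.
Qed.

Lemma code_value_surj w : exists2 x, is_code x & code_value x = w.
Proof.
exists ([seq (nat_of_ord (w.1 i).1, nat_of_ord (w.1 i).2) | i <- enum 'I_r], nat_of_ord w.2).
  apply/and3P; split; [by rewrite size_map size_enum_ord | | exact: ltFp].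
  by apply/allP => _ /mapP[i _ ->]; rewrite !ltFp.
case: w => v c; congr pair; last by rewrite natr_Zp.
apply/ffunP => i; rewrite ffunE (nth_map i) ?size_enum_ord //.
by rewrite nth_ord_enum !natr_Zp; case: (v i).
Qed.

Lemma is_code_mul x y : is_code x -> is_code (mul_code p x y).
Proof.
move=> /and3P[/eqP sx _ _]; have p0 := prime_gt0 p_pr.
apply/and3P; split=> /=; rewrite ?size_map ?size_iota ?sx ?ltn_mod //.
by apply/allP => _ /mapP[i _ ->]; rewrite /= !ltn_mod p0.
Qed.

Lemma code_valueM x y : is_code x ->
  code_value (mul_code p x y) = (code_value x * code_value y)%g.
Proof.
move=> /and3P[/eqP sx _ _]; congr pair.
  apply/ffunP => i; rewrite !ffunE /= sx (nth_map 0) ?size_iota //.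
  by rewrite nth_iota // !natF_mod !natrD.
rewrite /= natF_mod !natrD; congr (_ + _)%R.
have -> : iota 0 (size x.1) = index_iota 0 r by rewrite /index_iota subn0 sx.
rewrite sumnE big_map natr_sum big_mkord.
by apply: eq_bigr => i _; rewrite natrM !ffunE.
Qed.

Lemma vec_value_axis i ab :
  vec_value (axis_vector r i ab) = single r i (ab.1%:R, ab.2%:R)%R.
Proof.
apply/ffunP => j; rewrite !ffunE (nth_map 0) ?size_iota // nth_iota //= add0n.
by case: eqP.
Qed.

Lemma vec_value_plane i ab cd :
  vec_value (plane_vector r i ab cd)
  = plane r i (ab.1%:R, ab.2%:R)%R (cd.1%:R, cd.2%:R)%R.
Proof.
apply/ffunP => j; rewrite !ffunE (nth_map 0) ?size_iota // nth_iota //= add0n.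
by case: eqP => // _; case: eqP.
Qed.

Lemma natF_pred : ((p - 1)%:R = -1 :> F)%R.
Proof. by rewrite natrB ?prime_gt0 // (pcharf0 (pchar_Fp p_pr)) sub0r. Qed.

Let L := all_vectors p (p ^ (2 * r + 1)).

Lemma mem_vectors v : (v \in L) = (size v == r) && bounded_vec p v.
Proof. by rewrite /L all_vectorsE ?prime_gt1 //; case: (iter_extend p r). Qed.

Lemma size_head_vectors : size (head [::] L) = r.
Proof.
have : nseq r (0, 0) \in L.
  rewrite mem_vectors size_nseq eqxx; apply/allP => ab /nseqP[-> _] /=.
  by rewrite prime_gt0.
case E : L => [|v l] // _.
by have := mem_vectors v; rewrite E mem_head => /esym/andP[/eqP].
Qed.

Lemma axis_vector_code i ab : ab.1 < p -> ab.2 < p ->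
  (size (axis_vector r i ab) == r) && bounded_vec p (axis_vector r i ab).
Proof.
move=> a b; rewrite size_map size_iota eqxx; apply/allP => _ /mapP[j _ ->].
by case: ifP; rewrite ?a ?b //= prime_gt0.
Qed.

Lemma plane_vector_code i ab cd : ab.1 < p -> ab.2 < p -> cd.1 < p -> cd.2 < p ->
  (size (plane_vector r i ab cd) == r) && bounded_vec p (plane_vector r i ab cd).
Proof.
move=> a b c d; rewrite size_map size_iota eqxx; apply/allP => _ /mapP[j _ ->].
by case: ifP; [|case: ifP]; rewrite ?a ?b ?c ?d //= prime_gt0.
Qed.

Lemma head_vectors_code v : v \in head_vectors p r -> (size v == r) && bounded_vec p v.
Proof.
have p1 := prime_gt1 p_pr; have p0 := prime_gt0 p_pr.
have pp : p - 1 < p by rewrite ltn_subrL p0.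
rewrite !mem_cat mem_rcons inE -!orbA => /or4P[|/eqP ->||/orP[]].
- case/flatten_mapP => i _; rewrite !inE => /orP[]/eqP ->; exact: axis_vector_code.
- exact: axis_vector_code.
- by case/mapP => i _ ->; apply: plane_vector_code.
- case/flatten_mapP => i _; rewrite mem_cat !inE -!orbA.
  case/or4P => [/eqP ->|/eqP ->|/eqP ->|/orP[/eqP ->|]];
    do ?[exact: plane_vector_code].
  case/flatten_mapP => k; rewrite mem_iota /= => kp.
  rewrite !inE => /or3P[]/eqP ->; apply: plane_vector_code => //=; by rewrite ltn_mod.
- case/mapP => k; rewrite mem_iota => /= kp ->; apply: axis_vector_code => //=.
  by rewrite -ltn_predRL.
Qed.

Let E := element_list p L.

Lemma mem_elements x : (x \in E) = is_code x.
Proof.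
rewrite /E /element_list mem_dedup mem_cat size_head_vectors; apply/orP/idP => [[]|].
- case/mapP => v; rewrite mem_cat mem_filter => /orP[/head_vectors_code|/andP[_]].
    by move=> /andP[s b] ->; rewrite /is_code s b prime_gt0.
  by rewrite mem_vectors => /andP[s b] ->; rewrite /is_code s b prime_gt0.
- case/flatten_mapP => v; rewrite mem_vectors => /andP[s b] /mapP[c].
  by rewrite mem_iota /= => cp ->; rewrite /is_code s b.
case: x => v c /and3P[/= s b cp]; right; apply/flatten_mapP; exists v.
  by rewrite mem_vectors s b.
by apply/mapP; exists c; rewrite ?mem_iota.
Qed.

Definition elements : seq W := [seq code_value x | x <- E].

Lemma elements_uniq : uniq elements.
Proof.
rewrite map_inj_in_uniq; first exact: dedup_uniq.
by move=> x y; rewrite !mem_elements; apply: code_value_inj.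
Qed.

Lemma mem_all_elements w : w \in elements.
Proof.
by have [x xc <-] := code_value_surj w; apply: map_f; rewrite mem_elements.
Qed.

Lemma perm_elements : perm_eq elements (enum W).
Proof.
apply: uniq_perm (elements_uniq) (enum_uniq _) _ => w.
by rewrite mem_all_elements mem_enum.
Qed.

Lemma size_elements : size elements = p ^ (2 * r + 1).
Proof. by rewrite (perm_size perm_elements) -cardE card_heis. Qed.

Lemma index_elements x : is_code x -> index (code_value x) elements = index x E.
Proof.
move=> xc; rewrite /elements.
have : {in E, forall y, code_value y = code_value x -> y = x}.
  by move=> y; rewrite mem_elements => yc /code_value_inj; apply.
elim: E => //= y s IH inj; rewrite IH; last by move=> z zs; apply: inj; rewrite inE zs orbT.
case: (eqVneq y x) => [->|ne]; first by rewrite eqxx.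
by case: eqP => // /(inj y (mem_head _ _))/eqP; rewrite (negPf ne).
Qed.

Lemma code_tableE : code_table p E = mul_table elements.
Proof.
rewrite /code_table /mul_table /elements -map_comp; apply/eq_in_map => x.
rewrite mem_elements => xc /=; rewrite -map_comp; apply/eq_in_map => y _ /=.
by rewrite -code_valueM // index_elements // is_code_mul.
Qed.

Lemma commuting_matrixE : commuting_matrix p E =
  [seq [seq commuting_graph x y | y <- elements] | x <- elements].
Proof.
rewrite /commuting_matrix /elements -map_comp; apply/eq_in_map => x.
rewrite mem_elements => xc /=; rewrite -map_comp; apply/eq_in_map => y /=.
rewrite mem_elements => yc; rewrite /commuting_graph /= -!code_valueM //.
by rewrite !(inj_in_eq code_value_inj) ?[_ \in _]is_code_mul //.
Qed.
Variable o : 'I_r.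
Hypothesis o0 : (o : nat) = 0.

Lemma full_headE v : size v = r -> bounded_vec p v -> full_head v = full_vector o (vec_value v).
Proof.
move=> sv bv; rewrite /full_head /full_vector ffunE o0 -nth0 /=.
have /andP[v1 v2] := allP bv _ (mem_nth (0, 0) (ltac:(by rewrite sv ltnW) : 0 < size v)).
have nz a : a < p -> (a%:R == 0 :> F)%R = (a == 0).
  move=> ap; apply/eqP/eqP => [a0|->] //.
  by apply: natF_inj; rewrite ?prime_gt0.
by rewrite !nz.
Qed.

Lemma vector_seqE : exists full rest, (forall t, (t \in full) = full_vector o t) /\
  [seq (code_value x).1 | x <- [seq (v, 0) | v <- head_vectors p (size (head [::] L)) ++ filter full_head L]
         ++ flatten [seq [seq (v, c) | c <- iota 0 p] | v <- L]] = vector_seq full rest.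
Proof.
exists [seq vec_value v | v <- L & full_head v].
exists [seq (code_value x).1 | x <- flatten [seq [seq (v, c) | c <- iota 0 p] | v <- L]].
split=> [t|].
  apply/mapP/idP => [[v]|tf].
    rewrite mem_filter mem_vectors => /andP[vf /andP[/eqP sv bv]] ->.
    by rewrite -full_headE.
  have [[v c] /and3P[/= /eqP sv bv _] [vE _]] := code_value_surj (t, 0%R).
  by exists v => //; rewrite mem_filter mem_vectors sv bv eqxx !andbT full_headE // vE.
rewrite map_cat -map_comp size_head_vectors !map_cat -!catA.
congr (_ ++ _).
  rewrite map_flatten -map_comp; congr flatten; apply: eq_map => i /=.
  by rewrite !vec_value_axis.
congr (_ ++ _).
  rewrite map_rcons -map_comp; congr rcons; last by rewrite /= vec_value_axis.
  by apply: eq_map => i /=; rewrite vec_value_plane.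
congr (_ ++ _).
  rewrite map_flatten -map_comp; congr flatten; apply: eq_map => i /=.
  rewrite !vec_value_plane /= natF_pred; congr [:: _, _, _, _ & _].
  rewrite map_flatten -map_comp; congr flatten; apply: eq_map => k /=.
  by rewrite !vec_value_plane /= !natF_mod natrM natF_pred mulN1r.
congr (_ ++ _).
by rewrite -map_comp; apply: eq_map => k /=; rewrite vec_value_axis.
Qed.

(** Any element of the list is a choice that cannot be wrong. Dropping repeated entries is harmless as
    [good] only depends on the set of the earlier elements. *)
Lemma elements_split s1 w s2 : elements = s1 ++ w :: s2 ->
  @good p r [seq x.1 | x <- s1] w.1.
Proof.
rewrite /elements /E => /esym Es.
have [s1' [s2' [m [E' [E1 Em]]]]] : exists s1' s2' m,
    [/\ element_list p L = s1' ++ m :: s2', map code_value s1' = s1 & code_value m = w].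
  have := congr1 (take (size s1)) Es; have := congr1 (drop (size s1)) Es.
  rewrite take_size_cat // drop_size_cat // -map_drop -map_take.
  case D: (drop _ _) => [|m s2'] //= [-> _] ->.
  by exists (take (size s1) (element_list p L)), s2', m; rewrite -D cat_take_drop.
have [l1 [l2 [lE l1s]]] := dedup_split E'.
have [full [rest [fullP vE]]] := vector_seqE.
have := chain_vector_seq p_pr p_odd r_gt1 o0 rest fullP; rewrite -vE lE map_cat /=.
move/chain_split; rewrite cat0s -[vec_value m.1]/((code_value m).1) Em => gd v v0 sp.
have [t /mapP[x xl ->]|f [fa fp fm]] := gd v v0.
  by apply: sp; rewrite -E1 -map_comp; apply: (map_f (fun x => (code_value x).1)); rewrite -l1s.
exists f; split=> // t c; rewrite -E1 -map_comp => /mapP[x xs ->]; apply: fp.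
by apply: (map_f (fun x => (code_value x).1)); rewrite l1s.
Qed.
End Codes.

(** * Correctness of the greedy matching *)

Section Matrix.
Variables (T : eqType) (e : rel T) (l : seq T) (x0 : T).
Let M := [seq [seq e u v | v <- l] | u <- l].

Lemma adjE i j : i < size l -> j < size l -> adj M i j = e (nth x0 l i) (nth x0 l j).
Proof. by move=> il jl; rewrite /adj (nth_map x0) // (nth_map x0). Qed.

Lemma universalE i : uniq l -> i < size l ->
  universal M i = all (fun t => e (nth x0 l i) t || (t == nth x0 l i)) l.
Proof.
move=> ul il; rewrite /universal size_map.
apply/allP/allP => H t.
  move=> /(nthP x0)[j jl <-]; have := H j; rewrite mem_iota jl adjE // nth_uniq //.
  exact.
rewrite mem_iota => /= tl; have := H _ (mem_nth x0 tl).
by rewrite adjE // nth_uniq.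
Qed.
End Matrix.

Section Greedy.
Variables M M0 : seq (seq bool).
Let n := size M.
Let run i := iter i (greedy_step M M0) [::].

Lemma size_run i : size (run i) = i.
Proof. by elim: i => // i IH; rewrite /run iterS size_rcons -/(run i) IH. Qed.

Lemma take_run i j : i <= j -> take i (run j) = run i.
Proof.
elim: j => [|j IH]; first by rewrite leqn0 => /eqP ->.
rewrite leq_eqVlt => /predU1P[->|ij]; first by rewrite take_oversize // size_run.
by rewrite /run iterS -/(run j) /greedy_step -cats1 takel_cat ?size_run ?IH.
Qed.

Lemma run_fits j i : all (fun x => x < n) (run j) -> i < j ->
  nth 0 (run j) i < n /\ fits M M0 (run i) (nth 0 (run j) i).
Proof.
move=> lt ij; have sj := size_run j.
have ltn : nth 0 (run j) i < n by apply: (allP lt); rewrite mem_nth ?sj.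
split=> //; have E : nth 0 (run j) i = find (fits M M0 (run i)) (iota 0 n).
  rewrite -(nth_take 0 (ltnSn i)) take_run // /run iterS -/(run i) /greedy_step nth_rcons.
  by rewrite size_run ltnn eqxx.
have hs : has (fits M M0 (run i)) (iota 0 n) by rewrite has_find size_iota -E.
by have := nth_find 0 hs; rewrite -E nth_iota.
Qed.

Lemma run_uniq j : all (fun x => x < n) (run j) -> uniq (run j).
Proof.
elim: j => // j IH lt.
have [ltn] := run_fits lt (ltnSn j).
move: lt; rewrite /run iterS -/(run j) /greedy_step all_rcons rcons_uniq.
rewrite nth_rcons size_run ltnn eqxx => /andP[_ lt] /andP[/andP[-> _] _] /=.
exact: IH.
Qed.
End Greedy.

(** Exchanging two vertices with the same neighbours is an automorphism, so a bijection that hits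
    the right classes of twins can be corrected to hit prescribed elements. *)
Lemma exact_of_twins (T U : finType) (cm : rel U) (S : eqType) (h : T -> U) (x : S -> T)
    (m : S -> U) (idx : seq S) :
  bijective h -> uniq idx -> {in idx &, injective x} -> {in idx &, injective m} ->
  {in idx, forall i, cm (h (x i)) =1 cm (m i)} ->
  exists h', [/\ bijective h', forall u, cm (h' u) =1 cm (h u)
    & {in idx, forall i, h' (x i) = m i}].
Proof.
move=> bh; elim: idx => [|i idx IH] /=; first by exists h.
case/andP=> nin ui xinj minj tw.
have sub a : a \in idx -> a \in i :: idx by rewrite inE => ->; rewrite orbT.
have [h' [bh' ch' h'x]] : exists h', [/\ bijective h', forall u, cm (h' u) =1 cm (h u)
    & {in idx, forall i, h' (x i) = m i}].
  apply: IH => //; first by move=> a b /sub aI /sub bI; apply: xinj.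
    by move=> a b /sub aI /sub bI; apply: minj.
  by move=> a /sub; apply: tw.
have same : cm (h' (x i)) =1 cm (m i).
  by move=> u; rewrite ch' tw ?mem_head.
exists (tperm (h' (x i)) (m i) \o h'); split.
- by apply: bij_comp => //; exists (tperm (h' (x i)) (m i)); apply: tpermK.
- by move=> u t /=; rewrite -ch'; case: tpermP => [->|->|].
move=> j; rewrite inE => /predU1P[->|jI] /=; first by rewrite tpermL.
have ji : j != i by apply: contraNneq nin => <-.
rewrite (h'x j jI) tpermD //.
  rewrite -(h'x j) // (inj_eq (bij_inj bh')); apply: contra_neq ji => e.
  by apply/esym/xinj; rewrite ?mem_head ?sub.
by apply: contra_neq ji => e; apply/esym/minj; rewrite ?mem_head ?sub.
Qed.

Section Correctness.
Variables (p r : nat).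
Hypotheses (p_pr : prime p) (p_odd : odd p) (r_gt1 : 1 < r).
Variables (V : finType) (e : rel V).
Hypotheses (e_sym : symmetric e) (e_irr : irreflexive e).
Hypothesis cardV : #|V| = p ^ (2 * r + 1).
Local Notation W := (heis p r).
Local Notation cg := (@commuting_graph W).

Let M := [seq [seq e u v | v <- enum V] | u <- enum V].
Let s := elements p r.
Let M0 := [seq [seq cg x y | y <- s] | x <- s].
Let n := p ^ (2 * r + 1).
Let run i := iter i (greedy_step M M0) [::].

Lemma V_inhabited : V.
Proof.
case: (pickP (@predT V)) => [v _ //|none].
have : #|V| = 0 by apply: eq_card0 => v; have := none v.
by rewrite cardV => /eqP; rewrite expn_eq0 gtn_eqF // prime_gt0.
Qed.

Let v0 := V_inhabited.
Let w0 : W := 1%g.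
Let vx i := nth v0 (enum V) i.
Let sx i := nth w0 s i.

Lemma size_enumV : size (enum V) = n. Proof. by rewrite -cardE cardV. Qed.
Lemma size_M : size M = n. Proof. by rewrite size_map size_enumV. Qed.
Lemma size_s : size s = n. Proof. exact: size_elements. Qed.

Lemma cg_sym : symmetric cg.
Proof. by move=> x y; rewrite /commuting_graph /= eq_sym [(x * y == _)%g]eq_sym. Qed.

Lemma cg_irr : irreflexive cg.
Proof. by move=> x; rewrite /commuting_graph /= eqxx. Qed.

Lemma label_graphE : label_graph M =
  if all (fun i => i < n) (run n)
  then Pair (enc_seq (enc_seq enc_nat) (mul_table s))
            (enc_seq enc_nat [seq index i (run n) | i <- iota 0 n])
  else Leaf.
Proof.
rewrite /label_graph /matching /model_elements /greedy size_M.
have -> : smallest_factor n = p by apply: smallest_factor_primeX; rewrite ?addn1.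
by rewrite commuting_matrixE // code_tableE.
Qed.

Lemma adjV i j : i < n -> j < n -> adj M i j = e (vx i) (vx j).
Proof. by move=> il jl; rewrite (adjE _ v0) ?size_enumV. Qed.

Lemma adjW i j : i < n -> j < n -> adj M0 i j = cg (sx i) (sx j).
Proof. by move=> il jl; rewrite (adjE _ w0) ?size_s. Qed.

Lemma index_lt v : index v (enum V) < n.
Proof. by rewrite -size_enumV index_mem mem_enum. Qed.

Lemma vx_index v : vx (index v (enum V)) = v.
Proof. by rewrite /vx nth_index ?mem_enum. Qed.

Lemma index_vx i : i < n -> index (vx i) (enum V) = i.
Proof. by move=> il; rewrite index_uniq ?enum_uniq ?size_enumV. Qed.

(** Every choice has been checked against all the earlier ones, which covers each pair of vertices
    once; symmetry of both graphs does the rest. *)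
Lemma run_sound : all (fun i => i < n) (run n) ->
  exists g : V -> W, commuting_labelling e g /\
    [seq index (g v) s | v <- enum V] = [seq index i (run n) | i <- iota 0 n].
Proof.
move=> lt; have ltM : all (fun i => i < size M) (run n) by rewrite size_M.
have un : uniq (run n) := run_uniq ltM; have sz : size (run n) = n := size_run M M0 n.
have sub : {subset run n <= iota 0 n} by move=> i /(allP lt); rewrite mem_iota.
have [_ eqr] := uniq_min_size un sub (ltac:(by rewrite size_iota sz)).
have idx_lt i : i < n -> index i (run n) < n.
  by move=> il; rewrite -[X in _ < X]sz index_mem eqr mem_iota.
pose g v := sx (index (index v (enum V)) (run n)).
have gidx v : index (g v) s = index (index v (enum V)) (run n).
  by rewrite index_uniq ?size_s ?idx_lt ?index_lt // elements_uniq.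
have ginj : injective g.
  move=> u v /(congr1 (index^~ s)); rewrite !gidx => /(congr1 (nth 0 (run n))).
  rewrite !nth_index ?eqr ?mem_iota ?index_lt // => /(congr1 vx).
  by rewrite !vx_index.
exists g; split; last first.
  have -> : iota 0 n = [seq index v (enum V) | v <- enum V].
    apply: (@eq_from_nth _ 0) => [|i]; first by rewrite size_iota size_map -cardE cardV.
    rewrite size_iota => il.
    by rewrite nth_iota // (nth_map v0) ?size_enumV // -/(vx i) index_vx.
  by rewrite -[RHS]map_comp; apply: eq_map => v; apply: gidx.
split.
  by apply: inj_card_bij => //; rewrite card_heis // cardV.
have half i j : i < j -> j < n -> e (vx (nth 0 (run n) j)) (vx (nth 0 (run n) i)) = cg (sx j) (sx i).
  move=> ij jn; have iin := ltn_trans ij jn.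
  have [jlt] := run_fits ltM jn; have [ilt _] := run_fits ltM iin.
  rewrite size_M in jlt ilt; case/andP=> _ /allP/(_ i).
  rewrite size_run mem_iota ij => /(_ isT)/eqP.
  have -> : nth 0 (iter j (greedy_step M M0) [::]) i = nth 0 (run n) i.
    by rewrite -(take_run M M0 (ltnW jn)) nth_take.
  by rewrite adjV // adjW.
move=> u v; set i := index (index u (enum V)) (run n); set j := index (index v (enum V)) (run n).
have Eu : vx (nth 0 (run n) i) = u by rewrite nth_index ?vx_index // eqr mem_iota index_lt.
have Ev : vx (nth 0 (run n) j) = v by rewrite nth_index ?vx_index // eqr mem_iota index_lt.
have il : i < n by rewrite idx_lt ?index_lt.
have jl : j < n by rewrite idx_lt ?index_lt.
rewrite -{1}Eu -{1}Ev /g -/i -/j; case: (ltngtP i j) => [ij|ji|->].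
- by rewrite e_sym half // cg_sym.
- by rewrite half.
- by rewrite e_irr cg_irr.
Qed.

Definition isomorphism (h : V -> W) := bijective h /\ forall u v, e u v = cg (h u) (h v).

Lemma cgE (x y : W) : cg x y = (x != y) && (sform x.1 y.1 == 0%R).
Proof. by rewrite /commuting_graph /= heis_commuteP. Qed.

Lemma universalW j : j < n -> universal M0 j = ((sx j).1 == 0%R).
Proof.
move=> jn; rewrite (universalE _ w0) ?size_s ?elements_uniq //.
apply/allP/eqP => [H|z w _]; last first.
  rewrite cgE -/(sx j) z; case: (eqVneq w (sx j)) => [_|ne]; first by rewrite orbT.
  by rewrite sform0l eqxx.
apply: sform_nondeg => t; have := H (t, 0%R) (ltac:(by apply: mem_all_elements)).
rewrite cgE -/(sx j) => /orP[/andP[_ /eqP]|/eqP <-] //; exact: sformvv.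
Qed.

Lemma universalV h i : isomorphism h -> i < n -> universal M i = ((h (vx i)).1 == 0%R).
Proof.
move=> [bh he] il; rewrite (universalE _ v0) ?size_enumV ?enum_uniq //.
have [k kh hk] := bh.
apply/allP/eqP => [H|z v _]; last first.
  rewrite he cgE -/(vx i) z -(inj_eq (bij_inj bh)); case: (eqVneq (h v)) => [_|ne]; first by rewrite orbT.
  by rewrite sform0l eqxx.
apply: sform_nondeg => t; have := H (k (t, 0%R)) (mem_enum _ _).
rewrite he cgE -/(vx i) hk => /orP[/andP[_ /eqP]|/eqP <-] //; rewrite hk; exact: sformvv.
Qed.

Lemma elements_good j : j < n ->
  @good p r [seq x.1 | x <- take j s] (sx j).1.
Proof.
have o0 : (Ordinal (ltnW r_gt1) : nat) = 0 by [].
move=> jn; apply: (elements_split p_pr p_odd r_gt1 o0 (s2 := drop j.+1 s)).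
by rewrite -[LHS](cat_take_drop j) (drop_nth w0) // size_s.
Qed.

(** Whatever choices were made, they extend to an isomorphism: [elements_good] moves the next
    choice to its intended place by a symmetry of the model that keeps the earlier choices within
    their classes of twins. *)
Lemma run_complete j : (exists h, isomorphism h) -> j <= n ->
  all (fun i => i < n) (run j) /\
  exists h, isomorphism h /\ forall i, i < j -> h (vx (nth 0 (run j) i)) = sx i.
Proof.
move=> ex; elim: j => [|j IH] jn; first by split=> //; have [h ih] := ex; exists h.
have [lt [h [[bh he] hx]]] := IH (ltnW jn).
have [k kh hk] := bh; have sj := size_run M M0 j; rewrite -/(run j) in sj.
have ltn i : i < j -> nth 0 (run j) i < n by move=> ij; apply: (allP lt); rewrite mem_nth ?sj.
have us : uniq s by apply: elements_uniq.
have hasf : has (fits M M0 (run j)) (iota 0 (size M)).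
  apply/hasP; exists (index (k (sx j)) (enum V)); first by rewrite mem_iota size_M index_lt.
  rewrite /fits sj -andbA; apply/and3P; split.
  - apply/negP => /(nthP 0)[i]; rewrite sj => ij E.
    have := hx i ij; rewrite E vx_index hk => /eqP.
    by rewrite nth_uniq ?size_s ?(ltn_trans ij) // gtn_eqF.
  - by rewrite (universalV (conj bh he)) ?index_lt // vx_index hk universalW.
  apply/allP => i; rewrite mem_iota => /= ij.
  rewrite adjV ?index_lt ?ltn // adjW ?(ltn_trans ij) // he vx_index hk hx //.
set y := find (fits M M0 (run j)) (iota 0 (size M)).
have yn : y < n by rewrite -size_M -[X in _ < X](size_iota 0) -has_find.
have runE : run j.+1 = rcons (run j) y by [].
have := nth_find 0 hasf; rewrite -/y nth_iota ?size_M // add0n => /andP[/andP[ynin yu] ya].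
rewrite sj in yu ya.
split; first by rewrite runE all_rcons yn.
have y_s i : i < j -> h (vx y) != sx i.
  move=> ij; rewrite -(hx i ij) (inj_eq (bij_inj bh)); apply: contra ynin => /eqP E.
  by rewrite -(index_vx yn) E index_vx ?ltn // mem_nth ?sj.
have [|t|f [[bf fP] fpre fm]] := @elements_good j jn (h (vx y)).1.
- by rewrite -universalV // (eqP yu) universalW.
- case/mapP => x /(nthP w0)[i]; rewrite size_take size_s jn => ij <- ->.
  rewrite nth_take // -/(sx i).
  have := allP ya i; rewrite mem_iota ij => /(_ isT)/eqP.
  rewrite adjV ?ltn // adjW ?(ltn_trans ij) // he hx // !cgE y_s //.
  by rewrite nth_uniq ?size_s ?(ltn_trans ij) // gtn_eqF.
pose xs i := vx (nth 0 (run j.+1) i).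
have nthr i : i < j -> nth 0 (run j.+1) i = nth 0 (run j) i.
  by move=> ij; rewrite runE nth_rcons sj ij.
have nthy : nth 0 (run j.+1) j = y by rewrite runE nth_rcons sj ltnn eqxx.
pose cm (u w : W) := sform u.1 w.1 == 0%R.
have [|||||h' [bh' ch' h'x]] := @exact_of_twins V W cm nat (f \o h) xs sx (iota 0 j.+1).
- exact: bij_comp.
- exact: iota_uniq.
- move=> a b; rewrite !mem_iota /= => aj bj /(congr1 (index^~ (enum V))).
  have lt' i : i < j.+1 -> nth 0 (run j.+1) i < n.
    by rewrite ltnS leq_eqVlt => /predU1P[->|ij]; rewrite ?nthy // nthr ?ltn.
  rewrite /xs !index_vx ?lt' // => /eqP; rewrite nth_uniq ?size_run // => [/eqP //|].
  by apply: run_uniq; rewrite size_M -/(run j.+1) runE all_rcons yn.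
- move=> a b; rewrite !mem_iota /= !ltnS => aj bj /eqP.
  by rewrite nth_uniq ?size_s ?(leq_ltn_trans _ jn) // => /eqP.
- move=> i; rewrite mem_iota /= ltnS leq_eqVlt => /predU1P[->|ij] w /=; rewrite /cm.
    by rewrite /xs nthy [h _]surjective_pairing fm.
  rewrite /xs nthr // hx // [sx i]surjective_pairing fpre //.
  apply: (map_f (fun x : W => x.1)); rewrite -[X in X \in _](nth_take w0 ij).
  by rewrite mem_nth // size_take size_s jn.
exists h'; split; last by move=> i ij; apply: h'x; rewrite mem_iota.
split=> // u v; rewrite he !cgE (inj_eq (bij_inj bh)) (inj_eq (bij_inj bh')); congr (_ && _).
have := ch' u (h' v); rewrite /cm /= => ->.
have := ch' v ((f \o h) u); rewrite /cm /= sform_opp oppr_eq0 => ->.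
by rewrite fP sform_opp oppr_eq0.
Qed.

Lemma label_graph_correct : correct_answer (p ^ (2 * r + 1)) e (label_graph M).
Proof.
have exW : extraspecial [set: W] by apply: heis_extraspecial => //; apply: ltnW.
have iso_ex : is_extraspecial_commuting_graph (p ^ (2 * r + 1)) e -> all (fun i => i < n) (run n).
  case=> gT [g [[exG cardG] [bg ge]]].
  suff ex : exists h, isomorphism h by have [] := run_complete ex (leqnn n).
  have [//|k [[k' kk' k'k] ck _ _]] := @extraspecial_labelling gT p r p_pr exG cardG 0
    (fun=> 1%g) (fun=> 1%g) (leq0n r).
  have bk' : bijective k' by exists k.
  exists (k' \o g); split; first exact: bij_comp.
  move=> u v; rewrite ge /commuting_graph /= (inj_eq (bij_inj bk')); congr (_ && _).
  by rewrite -{1 2}(k'k (g u)) -{1 2}(k'k (g v)) ck.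
rewrite label_graphE; split=> [/[dup] /iso_ex lt _|nex].
  rewrite lt; have [g [gl idx]] := run_sound lt.
  exists (heis p r), s, g; split=> //; first by split; [exact: exW | exact: card_heis].
    exact: perm_elements.
  by rewrite /enc_labelling idx.
case: ifP => // /run_sound[g [gl _]]; case: nex; exists (heis p r), g; split=> //.
by split; [exact: exW | exact: card_heis].
Qed.

End Correctness.

Theorem theorem7p13 :
  exists (c : cmd) (a k : nat),
    forall (p r : nat), prime p -> odd p -> 2 <= r ->
    forall (V : finType) (e : rel V),
      symmetric e -> irreflexive e -> #|V| = p ^ (2 * r + 1) ->
      exists (t : nat) (out : tree),
        [/\ computes c (enc_graph e) t out,
            t <= a * tree_size (enc_graph e) ^ k
          & correct_answer (p ^ (2 * r + 1)) e out].
Proof.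
have [C [N [[a [k bN]] HC]]] := ptime_label_graph.
exists (C 0), a, k => p r pp po r2 V e es ei cV.
pose M := [seq [seq e u v | v <- enum V] | u <- enum V].
have [t [s [ex out _ le]]] := HC 0 (upd (fun=> Leaf) 0 (enc_graph e)) M erefl.
exists t, (label_graph M); split; last exact: label_graph_correct.
  by exists s.
exact: leq_trans le (bN M).
Qed.
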